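(* Consider SWFPP with i.i.d. horizontal weights of law $\mathrm{Ber}(p)\mathrm{Exp}(\alpha)$ ($0<p\le1$, $\alpha>0$) or $\mathrm{Ber}(p)$ ($0<p<1$). Then $$\mathbb{P}(\xi^*(0)>\xi^*(e_2))=\tfrac13,\qquad \mathbb{P}(\xi^*(0)=\xi^*(e_2))=\tfrac16,\qquad \mathbb{P}(\xi^*(0)<\xi^*(e_2))=\tfrac12.$$
   Context: SWFPP: directed edge-weight FPP on $\mathbb{Z}^2$, zero weights on vertical edges, i.i.d. non-negative weights on horizontal edges; $L(x,y)$ is the minimal weight sum over up-right paths. $\mathrm{Ber}(p)\mathrm{Exp}(\alpha)$ is the law of $BE$ with $B\sim\mathrm{Ber}(p)$, $E\sim\mathrm{Exp}(\alpha)$ independent. Directions $\mathscr U=\{(t,1-t):0<t<1\}$ are ordered by first coordinate ($\xi>\zeta$ iff $\xi\cdot e_1>\zeta\cdot e_1$, i.e. closer to horizontal). $B^{\xi\pm}(x,y)$ denote the north-east Busemann functions: $B^\xi(x,y)=\lim_n(L(x,v_n)-L(y,v_n))$ along $|v_n|\to\infty$, $v_n/|v_n|\to\xi$, with $B^{\xi\pm}$ their one-sided limits in $\xi$ (these exist for all $\xi$ a.s.). The critical angle at $x$ is $\xi^*(x)=\sup\{\xi\in\mathscr U:B^{\xi}(x,x+e_2)=0\}$, equivalently the asymptotic direction of the competition interface between the subtrees through $x+e_1$ and $x+e_2$ of the geodesic tree rooted at $x$. *)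

(* Defs.v *)
From HB Require Import structures.
From mathcomp Require Import all_boot all_order all_algebra.
From mathcomp Require Import all_classical all_reals all_analysis.
Set Implicit Arguments.
Unset Strict Implicit.
Unset Printing Implicit Defensive.
Import Order.TTheory GRing.Theory Num.Theory.
Import numFieldNormedType.Exports.
Local Open Scope classical_set_scope.
Local Open Scope ring_scope.

Definition site := (int * int)%type.
Definition e1 : site := (1%Z, 0%Z).
Definition e2 : site := (0%Z, 1%Z).
Definition sadd (x y : site) : site := (x.1 + y.1, x.2 + y.2)%R.

Section SWFPP.
Variable R : realType.

(* Environment: w x = weight of the horizontal edge x -> x + e1;
   vertical edges x -> x + e2 have weight 0. *)

Fixpoint path_end (x : site) (s : seq bool) : site :=
  match s with
  | [::] => x
  | b :: s' => path_end (sadd x (if b then e1 else e2)) s'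
  end.

Fixpoint path_weight (w : site -> R) (x : site) (s : seq bool) : R :=
  match s with
  | [::] => 0
  | b :: s' =>
      if b then w x + path_weight w (sadd x e1) s'
      else path_weight w (sadd x e2) s'
  end.

(* Last-passage-type minimal weight L(x,y) over up-right paths x -> y
   (a finite minimum, written as an infimum). *)
Definition L (w : site -> R) (x y : site) : R :=
  inf [set path_weight w x s | s in [set s | path_end x s = y]].

Definition l1 (v : site) : R := ((`|v.1| + `|v.2|)%N)%:R.

(* B^xi(x,y) = b for xi = (t, 1-t): along every v_n with |v_n| -> oo and
   v_n/|v_n| -> xi, L(x,v_n) - L(y,v_n) -> b. *)
Definition busemann_is (w : site -> R) (t : R) (x y : site) (b : R) : Prop :=
  forall v : nat -> site,
    (fun n => l1 (v n)) @ \oo --> +oo ->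
    (fun n => ((v n).1)%:~R / l1 (v n)) @ \oo --> t ->
    (fun n => ((v n).2)%:~R / l1 (v n)) @ \oo --> 1 - t ->
    (fun n => L w x (v n) - L w y (v n)) @ \oo --> b.

(* Critical angle xi*(x) = sup{ xi in U : B^xi(x, x+e2) = 0 },
   identified with its first coordinate (the order on U). *)
Definition crit_angle (w : site -> R) (x : site) : R :=
  sup [set t : R | 0 < t < 1 /\ busemann_is w t x (sadd x e2) 0].

Definition law_BerExp (p a : R) (A : set R) : \bar R :=
  ((1 - p)%:E * \d_(0%R : R) A +
   p%:E * \int[lebesgue_measure]_(t in A `&` [set t : R | (0 <= t)%R])
            (a * expR (- (a * t)))%R%:E)%E.

Definition law_Ber (p : R) (A : set R) : \bar R :=
  ((1 - p)%:E * \d_(0%R : R) A + p%:E * \d_(1%R : R) A)%E.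

Section Prob.
Context (d : measure_display) (T : measurableType d) (P : probability T R).

Definition has_law (X : T -> R) (mu : set R -> \bar R) : Prop :=
  forall A : set R, measurable A -> P (X @^-1` A) = mu A.

Definition mutually_independent {I : eqType} (X : I -> T -> R) : Prop :=
  forall (s : seq I) (A : I -> set R), uniq s ->
    (forall i, measurable (A i)) ->
    P (\bigcap_(i in [set` s]) (X i @^-1` A i)) =
    (\prod_(i <- s) P (X i @^-1` A i))%E.

Definition iid_with_law {I : eqType} (X : I -> T -> R)
  (mu : set R -> \bar R) : Prop :=
  (forall i, measurable_fun setT (X i)) /\
  (forall i, has_law (X i) mu) /\ mutually_independent X.
End Prob.
End SWFPP.

(* Main.v *)
Require Import Defs.
From HB Require Import structures.
From mathcomp Require Import all_boot all_order all_algebra.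
From mathcomp Require Import all_classical all_reals all_analysis.
From mathcomp Require Import measurable_realfun ring lra zify.
Set Implicit Arguments.
Unset Strict Implicit.
Unset Printing Implicit Defensive.
Import Order.TTheory GRing.Theory Num.Theory.
Import numFieldNormedType.Exports.
Local Open Scope classical_set_scope.
Local Open Scope ring_scope.

(* Parametrise boundary laws by 0 < u < 1. A local move, which preserves the product law
   of (bottom edge, left edge, fresh weight), turns i.i.d. boundary edges of parameter u
   into i.i.d. weights together with a stationary height F solving
   F(x) = min(w(x) + F(x + e1), F(x + e2)), whose increment along e2 vanishes with
   probability 1 - u. Stacking two such layers with parameters v < u, and subtracting the
   content of a store from the first height, gives the heights of both parameters for the
   same weights; at the origin their increments are explicit functions of independent
   variables. Comparing heights with passage times, by the weak law of large numbers at the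
   scales l^2, shows that the height of parameter u is the Busemann function in a direction
   tau(u), increasing in u. So an increment at x vanishes iff xi*(x) is beyond tau(u).
   The cells (xi*(0) in [tau(v), tau(u)] and xi*(e2) beyond, the converse, both inside)
   have probability at least (u - v)(1 - u), (u - v)(1 - u)(1 - v) and (u - v) u (1 - v).
   Summed over a fine partition these give 1/2, 1/3 and 1/6, which add up to 1, so that
   the three lower bounds are equalities. *)

(** * The local move *)

Section LocalMove.
Variable R : realType.
Implicit Types x y q g r b h z : R.

Definition pos x : R := Num.max x 0.
Definition neg x : R := Num.max (- x) 0.

Lemma pos_ge0 x : 0 <= pos x. Proof. by rewrite le_max lexx orbT. Qed.
Lemma neg_ge0 x : 0 <= neg x. Proof. by rewrite le_max lexx orbT. Qed.

Lemma posP x : (0 <= x /\ pos x = x /\ neg x = 0) \/ (x < 0 /\ pos x = 0 /\ neg x = - x).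
Proof.
rewrite /pos /neg; case: (leP x 0) => h; case: (leP (- x) 0) => h'; by [left; lra | right; lra].
Qed.

Lemma minP x y : (x <= y /\ Num.min x y = x) \/ (y < x /\ Num.min x y = y).
Proof.
by case: (leP x y) => h; [left|right].
Qed.

(* Around a unit square, [q] and [g] are the weights of the bottom and left
   edges and [r] is fresh; the outputs are the top edge, the right edge and the
   weight of the bottom edge. *)
Definition top q g r : R := if q + pos g == 0 then 0 else Num.min r (q + pos g).
Definition right q g r : R := if q + pos g == 0 then g else q + pos g - r.
Definition dual q g r : R := if q + pos g == 0 then r else q + neg g.

Lemma moveP q g r : 0 <= q -> 0 <= r ->
  [/\ 0 <= top q g r, 0 <= dual q g r &
      q + pos g = top q g r + pos (right q g r)].
Proof.
move=> q0 r0; rewrite /top /right /dual; case: ifPn => [/eqP X0|X0].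
  have g0 := pos_ge0 g; have -> : pos g = 0 by lra.
  by have -> : q = 0 by lra.
have g0 := pos_ge0 g; have n0 := neg_ge0 g.
have [[? ->]|[? ->]] := minP r (q + pos g);
  have [[? [-> _]]|[? [-> _]]] := posP (q + pos g - r); split; lra.
Qed.

Lemma topE q g r : 0 <= q -> 0 <= r -> top q g r = Num.min r (q + pos g).
Proof.
by move=> q0 r0; rewrite /top; case: ifPn => // /eqP ->; rewrite min_r.
Qed.

Lemma dual_ge q g r : 0 <= q -> 0 <= r -> q <= dual q g r.
Proof.
move=> q0 r0; rewrite /dual; have := pos_ge0 g; have := neg_ge0 g.
by case: ifPn => [/eqP X0|X0] ? ?; lra.
Qed.

Lemma dual_pos q g r : 0 <= q -> 0 < pos g -> dual q g r = q.
Proof.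
move=> q0 g0; rewrite /dual; case: ifPn => [/eqP X0|X0]; first by lra.
by have [[? [_ ->]]|[? [E _]]] := posP g; lra.
Qed.

(* Both sides are the content of the store one row up and one column to the left of [z],
   computed leftwards first or upwards first. *)
Lemma yang_baxter q g b h r z (R1 := dual b h r) :
  0 <= q -> 0 <= b -> 0 <= r -> 0 <= z ->
  pos h + pos (pos (z + b - q) - pos g) =
  pos (pos (right b h r) + pos (z - pos (right q g R1)) + top b h r - top q g R1).
Proof.
move=> q0 b0 r0 z0.
have [_ R10 e1] := moveP h b0 r0.
have [q'0 _ e3] := moveP g q0 R10.
have -> : pos (right b h r) + pos (z - pos (right q g R1)) + top b h r - top q g R1
  = b + pos h - top q g R1 + pos (z - (q + pos g - top q g R1)).
  have -> : pos (right q g R1) = q + pos g - top q g R1 by lra.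
  lra.
rewrite topE //.
have Rb : b <= R1 by apply: dual_ge.
have HR : pos h = 0 \/ R1 = b.
  have := pos_ge0 h; rewrite le_eqVlt => /orP[/eqP <-|h0]; [by left|right].
  exact: dual_pos.
have := pos_ge0 h; have := pos_ge0 g; move: (pos h) (pos g) HR => H G HR G0 H0.
move: R1 Rb R10 HR {e1 e3 q'0} => R1 Rb R10 HR.
have [[m1 ->]|[m1 ->]] := minP R1 (q + G);
have [[? [-> _]]|[? [-> _]]] := posP (z + b - q);
[have [[? [-> _]]|[? [-> _]]] := posP (z - (q + G - R1))
|have [[? [-> _]]|[? [-> _]]] := posP (z - (q + G - R1))
|have [[? [-> _]]|[? [-> _]]] := posP (z - (q + G - (q + G)))
|have [[? [-> _]]|[? [-> _]]] := posP (z - (q + G - (q + G)))];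
do ?(match goal with |- context [pos ?a] => have [[? [-> _]]|[? [-> _]]] := posP a end);
by case: HR => HR; lra.
Qed.

End LocalMove.

(** * Stationary heights *)

Section Fields.
Variable R : realType.
Implicit Types (r w b h : nat -> nat -> R).

(* The moves of column [k] are applied upwards; its right edges are the left edges
   of column [k.+1], and the duals of its bottom edges are the weights [w]. *)
Fixpoint column (q : R) (g r0 : nat -> R) j : R :=
  if j is i.+1 then top (column q g r0 i) (g i) (r0 i) else q.

Fixpoint vert (q0 g0 : nat -> R) r k : nat -> R :=
  if k is i.+1 then
    fun j => right (column (q0 i) (vert q0 g0 r i) (r i) j) (vert q0 g0 r i j) (r i j)
  else g0.

Definition horiz (q0 g0 : nat -> R) r k j : R := column (q0 k) (vert q0 g0 r k) (r k) j.

Definition weight (q0 g0 : nat -> R) r k j : R :=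
  dual (horiz q0 g0 r k j) (vert q0 g0 r k j) (r k j).

Definition potential (U V : nat -> nat -> R) k j : R :=
  \sum_(i < j) V k i - \sum_(i < k) U i 0%N.

Lemma potentialV U V k j : potential U V k j.+1 - potential U V k j = V k j.
Proof. by rewrite /potential big_ord_recr /=; ring. Qed.

Lemma potentialU (N : nat) U V :
  (forall k j, (k < N)%N -> U k j + V k j = U k j.+1 + V k.+1 j) ->
  forall k j, (k < N)%N -> potential U V k j - potential U V k.+1 j = U k j.
Proof.
move=> UV k j kN; elim: j => [|j IH].
  by rewrite /potential !big_ord0 big_ord_recr /=; ring.
have := potentialV U V k j; have := potentialV U V k.+1 j; have := UV k j kN.
by lra.
Qed.

Definition busemann_like (N : nat) w (F : nat -> nat -> R) :=
  forall k j, (k < N)%N -> F k j = Num.min (w k j + F k.+1 j) (F k j.+1).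

Section OneLayer.
Variables (q0 g0 : nat -> R) (r : nat -> nat -> R) (N : nat).
Hypothesis q0_ge0 : forall k, (k < N)%N -> 0 <= q0 k.
Hypothesis r_ge0 : forall k j, (k < N)%N -> 0 <= r k j.

Lemma horiz_ge0 k j : (k < N)%N -> 0 <= horiz q0 g0 r k j.
Proof.
move=> kN; elim: j => [|j IH]; first exact: q0_ge0.
by have [] := moveP (vert q0 g0 r k j) IH (r_ge0 j kN).
Qed.

Lemma weight_ge0 k j : (k < N)%N -> 0 <= weight q0 g0 r k j.
Proof.
by move=> kN; have [] := moveP (vert q0 g0 r k j) (horiz_ge0 j kN) (r_ge0 j kN).
Qed.

Lemma horiz_vert k j : (k < N)%N ->
  horiz q0 g0 r k j + pos (vert q0 g0 r k j) =
  horiz q0 g0 r k j.+1 + pos (vert q0 g0 r k.+1 j).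
Proof.
by move=> kN; have [] := moveP (vert q0 g0 r k j) (horiz_ge0 j kN) (r_ge0 j kN).
Qed.

Definition height := potential (horiz q0 g0 r) (fun k j => pos (vert q0 g0 r k j)).

Lemma heightV k j : height k j.+1 - height k j = pos (vert q0 g0 r k j).
Proof. by rewrite /height potentialV. Qed.

Lemma heightU k j : (k < N)%N -> height k j - height k.+1 j = horiz q0 g0 r k j.
Proof. by apply: potentialU k j => k j; exact: horiz_vert. Qed.

Lemma busemann_height : busemann_like N (weight q0 g0 r) height.
Proof.
move=> k j kN; have := heightU j kN; have := heightV k j.
have := dual_ge (vert q0 g0 r k j) (horiz_ge0 j kN) (r_ge0 j kN).
have := @dual_pos _ _ (vert q0 g0 r k j) (r k j) (horiz_ge0 j kN).
rewrite -/(weight q0 g0 r k j); have := pos_ge0 (vert q0 g0 r k j).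
rewrite le_eqVlt => /orP[/eqP <- _|p0 /(_ p0) ->] ? ? ?; rewrite minElt; case: ifP; lra.
Qed.

End OneLayer.

Section TwoLayers.
Variables (q0 g0 b0 h0 : nat -> R) (rr : nat -> nat -> R) (N : nat) (zN : R).
Hypothesis q0_ge0 : forall k, (k < N)%N -> 0 <= q0 k.
Hypothesis b0_ge0 : forall k, (k < N)%N -> 0 <= b0 k.
Hypothesis rr_ge0 : forall k j, (k < N)%N -> 0 <= rr k j.
Let r := weight b0 h0 rr.
Let w := weight q0 g0 r.
Let q := horiz q0 g0 r.
Let b := horiz b0 h0 rr.
Let g := vert q0 g0 r.
Let h := vert b0 h0 rr.

(* the signed content of the store at column [N - i] of row [0] *)
Fixpoint signed_store i : R :=
  if i is i'.+1 then right (b0 (N - i)) (signed_store i') (q0 (N - i)) else zN.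

(* The content of a queue with arrivals [h] and services [g]. Subtracting it from
   the height of the first layer gives a second height function of the weights [w]
   of the top layer, hence two stationary heights of one environment. *)
Fixpoint store k j : R :=
  if j is i.+1 then pos (h k i) + pos (store k i - pos (g k i))
  else pos (signed_store (N - k)).

Lemma store_ge0 k j : 0 <= store k j.
Proof.
by case: j => [|j] /=; rewrite ?addr_ge0 ?pos_ge0.
Qed.

Lemma store_left k j : (k < N)%N -> store k j = pos (store k.+1 j + b k j - q k j).
Proof.
move=> kN; elim: j => [|j IH] /=.
  have -> : (N - k = (N - k.+1).+1)%N by lia.
  rewrite /= /right.
  have -> : (N - (N - k.+1).+1 = k)%N by lia.
  rewrite /q /b /horiz /=.
  have bk := b0_ge0 kN; have qk := q0_ge0 kN; have c0 := pos_ge0 (signed_store (N - k.+1)).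
  case: ifPn => [/eqP e|_]; last by congr pos; ring.
  have -> : pos (signed_store (N - k.+1)) = 0 by lra.
  by have [[? [-> _]]|[? [-> _]]] := posP (0 + b0 k - q0 k); lra.
rewrite IH; have rk j' : 0 <= r k j' by apply: (weight_ge0 h0 b0_ge0 rr_ge0).
apply: yang_baxter; rewrite ?store_ge0 ?rr_ge0 //.
- exact: (horiz_ge0 g0 q0_ge0 (fun k j => weight_ge0 h0 b0_ge0 rr_ge0 (k := k) j)).
- exact: (horiz_ge0 h0 b0_ge0 rr_ge0).
Qed.

Definition height2 k j : R := height b0 h0 rr k j - store k j.

Lemma height2V k j :
  height2 k j.+1 - height2 k j = Num.min (pos (g k j)) (store k j).
Proof.
rewrite /height2 /=; have := heightV b0 h0 rr k j; rewrite -/(h k j).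
have [[? [-> _]]|[? [-> _]]] := posP (store k j - pos (g k j));
have [[? ->]|[? ->]] := minP (pos (g k j)) (store k j); lra.
Qed.

Lemma busemann_height2 : busemann_like N w height2.
Proof.
move=> k j kN; have r0 k' j' (k'N : (k' < N)%N) : 0 <= r k' j'.
  exact: (weight_ge0 h0 b0_ge0 rr_ge0).
have := heightU h0 b0_ge0 rr_ge0 j kN; rewrite -/(b k j) => bE.
have := height2V k j; rewrite /height2 => VE.
have := dual_ge (g k j) (horiz_ge0 g0 q0_ge0 r0 j kN) (r0 k j kN).
have := @dual_pos _ _ (g k j) (r k j) (horiz_ge0 g0 q0_ge0 r0 j kN).
rewrite -/(weight q0 g0 r k j) -/(w k j) -/(q k j); have := pos_ge0 (g k j).
have := store_ge0 k.+1 j; have := store_left j kN; move: VE.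
set S := store k j; set S' := store k.+1 j; set x := _ - store k j.+1.
have [[? [-> _]]|[? [-> _]]] := posP (S' + b k j - q k j) => + SE S'0;
rewrite le_eqVlt => VE /orP[/eqP p0 _|p0 /(_ p0) wE] ?;
move: VE; rewrite -?p0;
do ?(match goal with |- context [Num.min ?a ?c] => have [[? ->]|[? ->]] := minP a c end);
rewrite ?wE => *; lra.
Qed.

End TwoLayers.
End Fields.

(** * Passage times and exit points *)

Ltac split_min := repeat match goal with
  | |- context [Num.min ?a ?b] => have [[? ->]|[? ->]] := minP a b end.

Section PassageTime.
Variable R : realType.
Variable c : nat -> nat -> R.

Fixpoint passage_above r n : nat -> R :=
  if n is n'.+1 then
    fix go m := if m is m'.+1
      then Num.min (go m' + c m' (r + n)%N) (passage_above r n' m) else 0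
  else fun m => \sum_(k < m) c k r.

Definition passage r m n : R := passage_above r (n - r) m.

Lemma passage0 r n : passage r 0 n = 0.
Proof. by rewrite /passage; case: (n - r)%N => //=; rewrite big_ord0. Qed.

Lemma passage_row r m : passage r m.+1 r = passage r m r + c m r.
Proof. by rewrite /passage subnn /= big_ord_recr. Qed.

Lemma passageSS r m n : (r <= n)%N ->
  passage r m.+1 n.+1 = Num.min (passage r m n.+1 + c m n.+1) (passage r m.+1 n).
Proof.
by move=> rn; rewrite /passage subSn //= -addSnnS addSn subnKC.
Qed.

Lemma passage_leS r m n : (r <= n)%N -> passage r m n.+1 <= passage r m n.
Proof.
move=> rn; case: m => [|m]; first by rewrite !passage0.
by rewrite passageSS // ge_min lexx orbT.
Qed.

Lemma passage_le r m n n' : (r <= n)%N -> (n <= n')%N ->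
  passage r m n' <= passage r m n.
Proof.
move=> rn /subnK <-; elim: (n' - n)%N => [|k IH] //.
by rewrite addSn; apply: le_trans IH; rewrite passage_leS // (leq_trans rn) // leq_addl.
Qed.

Lemma passageS_le r m n : (r <= n)%N -> passage r m.+1 n <= passage r m n + c m n.
Proof.
rewrite leq_eqVlt => /orP[/eqP <-|]; first by rewrite passage_row.
by case: n => // n rn; rewrite passageSS // ge_min lexx.
Qed.

Definition gap r m n : R := passage r m n - passage r.+1 m n.

Lemma gap_le0 r m n : (r < n)%N -> gap r m n <= 0.
Proof.
rewrite /gap subr_le0; elim: n m => // n IH m; rewrite ltnS leq_eqVlt => /orP[/eqP <-|rn].
  elim: m => [|m IHm]; first by rewrite !passage0.
  by rewrite passage_row (le_trans (passageS_le _ _)) ?lerD2r.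
elim: m => [|m IHm]; first by rewrite !passage0.
by rewrite !passageSS ?(ltnW rn) // le_min !ge_min lerD2r IHm IH // orbT.
Qed.

Lemma gap_step r n : (r < n)%N ->
  (forall m, gap r m.+1 n <= gap r m n) /\ (forall m, gap r m n <= gap r m n.+1).
Proof.
have J n' : (r < n')%N -> (forall m, gap r m.+1 n' <= gap r m n') ->
    forall m, gap r m n' <= gap r m n'.+1.
  move=> rn I; elim=> [|m]; first by rewrite /gap !passage0.
  have := I m; rewrite /gap !passageSS ?(ltnW rn) // => I' IH.
  by split_min; lra.
elim: n => // n IH; rewrite ltnS leq_eqVlt => /orP[/eqP <-|rn].
  suff I m : gap r m.+1 r.+1 <= gap r m r.+1 by split=> //; exact: J.
  by rewrite /gap passage_row; have := @passageS_le r m r.+1 (leqnSn r); lra.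
have [I0 J0] := IH rn.
suff I m : gap r m.+1 n.+1 <= gap r m n.+1 by split=> //; apply: J => //; exact: ltnW.
have := I0 m; have := J0 m; rewrite /gap !passageSS ?(ltnW rn) // => J' I'.
by split_min; lra.
Qed.

Lemma gap_mono r m n m' n' : (r < n)%N -> (n <= n')%N -> (m' <= m)%N ->
  gap r m n <= gap r m' n'.
Proof.
move=> rn nn' mm'; apply: (@le_trans _ _ (gap r m' n)).
  move: mm' => /subnK <-; elim: (m - m')%N => [|k IH] //.
  by apply: le_trans IH; have [I _] := gap_step rn; rewrite addSn.
move: nn' => /subnK <-; elim: (n' - n)%N => [|k IH] //; apply: (le_trans IH).
by rewrite addSn; have [] := @gap_step r (k + n)%N; rewrite ?(leq_trans rn) ?leq_addl.
Qed.

Lemma passage_row_le r m n : (r <= n)%N -> passage 0 m n <= passage r m n.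
Proof.
elim: r => // r IH rn; apply: (le_trans (IH (ltnW rn))).
by have := @gap_le0 r m n rn; rewrite /gap subr_le0.
Qed.

Lemma passage_ge0 N r m n : (forall k j, (k < N)%N -> 0 <= c k j) -> (m <= N)%N ->
  (r <= n)%N -> 0 <= passage r m n.
Proof.
move=> c0; elim: m n => [|m IH] n mN; first by rewrite passage0.
have row : 0 <= passage r m r -> 0 <= passage r m.+1 r.
  by move=> ?; rewrite passage_row addr_ge0 // c0.
elim: n => [|n IHn]; rewrite leq_eqVlt => /orP[/eqP rE|rn] //.
- by rewrite -rE; apply: row; apply: IH => //; exact: ltnW.
- by rewrite -rE; apply: row; apply: IH => //; exact: ltnW.
- rewrite passageSS // le_min IHn // andbT.
  by apply: addr_ge0; [apply: IH; exact: ltnW|exact: c0].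
Qed.

Section Exit.
Variables (N : nat) (F : nat -> nat -> R).
Hypothesis FB : busemann_like N c F.
Hypothesis Fup : forall k j, F k j <= F k j.+1.

Lemma potential_le k j j' : (j <= j')%N -> F k j <= F k j'.
Proof.
by move=> /subnK <-; elim: (j' - j)%N => [|i IH] //; rewrite (le_trans IH) // addSn.
Qed.

Lemma busemann_passage r m n : (m <= N)%N -> (r <= n)%N ->
  F 0 r <= passage r m n + F m n.
Proof.
elim: m n => [|m IH] n mN rn; first by rewrite passage0 add0r potential_le.
have step n' : F m n' <= c m n' + F m.+1 n' by rewrite (FB n' mN) ge_min lexx.
move: rn; elim: n => [|n IHn]; rewrite leq_eqVlt => /orP[/eqP rE|rn] //.
- have := IH r (ltnW mN) (leqnn r); have := step r.
  by rewrite rE passage_row -rE; lra.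
- have := IH r (ltnW mN) (leqnn r); have := step r.
  by rewrite -rE passage_row; lra.
- rewrite passageSS //; have := IHn rn; have := Fup m.+1 n.
  have := IH n.+1 (ltnW mN) (ltnW rn); have := step n.+1.
  by split_min; lra.
Qed.

(* The minimiser in the recursion for [F] is followed until it leaves the box. *)
Lemma busemann_exit r M H : (M <= N)%N -> (r <= H)%N ->
  exists m n, [/\ (r <= n)%N, (m = M /\ (n <= H)%N) \/ ((m <= M)%N /\ n = H) &
    passage r m n + F m n <= F 0 r].
Proof.
move=> MN rH.
suff [m [n [rn mM nH E]]] : exists m n, [/\ (r <= n)%N, (m <= M)%N, (n <= H)%N &
    ((m == M) || (n == H) || (M + H <= m + n)%N) /\ passage r m n + F m n <= F 0 r].
  exists m, n; split => //; last by case: E.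
  case: E => /orP[/orP[/eqP mE|/eqP nE]|s] _; [by left|by right|left].
  by split=> //; lia.
have : forall s, exists m n, [/\ (r <= n)%N, (m <= M)%N, (n <= H)%N &
    ((m == M) || (n == H) || (s <= m + n)%N) /\ passage r m n + F m n <= F 0 r].
  elim=> [|s [m [n [rn mM nH [/orP[C|ge] E]]]]].
  - by exists 0%N, r; split=> //; split; rewrite ?orbT // passage0 add0r.
  - by exists m, n; split=> //; split=> //; rewrite C.
  have [mE|mM'] := eqVneq m M; first by exists m, n; rewrite mE eqxx; split=> //; rewrite -mE.
  have [nE|nH'] := eqVneq n H; first by exists m, n; rewrite nE eqxx orbT; split=> //; rewrite -nE.
  have mN : (m < N)%N by lia.
  have := FB n mN; case: (leP (c m n + F m.+1 n) (F m n.+1)) => _ FE.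
  - exists m.+1, n; split=> //; [lia|split; first by rewrite addSn ltnS ge orbT].
    by have := @passageS_le r m n rn; lra.
  - exists m, n.+1; split=> //; [lia|lia|split; first by rewrite addnS ltnS ge orbT].
    by have := @passage_leS r m n rn; lra.
by apply.
Qed.

Section Bounds.
Variables (M d I H : nat) (mq ma mq' ma' e : R).
Hypothesis MN : (M <= N)%N.
Hypothesis IH : (I * d <= H)%N.
Hypothesis c_ge0 : forall k j, (k < N)%N -> 0 <= c k j.
Hypothesis Fleft : forall k j, (k < N)%N -> F k.+1 j <= F k j.
Hypothesis Fmean : forall k, (k <= I)%N ->
  F 0 0 - F M (k * d)%N <= M%:R * mq - (k * d)%:R * ma + e.
Hypothesis Fstart : forall r, (r <= 2)%N -> F 0 r <= F 0 0 + e.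
Hypothesis top_lt0 : M%:R * mq - (I * d)%:R * ma + 2 * e < 0.
Hypothesis d_gt0 : (0 < d)%N.
Hypothesis H2 : (2 <= H)%N.

Lemma exit_window r : (r <= 2)%N ->
  exists i k, [/\ (r <= i)%N, (k * d <= i < k.+1 * d)%N, (k < I)%N,
    passage r M i + F M i <= F 0 r &
    passage 0 M (k.+1 * d) <= M%:R * mq - (k * d)%:R * ma + 2 * e].
Proof.
move=> r2; have [m [n [rn C E]]] := busemann_exit MN (leq_trans r2 H2).
have Fdec m' j : (m' <= M)%N -> F M j <= F m' j.
  move=> m'M; have -> : (M = (M - m') + m')%N by lia.
  have : ((M - m') + m' <= N)%N by lia.
  elim: (M - m')%N => [|k IHk] // kN; rewrite addSn.
  by apply: le_trans (IHk _); [apply: Fleft; lia | lia].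
have contra m' n' : (r <= n')%N -> (m' <= M)%N -> (I * d <= n')%N ->
    passage r m' n' + F m' n' <= F 0 r -> False.
  move=> rn' m'M In' E'; have := Fstart r2; have := Fmean (leqnn I).
  have := Fdec m' n' m'M; have := potential_le M In'.
  have := @passage_ge0 N r m' n' c_ge0 (leq_trans m'M MN) rn'.
  by move: top_lt0 E'; lra.
case: C => [[mE nH]|[mM nE]]; last by case: (contra m n) => //; rewrite nE.
subst m; case: (leqP (I * d) n) => [In|nI]; first by case: (contra M n).
exists n, (n %/ d)%N; have kd := leq_trunc_div n d; have kd' := ltn_ceil n d_gt0.
have kI : (n %/ d < I)%N by rewrite ltn_divLR.
split=> //; first by rewrite kd kd'.
have := Fmean (ltnW kI); have := Fstart r2; have := potential_le M kd.
have := @passage_row_le r M n rn; have := passage_le (r := 0) M (leq0n n) (ltnW kd').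
by move: E; lra.
Qed.

Hypothesis Lmean : forall k, (k <= I)%N ->
  M%:R * mq' - (k * d)%:R * ma' - e <= passage 0 M (k * d).

Lemma gap_ge_increment r n y : (r < 2)%N -> ma' < ma -> 0 <= ma' ->
  M%:R * (mq - mq') + d%:R * ma + 3 * e <= M%:R * y * (ma - ma') ->
  M%:R * y <= n%:R -> F 0 r - F 0 r.+1 <= gap r M n.
Proof.
move=> r2 ma'ma ma'0 key yn.
have [i [k [ri /andP[ki ik] kI E B]]] := @exit_window r.+1 r2.
have L := Lmean kI.
have le_in : (i <= n)%N.
  apply: (leq_trans (ltnW ik)); rewrite -(ler_nat R); apply: le_trans yn.
  rewrite -(ler_pM2r (x := ma - ma')) ?subr_gt0 //; apply: le_trans key.
  by move: L B; rewrite mulSn natrD; set K := (k * d)%:R; nra.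
apply: (@le_trans _ _ (gap r M i)); last exact: gap_mono.
by have := @busemann_passage r M i MN (ltnW ri); rewrite /gap; lra.
Qed.

Lemma gap_le_increment r n y : (r < 2)%N -> (r < n)%N -> ma < ma' ->
  M%:R * y * (ma' - ma) + d%:R * ma' + 3 * e <= M%:R * (mq' - mq) ->
  n%:R <= M%:R * y -> gap r M n <= F 0 r - F 0 r.+1.
Proof.
move=> r2 rn ma'ma key yn.
have [i [k [ri /andP[ki ik] kI E B]]] := @exit_window r (ltnW r2).
have L := Lmean kI.
have le_ni : (n <= i)%N.
  apply: leq_trans ki; rewrite -(ler_nat R); apply: (le_trans yn).
  rewrite -(ler_pM2r (x := ma' - ma)) ?subr_gt0 //.
  by move: L B; rewrite mulSn natrD; set K := (k * d)%:R; nra.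
apply: (@le_trans _ _ (gap r M i)); first exact: gap_mono.
have := @busemann_passage r.+1 M i MN (leq_trans rn le_ni); rewrite /gap; lra.
Qed.

End Bounds.
End Exit.
End PassageTime.

(** * Independent families *)

Lemma pushforward_measure d d1 (T : measurableType d) (T1 : measurableType d1)
    (R : realType) (m : {measure set T -> \bar R}) (f : T -> T1) :
  measurable_fun setT f ->
  exists nu : {measure set T1 -> \bar R}, forall B, nu B = m (f @^-1` B).
Proof.
move=> mf.
by unshelve refine (ex_intro _ [the {measure set T1 -> \bar R} of pushforward m f] _).
Qed.

Section ProductProbability.
Context d1 d2 (T1 : measurableType d1) (T2 : measurableType d2) (R : realType).
Variables (m1 : probability T1 R) (m2 : probability T2 R).
Local Open Scope ereal_scope.

Let prod := m1 \x m2.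

HB.instance Definition _ := Measure.on prod.

Let prod_setT : prod setT = 1.
Proof.
rewrite -setXTT /prod product_measure1E //; transitivity (1 * 1 : \bar R); last by rewrite mule1.
by congr (_ * _); exact: probability_setT.
Qed.

HB.instance Definition _ := Measure_isProbability.Build _ _ _ prod prod_setT.

Definition prodP : probability (T1 * T2)%type R := prod.

Lemma prodPE A B : measurable A -> measurable B -> prodP (A `*` B) = m1 A * m2 B.
Proof. exact: product_measure1E. Qed.

End ProductProbability.

Section JointLaw.
Context d d1 d2 (T : measurableType d) (T1 : measurableType d1)
  (T2 : measurableType d2) (R : realType).
Local Open Scope ereal_scope.

Lemma joint_law (m : {measure set T -> \bar R}) (k : {nonneg R})
    (m1 : probability T1 R) (m2 : probability T2 R) (f : T -> T1) (g : T -> T2) :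
  m setT < +oo -> measurable_fun setT f -> measurable_fun setT g ->
  (forall A B, measurable A -> measurable B ->
    m (f @^-1` A `&` g @^-1` B) = k%:num%:E * (m1 A * m2 B)) ->
  forall E, measurable E ->
    m ((fun t => (f t, g t)) @^-1` E) = k%:num%:E * prodP m1 m2 E.
Proof.
move=> moo mf mg mAB E mE.
have mfg : measurable_fun setT (fun t => (f t, g t)) by exact: measurable_fun_pair.
have [nu1 nu1E] := pushforward_measure m mfg.
pose nu2 : {measure set (T1 * T2) -> \bar R} := mscale k (prodP m1 m2).
rewrite -nu1E; change (nu1 E = nu2 E).
pose G : set (set (T1 * T2)) :=
  [set C | exists A, measurable A /\ exists B, measurable B /\ C = A `*` B].
apply: (measure_unique G (fun _ => setT)) => //.
- rewrite measurable_prod_measurableType //; congr (<<s _ >>).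
  rewrite predeqE; split => [[A mA [B mB <-]]|[A [mA [B [mB ->]]]]].
    by exists A; split => //; exists B.
  by exists A => //; exists B.
- move=> /= _ _ [X1 [mX1 [X2 [mX2 ->]]]] [Y1 [mY1 [Y2 [mY2 ->]]]].
  rewrite -setXI; exists (X1 `&` Y1); split; first exact: measurableI.
  by exists (X2 `&` Y2); split => //; exact: measurableI.
- by move=> _; exists setT; split => //; exists setT; split => //; rewrite setXTT.
- by rewrite bigcup_const.
- move=> C [A [mA [B [mB ->]]]]; rewrite nu1E /nu2 /= /mscale /=.
  by rewrite [product_measure1 _ _ _]prodPE // -mAB.
- by move=> _; rewrite nu1E preimage_setT.
Qed.

Lemma joint_law_trace (P : probability T R) (C : set T)
    (l : \bar R) (m1 : probability T1 R) (m2 : probability T2 R) (f : T -> T1) (g : T -> T2) :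
  measurable C -> 0 <= l -> l \is a fin_num -> measurable_fun setT f -> measurable_fun setT g ->
  (forall A B, measurable A -> measurable B ->
    P (C `&` (f @^-1` A `&` g @^-1` B)) = l * (m1 A * m2 B)) ->
  forall E, measurable E ->
    P (C `&` (fun t => (f t, g t)) @^-1` E) = l * prodP m1 m2 E.
Proof.
move=> mC l0 lf mf mg H E mE.
pose k : {nonneg R} := NngNum (fine_ge0 l0).
have kE : k%:num%:E = l by rewrite /= fineK.
rewrite setIC -kE; apply: (joint_law (m := mrestr P mC)) => //.
  by rewrite /= /mrestr setTI (le_lt_trans (probability_le1 _ _)) // ltry.
move=> A B mA mB; rewrite kE -(H _ _ mA mB) /mrestr. by rewrite [C `&` _]setIC.
Qed.

End JointLaw.

Section Independence.
Context (R : realType) (I : eqType).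
Implicit Types (D : pred I) (ell : I -> probability R R).
Local Open Scope ereal_scope.

Definition box (T : Type) (X : I -> T -> R) (s : seq I)
  (A : I -> set R) : set T := \bigcap_(i in [set` s]) (X i @^-1` A i).

Definition independent_on d (T : measurableType d) (P : probability T R)
    D ell (X : I -> T -> R) :=
  (forall i, measurable_fun setT (X i)) /\
  forall (s : seq I) (A : I -> set R), uniq s -> {subset s <= D} ->
    (forall i, measurable (A i)) -> P (box X s A) = \prod_(i <- s) ell i (A i).

Section Basics.
Context d (T : measurableType d) (P : probability T R).
Implicit Types X : I -> T -> R.

Lemma box_nil X A : box X [::] A = setT.
Proof. by apply/seteqP; split => t // _ i; rewrite /= in_nil. Qed.

Lemma box_cons X i s A : box X (i :: s) A = X i @^-1` A i `&` box X s A.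
Proof.
apply/seteqP; split => t.
  by move=> h; split => [|j js]; apply: h; rewrite /= inE ?eqxx // js orbT.
by move=> [h1 h2] j /=; rewrite inE => /predU1P[->|/h2].
Qed.

Lemma measurable_box X s A : (forall i, measurable_fun setT (X i)) ->
  (forall i, measurable (A i)) -> measurable (box X s A).
Proof.
move=> mX mA; elim: s => [|i s IH]; first by rewrite box_nil.
by rewrite box_cons; apply: measurableI => //; rewrite -[_ @^-1` _]setTI; exact: mX.
Qed.

Lemma eq_box X Y s A B : (forall i, i \in s -> X i @^-1` A i = Y i @^-1` B i) ->
  box X s A = box Y s B.
Proof. by move=> E; apply: eq_bigcapr => i /= /E. Qed.

Lemma independent_on_extend ell X (s s' : seq I) (A : I -> set R) :
  uniq s -> uniq s' -> {subset s <= s'} ->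
  let A' i := if i \in s then A i else setT in
  box X s' A' = box X s A /\
  \prod_(i <- s') ell i (A' i) = \prod_(i <- s) ell i (A i).
Proof.
move=> us us' ss' A'; split.
  rewrite /box; apply/seteqP; split => t h i /= is_.
    by have := h i (ss' _ is_); rewrite /A' is_.
  by rewrite /A'; case: ifP => // is'; exact: h.
rewrite (bigID (mem s)) /= [X in _ * X]big1_seq ?mule1; last first.
  by move=> i /andP[is_ _]; rewrite /A' (negPf is_) probability_setT.
rewrite -big_filter.
have -> : \prod_(i <- [seq i <- s' | i \in s]) ell i (A' i) = \prod_(i <- s) ell i (A' i).
  apply: perm_big; apply: uniq_perm => //; first exact: filter_uniq.
  by move=> i; rewrite mem_filter; case: (boolP (i \in s)) => //= /ss' ->.
by apply: eq_big_seq => i is_; rewrite /A' is_.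
Qed.

Lemma triple_law D ell X s A i1 i2 i3 : independent_on P D ell X ->
  uniq (i1 :: i2 :: i3 :: s) -> {subset i1 :: i2 :: i3 :: s <= D} ->
  (forall i, measurable (A i)) -> forall E, measurable E ->
  P (box X s A `&` (fun t => ((X i1 t, X i2 t), X i3 t)) @^-1` E) =
  P (box X s A) * prodP (prodP (ell i1) (ell i2)) (ell i3) E.
Proof.
move=> [mX indep] us sD mA E mE.
have mC := measurable_box s mX mA.
have pre i B : measurable B -> measurable (X i @^-1` B).
  by move=> mB; rewrite -[_ @^-1` _]setTI; exact: mX.
have rect B1 B2 B3 : measurable B1 -> measurable B2 -> measurable B3 ->
    P (box X s A `&` X i1 @^-1` B1 `&` (X i2 @^-1` B2 `&` X i3 @^-1` B3)) =
    P (box X s A) * (ell i1 B1 * (ell i2 B2 * ell i3 B3)).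
  move=> m1 m2 m3.
  pose A' i := if i == i1 then B1 else if i == i2 then B2 else
    if i == i3 then B3 else A i.
  have mA' i : measurable (A' i) by rewrite /A'; do 3 case: ifP => // _.
  have /= := us; rewrite !inE !negb_or => /andP[/and3P[n12 n13 i1s]].
  move=> /andP[/andP[n23 i2s] /andP[i3s us']].
  have ss : {subset s <= D} by move=> i is_; apply: sD; rewrite !inE is_ !orbT.
  have As i : i \in s -> A' i = A i.
    by rewrite /A'; do 3 (case: eqP => [->|_]; first by rewrite ?(negPf i1s) ?(negPf i2s) ?(negPf i3s)).
  have bs : box X s A' = box X s A by apply: eq_box => i /As ->.
  have ps : \prod_(i <- s) ell i (A' i) = \prod_(i <- s) ell i (A i).
    by apply: eq_big_seq => i /As ->.
  have := indep _ A' us sD mA'; rewrite !box_cons !big_cons bs ps.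
  rewrite (indep s A us' ss mA) /A' !eqxx (eq_sym i2 i1) (negPf n12) (eq_sym i3 i1)
    (negPf n13) (eq_sym i3 i2) (negPf n23) => E'.
  rewrite [RHS]muleC -!muleA -E'; congr (P _).
  by rewrite -!setIA; apply/seteqP; split => t; rewrite /=; tauto.
apply: joint_law_trace => //.
- by rewrite fin_num_measure.
- exact: measurable_fun_pair.
move=> E' B3 mE' m3.
transitivity (P ((box X s A `&` X i3 @^-1` B3) `&` (fun t => (X i1 t, X i2 t)) @^-1` E')).
  by congr (P _); apply/seteqP; split => t; rewrite /=; tauto.
transitivity ((P (box X s A) * ell i3 B3) * prodP (ell i1) (ell i2) E'); last first.
  by rewrite -muleA [X in _ * X]muleC.
apply: joint_law_trace => //.
- by apply: measurableI => //; exact: pre.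
- by rewrite mule_ge0.
- by rewrite fin_numM // fin_num_measure.
move=> B1 B2 m1 m2.
transitivity (P (box X s A `&` X i1 @^-1` B1 `&` (X i2 @^-1` B2 `&` X i3 @^-1` B3))).
  by congr (P _); apply/seteqP; split => t; rewrite /=; tauto.
by rewrite rect // -!muleA; congr (_ * _); rewrite muleA muleC.
Qed.
End Basics.

Definition move_preserving (m1 m2 m3 : probability R R) :=
  forall A B C : set R, measurable A -> measurable B -> measurable C ->
  prodP (prodP m1 m2) m3 [set t | [/\ A (top t.1.1 t.1.2 t.2),
    B (right t.1.1 t.1.2 t.2) & C (dual t.1.1 t.1.2 t.2)]] = m1 A * (m2 B * m3 C).

Definition update (i1 i2 i3 : I) (c : I -> R) (i : I) : R :=
  if i == i1 then top (c i1) (c i2) (c i3) else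
  if i == i2 then right (c i1) (c i2) (c i3) else
  if i == i3 then dual (c i1) (c i2) (c i3) else c i.

Section MeasurableMove.
Context d (T : measurableType d) (f g h : T -> R).
Hypotheses (mf : measurable_fun setT f) (mg : measurable_fun setT g)
  (mh : measurable_fun setT h).

Lemma measurable_pos : measurable_fun setT (fun t => pos (g t)).
Proof. by apply: measurable_maxr => //; exact: measurable_cst. Qed.

Lemma measurable_neg_part : measurable_fun setT (fun t => neg (g t)).
Proof.
apply: measurable_maxr; last exact: measurable_cst.
exact: measurableT_comp.
Qed.

Let mX : measurable_fun setT (fun t => f t + pos (g t))%R.
Proof. by apply: measurable_funD => //; exact: measurable_pos. Qed.

Let mX0 : measurable_fun setT (fun t => (f t + pos (g t) == 0)%R).
Proof. by apply: measurable_fun_eqr; [exact: mX|exact: measurable_cst]. Qed.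

Lemma measurable_top : measurable_fun setT (fun t => top (f t) (g t) (h t)).
Proof.
by apply: measurable_fun_ifT; [exact: mX0|exact: measurable_cst|exact: measurable_minr].
Qed.

Lemma measurable_right : measurable_fun setT (fun t => right (f t) (g t) (h t)).
Proof. by apply: measurable_fun_ifT; [exact: mX0|exact: mg|exact: measurable_funB]. Qed.

Lemma measurable_dual : measurable_fun setT (fun t => dual (f t) (g t) (h t)).
Proof.
apply: measurable_fun_ifT; [exact: mX0|exact: mh|].
by apply: measurable_funD => //; exact: measurable_neg_part.
Qed.

End MeasurableMove.

Lemma preimage_measurable d (T : measurableType d) (f : T -> R) A :
  measurable_fun setT f -> measurable A -> measurable (f @^-1` A).
Proof. by move=> mf mA; rewrite -[_ @^-1` _]setTI; exact: mf. Qed.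

Section MeasurableFormulas.
Context d (T : measurableType d).

Lemma measurable_forall (b : nat -> bool) (Q : nat -> T -> Prop) :
  (forall k, b k -> measurable [set t | Q k t]) -> measurable [set t | forall k, b k -> Q k t].
Proof.
move=> mQ; rewrite (_ : [set _ | _] = \bigcap_k (if b k then [set t | Q k t] else setT)).
  by apply: bigcapT_measurable => k; case: ifP => // /mQ.
apply/seteqP; split => t /= h k; first by move=> _; case: ifP => // /h.
by move=> bk; have := h k Logic.I; rewrite bk.
Qed.

Lemma measurable_imply (b : bool) (A : T -> Prop) :
  measurable [set t | A t] -> measurable [set t | b -> A t].
Proof.
case: b => mA.
  by rewrite (_ : [set _ | _] = [set t | A t]) //; apply/seteqP; split => t /=; auto.
by rewrite (_ : [set _ | _] = setT) //; apply/seteqP; split.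
Qed.

Lemma measurable_and3 (A B C : T -> Prop) : measurable [set t | A t] ->
  measurable [set t | B t] -> measurable [set t | C t] ->
  measurable [set t | [/\ A t, B t & C t]].
Proof.
move=> mA mB mC; rewrite (_ : [set _ | _] = [set t | A t] `&` ([set t | B t] `&` [set t | C t])).
  by apply: measurableI => //; exact: measurableI.
by apply/seteqP; split => t /= [] // ? [].
Qed.

End MeasurableFormulas.

Section MeasurableComparison.
Context d (T : measurableType d) (f g : T -> R).
Hypotheses (mf : measurable_fun setT f) (mg : measurable_fun setT g).

Lemma measurable_le : measurable [set t | (f t <= g t)%R].
Proof.
rewrite (_ : [set _ | _] = (fun t => (f t <= g t)%R) @^-1` [set true]) //.
by rewrite -[_ @^-1` _]setTI; exact: measurable_fun_ler.
Qed.

Lemma measurable_lt : measurable [set t | (f t < g t)%R].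
Proof.
rewrite (_ : [set _ | _] = (fun t => (f t < g t)%R) @^-1` [set true]) //.
by rewrite -[_ @^-1` _]setTI; exact: measurable_fun_ltr.
Qed.

Lemma measurable_eq : measurable [set t | f t = g t].
Proof.
rewrite (_ : [set _ | _] = (fun t => f t == g t) @^-1` [set true]); last first.
  by apply/seteqP; split => t /= /eqP.
by rewrite -[_ @^-1` _]setTI; exact: measurable_fun_eqr.
Qed.

End MeasurableComparison.

Lemma independent_on_update d (T : measurableType d) (P : probability T R)
    D ell X i1 i2 i3 :
  independent_on P D ell X -> uniq [:: i1; i2; i3] ->
  {subset [:: i1; i2; i3] <= D} -> move_preserving (ell i1) (ell i2) (ell i3) ->
  independent_on P D ell (fun i t => update i1 i2 i3 (X^~ t) i).
Proof.
move=> iX u123 D123 mp; have [mX iXE] := iX; split=> [i|s A us sD mA].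
  rewrite /update; case: (i == i1); first exact: measurable_top.
  case: (i == i2); first exact: measurable_right.
  case: (i == i3); first exact: measurable_dual.
  exact: mX.
set Y := fun i t => _.
pose s3 := [seq i <- s | i \notin [:: i1; i2; i3]].
pose s' := i1 :: i2 :: i3 :: s3.
have us' : uniq s'.
  rewrite -[s']/([:: i1; i2; i3] ++ s3) cat_uniq u123 filter_uniq //.
  by rewrite andbT; apply/hasPn => i; rewrite mem_filter => /andP[].
have s'D : {subset s' <= D}.
  move=> i; rewrite -[s']/([:: i1; i2; i3] ++ s3) mem_cat => /orP[/D123 //|].
  by rewrite mem_filter => /andP[_ /sD].
have ss' : {subset s <= s'}.
  move=> i is_; rewrite -[s']/([:: i1; i2; i3] ++ s3) mem_cat mem_filter is_ andbT.
  by case: (i \in _).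
have [bE <-] := independent_on_extend ell Y A us us' ss'.
rewrite -bE; set A' := fun i => _.
have mA' i : measurable (A' i) by rewrite /A'; case: ifP.
have n3 i : i \in s3 -> [/\ i != i1, i != i2 & i != i3].
  by rewrite mem_filter !inE !negb_or => /andP[/and3P[]].
have -> : box Y s' A' = box X s3 A' `&` (fun t => ((X i1 t, X i2 t), X i3 t)) @^-1`
   [set t | [/\ A' i1 (top t.1.1 t.1.2 t.2),
    A' i2 (right t.1.1 t.1.2 t.2) & A' i3 (dual t.1.1 t.1.2 t.2)]].
  have /= := u123; rewrite !inE negb_or => /andP[/andP[n12 n13] /andP[n23 _]].
  rewrite /s' !box_cons.
  have -> : box Y s3 A' = box X s3 A'.
    apply: eq_box => i /n3[j1 j2 j3]; apply/seteqP.
    by split => t; rewrite /= /Y /update (negPf j1) (negPf j2) (negPf j3).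
  apply/seteqP; split => t; rewrite /= /Y /update !eqxx (eq_sym i2) (negPf n12)
    (eq_sym i3) (negPf n13) (eq_sym i3) (negPf n23).
    by move=> [? [? [? ?]]].
  by move=> [? []].
have us3 : uniq s3 by exact: filter_uniq.
have s3D : {subset s3 <= D} by move=> i i3s; apply: s'D; rewrite !inE i3s !orbT.
rewrite (triple_law iX) //.
  by rewrite mp // iXE // /s' !big_cons muleC -!muleA.
have mt1 : measurable_fun setT (fun t : (R * R) * R => t.1.1).
  by apply: measurableT_comp => //; exact: measurable_fst.
have mt2 : measurable_fun setT (fun t : (R * R) * R => t.1.2).
  by apply: measurableT_comp => //; exact: measurable_snd.
have mt3 : measurable_fun setT (fun t : (R * R) * R => t.2) by exact: measurable_snd.
have -> : [set t | [/\ A' i1 (top t.1.1 t.1.2 t.2), A' i2 (right t.1.1 t.1.2 t.2)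
     & A' i3 (dual t.1.1 t.1.2 t.2)]] =
   (fun t : (R * R) * R => top t.1.1 t.1.2 t.2) @^-1` A' i1 `&`
   ((fun t => right t.1.1 t.1.2 t.2) @^-1` A' i2 `&`
    (fun t => dual t.1.1 t.1.2 t.2) @^-1` A' i3).
  by apply/seteqP; split => t /= [] // ? [].
apply: measurableI; first by apply: preimage_measurable => //; exact: measurable_top.
apply: measurableI; apply: preimage_measurable => //.
  exact: measurable_right.
exact: measurable_dual.
Qed.

Lemma independent_on_exists (ds : seq I) ell :
  exists d (T : measurableType d) (P : probability T R) (X : I -> T -> R),
    independent_on P (mem ds) ell X.
Proof.
elim: ds => [|a ds [d [T [P [X iX]]]]].
  exists _, R, (dirac (0%R : R)), (fun _ _ => 0%R); split=> [i|].
    exact: measurable_cst.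
  move=> [|i s] A us sD mA; first by rewrite box_nil big_nil probability_setT.
  by have := sD i (mem_head _ _); rewrite inE.
case: (boolP (a \in ds)) => [ads|nads].
  exists d, T, P, X; have [mX iE] := iX; split=> // s A us sD mA; apply: iE => // i /sD.
  by rewrite !inE => /predU1P[->|].
exists _, (T * R)%type, (prodP P (ell a)),
  (fun i t => if i == a then t.2 else X i t.1).
have [mX iE] := iX; split => [i|s A us sD mA].
  case: (i == a); first exact: measurable_snd.
  by apply: measurableT_comp => //; exact: measurable_fst.
pose s' := [seq i <- s | i != a]; set Y := fun i t => _.
have us' : uniq (a :: s') by rewrite /= mem_filter eqxx filter_uniq.
have ss' : {subset s <= a :: s'}.
  by move=> i is_; rewrite inE mem_filter is_ andbT; case: eqP.
have [<- <-] := independent_on_extend ell Y A us us' ss'; set A' := fun i => _.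
have mA' i : measurable (A' i) by rewrite /A'; case: ifP.
have -> : box Y (a :: s') A' = box X s' A' `*` A' a.
  rewrite box_cons; apply/seteqP; split => t; rewrite /= /Y eqxx.
    move=> [ta h]; split=> // i /= is_; have := h i is_; rewrite /=.
    by move: is_; rewrite mem_filter => /andP[/negPf ->].
  move=> [h ta]; split => // i /= is_; have := h i is_; rewrite /=.
  by move: is_; rewrite mem_filter => /andP[/negPf ->].
rewrite prodPE //; last exact: measurable_box.
rewrite big_cons muleC iE //; first exact: filter_uniq.
by move=> i; rewrite mem_filter => /andP[ia /sD]; rewrite !inE (negPf ia).
Qed.

End Independence.

(** * Critical angles *)

Section CriticalAngle.
Variable R : realType.
Implicit Types (w : site -> R).

Definition corner w (k j : nat) : R := w (k%:Z, j%:Z).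

Lemma path_end_count r s :
  path_end (0%:Z, r%:Z) s = ((count id s)%:Z, (r + count negb s)%N%:Z).
Proof.
suff E k : path_end (k%:Z, r%:Z) s = ((k + count id s)%N%:Z, (r + count negb s)%N%:Z) by exact: E.
elim: s k r => [|b s IH] k r; first by rewrite !addn0.
case: b => /=; rewrite /sadd /=.
  by rewrite addr0 (_ : k%:Z + 1%Z = k.+1%:Z) ?IH; [congr (_%:Z, _%:Z); lia|lia].
by rewrite addr0 (_ : r%:Z + 1%Z = r.+1%:Z) ?IH; [congr (_%:Z, _%:Z); lia|lia].
Qed.

Lemma path_weight_rcons w x s b :
  path_weight w x (rcons s b) = path_weight w x s + (if b then w (path_end x s) else 0).
Proof.
elim: s x => [|a s IH] x /=; first by case: b => /=; rewrite ?addr0 ?add0r.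
by case: a; rewrite IH // addrA.
Qed.

Lemma path_end_rcons x s b :
  path_end x (rcons s b) = sadd (path_end x s) (if b then e1 else e2).
Proof. by elim: s x => [|a s IH] x //=. Qed.

Lemma passage_path_weight w r s :
  passage (corner w) r (count id s) (r + count negb s) <= path_weight w (0%:Z, r%:Z) s.
Proof.
elim/last_ind: s => [|s b IH]; first by rewrite /= passage0.
rewrite path_weight_rcons path_end_count -cats1 !count_cat; case: b => /=.
  rewrite !addn0 addn1; apply: (le_trans (passageS_le _ _ (leq_addr _ _))).
  by rewrite lerD2r.
rewrite !addn0 addn1 addnS addr0; apply: le_trans IH.
by apply: passage_leS; rewrite leq_addr.
Qed.

Lemma passage_attained w r m n : (r <= n)%N -> exists s : seq bool,
  path_end (0%:Z, r%:Z) s = (m%:Z, n%:Z) /\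
  path_weight w (0%:Z, r%:Z) s = passage (corner w) r m n.
Proof.
have stepT m' n' s : path_end (0%:Z, r%:Z) s = (m'%:Z, n'%:Z) ->
    path_end (0%:Z, r%:Z) (rcons s true) = (m'.+1%:Z, n'%:Z) /\
    path_weight w (0%:Z, r%:Z) (rcons s true) = path_weight w (0%:Z, r%:Z) s + corner w m' n'.
  move=> E; rewrite path_end_rcons path_weight_rcons E /sadd /= addr0; split=> //.
  by congr (_, _); lia.
have stepF m' n' s : path_end (0%:Z, r%:Z) s = (m'%:Z, n'%:Z) ->
    path_end (0%:Z, r%:Z) (rcons s false) = (m'%:Z, n'.+1%:Z) /\
    path_weight w (0%:Z, r%:Z) (rcons s false) = path_weight w (0%:Z, r%:Z) s.
  move=> E; rewrite path_end_rcons path_weight_rcons E /sadd /= !addr0; split=> //.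
  by congr (_, _); lia.
elim: m n => [|m IHm].
  elim=> [|n IHn]; rewrite leq_eqVlt => /orP[/eqP rE|rn] //.
  - by exists [::]; rewrite rE passage0.
  - by exists [::]; rewrite -rE passage0.
  - have [s [s1 s2]] := IHn rn; have [f1 f2] := stepF _ _ _ s1.
    by exists (rcons s false); rewrite f1 f2 s2 !passage0.
elim=> [|n IHn]; rewrite leq_eqVlt => /orP[/eqP rE|rn] //.
- have [s [s1 s2]] := IHm r (leqnn r); have [f1 f2] := stepT _ _ _ s1.
  by exists (rcons s true); rewrite f1 f2 s2 rE -passage_row.
- have [s [s1 s2]] := IHm r (leqnn r); have [f1 f2] := stepT _ _ _ s1.
  by exists (rcons s true); rewrite -rE f1 f2 s2 -passage_row.
rewrite passageSS //.
case: (minP (passage (corner w) r m n.+1 + corner w m n.+1) (passage (corner w) r m.+1 n)) => -[_ ->].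
- have [s [s1 s2]] := IHm n.+1 (ltnW rn); have [f1 f2] := stepT _ _ _ s1.
  by exists (rcons s true); rewrite f1 f2 s2.
- have [s [s1 s2]] := IHn rn; have [f1 f2] := stepF _ _ _ s1.
  by exists (rcons s false); rewrite f1 f2 s2.
Qed.

Lemma L_passage w r m n : (r <= n)%N ->
  L w (0%:Z, r%:Z) (m%:Z, n%:Z) = passage (corner w) r m n.
Proof.
move=> rn; have [s [s1 s2]] := passage_attained w m rn.
have lb : lbound [set path_weight w (0%:Z, r%:Z) s | s in
    [set s | path_end (0%:Z, r%:Z) s = (m%:Z, n%:Z)]] (passage (corner w) r m n).
  move=> _ [s' /= s'E <-]; have := passage_path_weight w r s'.
  by move: s'E; rewrite path_end_count => -[<- <-].
apply/eqP; rewrite eq_le; apply/andP; split.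
  rewrite -s2; apply: ge_inf; last by exists s.
  by exists (passage (corner w) r m n).
apply: lb_le_inf => //; by exists (path_weight w (0%:Z, r%:Z) s), s.
Qed.

(* The gap vanishes in direction [s / (1 + s)]. Since gaps are monotone, this decides
   on which side of that direction the critical angle lies. *)
Definition flat w r (s : R) := forall i : nat, exists N : nat, forall n, (N <= n)%N ->
  - (i.+1%:R)^-1 <= gap (corner w) r (Num.truncn (s * n%:R)) n.

Lemma L_gap w r m n : (r < n)%N ->
  L w (0%:Z, r%:Z) (m%:Z, n%:Z) - L w (0%:Z, r.+1%:Z) (m%:Z, n%:Z) = gap (corner w) r m n.
Proof. by move=> rn; rewrite !L_passage // ltnW. Qed.

Lemma flat_busemann w r (s t : R) : 0 < s -> flat w r s -> 0 < t -> t < s / (1 + s) ->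
  busemann_is w t (0%:Z, r%:Z) (0%:Z, r.+1%:Z) 0.
Proof.
move=> s0 fl t0 ts v vinf v1 v2.
have t1 : t < 1 by apply: (lt_trans ts); rewrite ltr_pdivrMr ?mul1r; lra.
have st : t / (1 - t) < s.
  by rewrite ltr_pdivrMr ?subr_gt0 //; move: ts; rewrite ltr_pdivlMr; lra.
apply/cvgrPdist_le => e e0.
pose i := Num.truncn (e^-1); have [N NE] := fl i.
have ie : (i.+1%:R)^-1 <= e.
  by rewrite -[leRHS]invrK lef_pV2 ?posrE ?invr_gt0 // ltW // truncnS_gt.
have near1 : \forall n \near \oo, 0 < l1 R (v n) by exact: (cvgryPgt _).1 vinf 0.
have near2 : \forall n \near \oo, (maxn N r).+1%:R / ((1 - t) / 2) < l1 R (v n).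
  by apply: (cvgryPgt _).1.
have near3 : \forall n \near \oo, 0 < ((v n).1)%:~R / l1 R (v n) by exact: (cvgr_gt t).
have near4 : \forall n \near \oo, (1 - t) / 2 < ((v n).2)%:~R / l1 R (v n).
  by apply: (cvgr_gt (1 - t)) => //; lra.
have ratio : (fun n => s * (((v n).2)%:~R / l1 R (v n)) - ((v n).1)%:~R / l1 R (v n)) @ \oo --> s * (1 - t) - t.
  by apply: cvgB => //; apply: cvgM => //; exact: cvg_cst.
have near5 : \forall n \near \oo, 0 < s * (((v n).2)%:~R / l1 R (v n)) - ((v n).1)%:~R / l1 R (v n).
  apply: (cvgr_gt _ ratio); move: st; rewrite ltr_pdivrMr ?subr_gt0 //; lra.
near=> n.
have l0 : 0 < l1 R (v n) by near: n.
have h2 : (maxn N r).+1%:R / ((1 - t) / 2) < l1 R (v n) by near: n.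
have h3 : 0 < ((v n).1)%:~R / l1 R (v n) by near: n.
have h4 : (1 - t) / 2 < ((v n).2)%:~R / l1 R (v n) by near: n.
have h5 : 0 < s * (((v n).2)%:~R / l1 R (v n)) - ((v n).1)%:~R / l1 R (v n) by near: n.
move: h2 h3 h4 h5; case: (v n) l0 => x y /= l0.
set l := l1 R _ in l0 *.
rewrite ltr_pdivrMr; last by rewrite divr_gt0 ?subr_gt0.
move=> h2; rewrite pmulr_lgt0 ?invr_gt0 // ltr0z => x0.
rewrite ltr_pdivlMr // => h4; rewrite mulrA -mulrBl pmulr_lgt0 ?invr_gt0 // subr_gt0 => h5.
have yb : (maxn N r).+1%:R < y%:~R :> R by apply: lt_trans h4; rewrite mulrC.
case: x x0 h5 {l0 l h2 h4} => // m _ h5; case: y yb h5 => // [n'|n'] yb h5; last first.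
  have : (maxn N r).+1%:R < 0 :> R by apply: (lt_trans yb); rewrite ltrz0.
  by rewrite ltrn0.
move: yb; rewrite -!pmulrn ltr_nat => yb.
rewrite L_gap; last by lia.
have g0 := @gap_le0 _ (corner w) r m n' ltac:(lia).
have := NE n' ltac:(lia).
have mm : (m <= Num.truncn (s * n'%:R))%N.
  by rewrite truncn_ge_nat ?mulr_ge0 ?(ltW s0) //; move: h5; rewrite -!pmulrn => /ltW.
have := @gap_mono _ (corner w) r (Num.truncn (s * n'%:R)) n' m n' ltac:(lia) (leqnn _) mm.
move=> g1 g2; rewrite sub0r normrN ler0_norm //; apply: le_trans ie.
by rewrite lerNl; exact: le_trans g1.
Unshelve. all: by end_near.
Qed.

Lemma busemann_flat w r (s t : R) : 0 < s -> t < 1 -> s / (1 + s) < t ->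
  busemann_is w t (0%:Z, r%:Z) (0%:Z, r.+1%:Z) 0 -> flat w r s.
Proof.
move=> s0 t1 st B i.
have t0 : 0 < t by apply: lt_trans st; rewrite divr_gt0 // addr_gt0.
pose s' := t / (1 - t).
have ss' : s < s'.
  by rewrite /s' ltr_pdivlMr ?subr_gt0 //; move: st; rewrite ltr_pdivrMr; lra.
have s'0 : 0 < s' by exact: lt_trans ss'.
pose m n := Num.truncn (s' * n%:R).
have mb n : (m n)%:R <= s' * n%:R /\ s' * n%:R < (m n)%:R + 1.
  have : 0 <= s' * n%:R by rewrite mulr_ge0 // ltW.
  by move=> /truncn_itv /andP[-> ]; rewrite natr1.
pose v n : site := ((m n)%:Z, n%:Z).
have l1E n : l1 R (v n) = (m n)%:R + n%:R by rewrite /l1 /v /= -natrD.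
have v1E n : ((v n).1)%:~R = (m n)%:R :> R by rewrite /v /= -pmulrn.
have v2E n : ((v n).2)%:~R = n%:R :> R by rewrite /v /= -pmulrn.
have key n : (0 < n)%N -> `|(1 - t) - n%:R / l1 R (v n)| <= n%:R^-1.
  move=> n0; have n0' : 0 < n%:R :> R by rewrite ltr0n.
  have [m1 m2] := mb n; rewrite l1E; have m0 : 0 <= (m n)%:R :> R by [].
  have ts : (1 - t) * s' = t by rewrite /s' mulrC divfK // gt_eqF // subr_gt0.
  move: m1 m2 m0; set M := (m n)%:R; set k : R := n%:R in n0' *; move=> m1 m2 m0.
  have Mk : 0 < M + k by lra.
  have -> : 1 - t - k / (M + k) = ((1 - t) * (M - s' * k)) / (M + k).
    by rewrite mulrBr mulrA ts; field; rewrite gt_eqF.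
  rewrite normrM normfV (gtr0_norm Mk) ler_pdivrMr // normrM.
  rewrite (gtr0_norm (_ : 0 < 1 - t)) ?subr_gt0 // ler0_norm; last by lra.
  apply: (@le_trans _ _ 1); first by nra.
  by rewrite mulrDr mulVf ?gt_eqF // lerDr mulr_ge0 // invr_ge0 ltW.
have small e : 0 < e -> \forall n \near \oo, (0 < n)%N /\ n%:R^-1 <= e :> R.
  move=> e0; exists (Num.truncn e^-1).+1 => // n /= en; split; first exact: leq_ltn_trans en.
  rewrite -[leRHS]invrK lef_pV2 ?posrE ?invr_gt0 ?ltr0n //; last exact: leq_ltn_trans en.
  by apply: ltW; apply: (lt_le_trans (truncnS_gt _)); rewrite ler_nat.
have vB : (fun n => L w (0%:Z, r%:Z) (v n) - L w (0%:Z, r.+1%:Z) (v n)) @ \oo --> 0.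
  apply: B.
  - apply/cvgryPge => A; exists (Num.truncn A).+1 => // n /= An; rewrite l1E.
    apply: ltW; apply: (lt_le_trans (truncnS_gt A)).
    by apply: (@le_trans _ _ n%:R); rewrite ?ler_nat // lerDr.
  - apply/cvgrPdist_le => e e0; have := small e e0; apply: filterS => n [n0 ne].
    apply: le_trans ne; have := key n n0; rewrite v1E.
    have l0 : 0 < l1 R (v n) by rewrite l1E ltr_wpDl // ltr0n.
    rewrite (_ : t - _ = - (1 - t - n%:R / l1 R (v n))) ?normrN //=.
    by move: l0; rewrite l1E => l0; field; rewrite gt_eqF.
  - apply/cvgrPdist_le => e e0; have := small e e0; apply: filterS => n [n0 ne].
    by apply: le_trans ne; have := key n n0; rewrite v2E.
have e0 : 0 < (i.+1%:R)^-1 :> R by rewrite invr_gt0.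
have [N _ NE] : \forall n \near \oo,
    - (i.+1%:R)^-1 < L w (0%:Z, r%:Z) (v n) - L w (0%:Z, r.+1%:Z) (v n).
  by apply: (cvgr_gt 0); rewrite ?oppr_lt0.
exists (maxn N r.+1) => n; rewrite geq_max => /andP[Nn rn].
have := NE n Nn; rewrite /= L_gap // => /ltW/le_trans; apply; apply: gap_mono => //.
by apply: le_truncn; rewrite ler_wpM2r // ltW.
Qed.

Lemma crit_angle_sup w r : crit_angle w (0%:Z, r%:Z) =
  sup [set t : R | 0 < t < 1 /\ busemann_is w t (0%:Z, r%:Z) (0%:Z, r.+1%:Z) 0].
Proof.
rewrite /crit_angle /sadd /= (_ : r%:Z + 1%Z = r.+1%:Z) //; lia.
Qed.

Lemma crit_angle_ge0 w r : 0 <= crit_angle w (0%:Z, r%:Z).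
Proof.
rewrite crit_angle_sup //; set S := [set t | _].
have [->|/set0P[t tS]] := eqVneq S set0; first by rewrite sup0.
apply: le_trans (_ : t <= _); first by case: tS => /andP[/ltW].
by apply: ub_le_sup => //; exists 1 => y [/andP[_ /ltW]].
Qed.

Lemma flat_crit_angle w r (s : R) : 0 < s -> flat w r s ->
  s / (1 + s) <= crit_angle w (0%:Z, r%:Z).
Proof.
move=> s0 fl; rewrite crit_angle_sup //; set S := [set t | _].
have s1 : s / (1 + s) < 1 by rewrite ltr_pdivrMr ?mul1r; lra.
have s2 : 0 < s / (1 + s) by rewrite divr_gt0 // addr_gt0.
have ubS : has_ubound S by exists 1 => y [/andP[_ /ltW]].
apply/ler_addgt0Pl => e e0.
have [lt_e|ge_e] := ltP e (s / (1 + s)); last first.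
  apply: (le_trans ge_e); rewrite lerDl; move: (crit_angle_ge0 w r).
  by rewrite crit_angle_sup.
rewrite -lerBlDl; apply: ub_le_sup => //; split; first by apply/andP; split; lra.
by apply: (flat_busemann s0 fl); lra.
Qed.

Lemma crit_angle_le w r (s : R) : 0 < s -> ~ flat w r s ->
  crit_angle w (0%:Z, r%:Z) <= s / (1 + s).
Proof.
move=> s0 nfl; rewrite crit_angle_sup //; set S := [set t | _].
have s2 : 0 < s / (1 + s) by rewrite divr_gt0 // addr_gt0.
have [->|/set0P S0] := eqVneq S set0; first by rewrite sup0 ltW.
apply: ge_sup => // t [/andP[t0 t1] B]; rewrite leNgt; apply/negP => st.
by apply: nfl; exact: busemann_flat B.
Qed.

Lemma crit_angle_gt w r (x : R) : 0 <= x -> x < crit_angle w (0%:Z, r%:Z) <->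
  exists2 q : rat, 0 < ratr q :> R & x < ratr q / (1 + ratr q) /\ flat w r (ratr q).
Proof.
move=> x0; split; last first.
  by move=> [q q0 [xq fl]]; apply: (lt_le_trans xq); exact: flat_crit_angle.
rewrite crit_angle_sup //; set S := [set t | _] => xS.
have [S0|/set0P S0] := eqVneq S set0; first by move: xS; rewrite S0 sup0; lra.
have [t [/andP[t0 t1] B] xt] : exists2 t, S t & x < t.
  have hs : has_sup S by split => //; exists 1 => y [/andP[_ /ltW]].
  by apply: sup_gt xS.
have x1 : x < 1 by exact: lt_trans t1.
have h : x / (1 - x) < t / (1 - t).
  by rewrite ltr_pdivrMr ?subr_gt0 // mulrAC ltr_pdivlMr ?subr_gt0 //; lra.
have [q] := rat_in_itvoo h; rewrite in_itv /= ltr_pdivrMr ?subr_gt0 // ltr_pdivlMr ?subr_gt0 //.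
move=> /andP[q1 q2].
have q0 : 0 < ratr q :> R by rewrite -(pmulr_lgt0 _ (_ : 0 < 1 - x)) ?subr_gt0 //; lra.
exists q => //; split; first by rewrite ltr_pdivlMr; lra.
by apply: (busemann_flat q0 t1 _ B); rewrite ltr_pdivrMr; lra.
Qed.

Section Measurability.
Context d (T : measurableType d) (omega : site -> T -> R).
Hypothesis momega : forall x, measurable_fun setT (omega x).

Lemma measurable_passage (c : nat -> nat -> T -> R) r m n :
  (forall k j, measurable_fun setT (c k j)) ->
  measurable_fun setT (fun t => passage (fun k j => c k j t) r m n).
Proof.
move=> mc; wlog rn : n / (r <= n)%N.
  move=> H; case: (leqP r n) => [/H//|nr].
  rewrite (_ : (fun _ => _) = fun t => passage (fun k j => c k j t) r m r); first exact: H.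
  by apply/funext => t; rewrite /passage subnn (_ : (n - r)%N = 0%N) //; apply/eqP; rewrite subn_eq0 ltnW.
have eqm (f g : T -> R) : f =1 g -> measurable_fun setT g -> measurable_fun setT f.
  by move=> /funext ->.
elim: m n rn => [|m IHm] n rn.
  by apply: (eqm _ (cst 0)); [move=> t; rewrite passage0|exact: measurable_cst].
have row : measurable_fun setT (fun t => passage (fun k j => c k j t) r m.+1 r).
  apply: (eqm _ (fun t => passage (fun k j => c k j t) r m r + c m r t)).
    by move=> t; rewrite passage_row.
  by apply: measurable_funD => //; exact: IHm.
elim: n rn => [|n IHn]; rewrite leq_eqVlt => /orP[/eqP rE|rn] //; try by rewrite -rE.
apply: (eqm _ (fun t => Num.min (passage (fun k j => c k j t) r m n.+1 + c m n.+1 t)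
   (passage (fun k j => c k j t) r m.+1 n))).
  by move=> t; rewrite passageSS.
apply: measurable_minr; last exact: IHn.
by apply: measurable_funD => //; apply: IHm; exact: ltnW.
Qed.

Lemma measurable_flat r (s : R) : measurable [set t | flat (omega^~ t) r s].
Proof.
have mgap m n : measurable_fun setT (fun t => gap (corner (omega^~ t)) r m n).
  by apply: measurable_funB; apply: measurable_passage => k j; exact: momega.
rewrite (_ : [set _ | _] = \bigcap_i \bigcup_N [set t | forall n, (N <= n)%N ->
    - (i.+1%:R)^-1 <= gap (corner (omega^~ t)) r (Num.truncn (s * n%:R)) n]).
  apply: bigcapT_measurable => i; apply: bigcupT_measurable => N.
  by apply: measurable_forall => n _; exact: measurable_le.
apply/seteqP; split => t /= fl i; first by move=> _; have [N NE] := fl i; exists N.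
by have [N _ NE] := fl i I; exists N.
Qed.

Lemma measurable_crit_angle r :
  measurable_fun setT (fun t => crit_angle (omega^~ t) (0%:Z, r%:Z)).
Proof.
apply: (@measurability _ _ T R setT _ (@RGenOInfty.G R)); first exact: RGenOInfty.measurableE.
move=> _ [_ [x ->] <-]; rewrite setTI; case: (ltP x 0) => x0.
  rewrite (_ : _ @^-1` _ = setT) //; apply/seteqP; split => // t _ /=.
  by rewrite in_itv /= andbT (lt_le_trans x0) // crit_angle_ge0.
rewrite (_ : _ @^-1` _ = \bigcup_(q : rat) (if (0 < ratr q :> R) && (x < ratr q / (1 + ratr q))
    then [set t | flat (omega^~ t) r (ratr q)] else set0)).
  apply: countable_bigcupT_measurable; first exact: countableP.
  by move=> q; case: ifP => // _; exact: measurable_flat.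
apply/seteqP; split => t /=.
  rewrite in_itv /= andbT => /(crit_angle_gt _ _ x0)[q q0 [xq fl]].
  by exists q => //; rewrite q0 xq.
move=> [q _]; case: ifP => // /andP[q0 xq] fl; rewrite in_itv /= andbT.
by apply/(crit_angle_gt _ _ x0); exists q.
Qed.

End Measurability.

(* The scales [l ^ 2] are dense enough to decide flatness. *)
Lemma flat_scales w r (K : nat) (y y' : R) : 0 < y < y' ->
  (r < 2)%N ->
  (forall l, (K <= l)%N ->
     0 <= gap (corner w) r (l ^ 2) (Num.truncn ((l ^ 2)%:R * y)).+2) ->
  flat w r y'^-1.
Proof.
move=> /andP[y0 yy'] r2 H i; have y'0 : 0 < y' by exact: lt_trans yy'.
pose K' := maxn K (Num.truncn ((2 * y' + 2) / (y' - y))).+1.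
exists (maxn r.+1 (Num.truncn (y' * (K' ^ 2).+1%:R)).+1) => n.
rewrite geq_max => /andP[rn nb].
pose q := Num.truncn (y'^-1 * n%:R).
have n0 : 0 <= y'^-1 * n%:R by rewrite mulr_ge0 // invr_ge0 ltW.
have Kq : (K' ^ 2 < q)%N.
  rewrite truncn_gt_nat mulrC ler_pdivlMr // mulrC; apply: ltW.
  by apply: (lt_le_trans (truncnS_gt _)); rewrite ler_nat.
have ex : exists l, (q <= l ^ 2)%N by exists q; rewrite -mulnn; case: (q) => // m; exact: leq_pmulr.
have [l ql lmin] := ex_minnP ex.
have Kl : (K' <= l)%N by rewrite -(leq_sqr) //; apply: ltnW; exact: leq_trans ql.
have l0 : (0 < l)%N by apply: leq_trans Kl; rewrite leq_max orbT.
have pl : ((l.-1) ^ 2 < q)%N.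
  by rewrite ltnNge; apply/negP => /lmin; rewrite leqNgt prednK // leqnn.
have lb : 2 * y' + 2 <= l%:R * (y' - y).
  rewrite -ler_pdivrMr ?subr_gt0 //; apply: ltW; apply: (lt_le_trans (truncnS_gt _)).
  by rewrite ler_nat (leq_trans _ Kl) // leq_max leqnn orbT.
have h : (l ^ 2)%:R * y + 2 <= n%:R :> R.
  have : ((l.-1) ^ 2)%:R < y'^-1 * n%:R :> R.
    by apply: (lt_le_trans (_ : _ < q%:R)); rewrite ?ltr_nat ?truncn_le.
  rewrite mulrC ltr_pdivlMr // => /ltW; apply: le_trans.
  rewrite !natrX -subn1 natrB //; move: lb; have : 1 <= l%:R :> R by rewrite ler1n.
  by move: (l%:R : R) => z z0 zb; nra.
have g0 := H l (leq_trans (leq_maxl _ _) Kl).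
have ln : ((Num.truncn ((l ^ 2)%:R * y : R)).+2 <= n)%N.
  rewrite -(ler_nat R); apply: le_trans h; rewrite -addn2 natrD lerD2r truncn_le.
  by rewrite mulr_ge0 // ltW.
have mono : gap (corner w) r (l ^ 2) (Num.truncn ((l ^ 2)%:R * y)).+2 <= gap (corner w) r q n.
  by apply: gap_mono => //; apply: (leq_trans r2).
apply: (le_trans _ mono); apply: le_trans g0.
by rewrite oppr_le0 invr_ge0.
Qed.

Lemma not_flat_scales w r (K : nat) (y y' eta : R) : 0 < y' < y -> 0 < eta ->
  (forall l, (K <= l)%N ->
     gap (corner w) r (l ^ 2) (Num.truncn ((l ^ 2)%:R * y)) <= - eta) ->
  ~ flat w r y'^-1.
Proof.
move=> /andP[y'0 yy'] eta0 H fl.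
have [N NE] := fl (Num.truncn eta^-1).
pose l := maxn K (maxn (Num.truncn ((y - y')^-1)).+1 (Num.truncn ((maxn N r).+2%:R / y)).+1).
have y0 : 0 < y by exact: lt_trans yy'.
have l1 : 1 < l%:R * (y - y').
  rewrite -ltr_pdivrMr ?subr_gt0 // mul1r; apply: (lt_le_trans (truncnS_gt _)).
  by rewrite ler_nat /l !leq_max leqnn !orbT.
have l2 : (maxn N r).+2%:R < l%:R * y.
  rewrite -ltr_pdivrMr //; apply: (lt_le_trans (truncnS_gt _)).
  by rewrite ler_nat /l !leq_max leqnn !orbT.
have l0 : 1 <= l%:R :> R by rewrite ler1n /l !leq_max !orbT.
have ll : l%:R <= (l ^ 2)%:R :> R by rewrite natrX; nra.
have l20 : 0 <= (l ^ 2)%:R * y :> R by rewrite mulr_ge0 // ltW.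
pose n := Num.truncn ((l ^ 2)%:R * y).
have nb : n%:R <= (l ^ 2)%:R * y by rewrite truncn_le.
have nB : (l ^ 2)%:R * y < n%:R + 1 by rewrite natr1 truncnS_gt.
have rn : (maxn N r < n)%N.
  rewrite /n truncn_gt_nat; apply: (@le_trans _ _ (l%:R * y)); last by rewrite ler_pM2r.
  by apply: ltW; apply: lt_trans l2; rewrite ltr_nat.
have g1 := H l (leq_maxl _ _).
have g2 := NE n (leq_trans (leq_maxl _ _) (ltnW rn)).
have mono : gap (corner w) r (Num.truncn (y'^-1 * n%:R)) n <= gap (corner w) r (l ^ 2) n.
  apply: gap_mono => //; first exact: leq_ltn_trans (leq_maxr _ _) rn.
  rewrite truncn_ge_nat ?mulr_ge0 ?invr_ge0 ?(ltW y'0) // mulrC ler_pdivlMr //.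
  by move: l1 ll nB; rewrite !mulrBr; nra.
have : (Num.truncn eta^-1).+1%:R^-1 < eta.
  by rewrite -[ltRHS]invrK ltf_pV2 ?posrE ?invr_gt0 // truncnS_gt.
by rewrite ltNge -lerN2 (le_trans g2) // (le_trans mono).
Qed.

End CriticalAngle.

(** * Transfer of laws and the weak law of large numbers *)

Section Cylinders.
Context (R : realType) (I : eqType).

Definition cylinder : set (set (I -> R)) :=
  [set C | exists (s : seq I) (A : I -> set R), (forall i, measurable (A i)) /\
    C = [set c | forall i, i \in s -> A i (c i)]].

Definition config := g_sigma_algebraType cylinder.

Lemma measurable_coord i : measurable_fun setT (fun c : config => (c : I -> R) i).
Proof.
move=> _ B mB; rewrite setTI; apply: sub_sigma_algebra.
exists [:: i], (fun _ => B); split => //; apply/seteqP; split => c /=.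
  by move=> Bc j; rewrite inE => /eqP ->.
by apply; rewrite inE.
Qed.

Definition restr (D : pred I) U (Y : I -> U -> R) (t : U) : config :=
  (fun i => if D i then Y i t else 0).

Section Transfer.
Context d (T : measurableType d) (P : probability T R) d' (T' : measurableType d')
  (P' : probability T' R) (D : pred I) (X : I -> T -> R) (X' : I -> T' -> R).
Hypothesis mX : forall i, measurable_fun setT (X i).
Hypothesis mX' : forall i, measurable_fun setT (X' i).
Hypothesis same_law : forall s (A : I -> set R), uniq s -> {subset s <= D} ->
  (forall i, measurable (A i)) -> P (box X s A) = P' (box X' s A).

Lemma restr_cylinder U (Y : I -> U -> R) s (A : I -> set R) :
  restr D Y @^-1` [set c | forall i, i \in s -> A i (c i)] =
  box Y [seq i <- undup s | D i] A `&`
    [set _ | forall i, i \in s -> ~~ D i -> A i 0].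
Proof.
apply/seteqP; split => t; rewrite /= /restr.
  move=> h; split => [i /=|i is_ nD]; last by have := h i is_; rewrite (negPf nD).
  by rewrite mem_filter mem_undup => /andP[Di is_]; have := h i is_; rewrite Di.
move=> [h1 h2] i is_; case: ifP => Di; last by apply: h2 => //; rewrite Di.
by apply: h1; rewrite /= mem_filter Di mem_undup.
Qed.

Lemma measurable_restr d0 (U : measurableType d0) (Y : I -> U -> R) :
  (forall i, measurable_fun setT (Y i)) -> measurable_fun setT (restr D Y).
Proof.
move=> mY; apply: (@measurability _ _ U config setT (restr D Y) cylinder) => // _ [C [s [A [mA ->]]] <-].
rewrite setTI restr_cylinder.
set S := [set _ | _]; have [->|->] : S = setT \/ S = set0.
- have [h|h] := pselect (forall i, i \in s -> ~~ D i -> A i 0).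
    by left; apply/seteqP; split.
  by right; apply/seteqP; split.
- by rewrite setIT; exact: measurable_box.
- by rewrite setI0.
Qed.

Lemma transfer (E : set config) : measurable E ->
  P ((fun t => restr D X t) @^-1` E) = P' ((fun t => restr D X' t) @^-1` E).
Proof.
move=> mE.
have [n1 n1E] := pushforward_measure P (measurable_restr mX).
have [n2 n2E] := pushforward_measure P' (measurable_restr mX').
rewrite -[LHS]n1E -[RHS]n2E.
apply: (@measure_unique _ _ config cylinder (fun _ => setT)) => //.
- move=> _ _ [s1 [A1 [mA1 ->]]] [s2 [A2 [mA2 ->]]].
  exists (s1 ++ s2), (fun i => [set x | (i \in s1 -> A1 i x) /\ (i \in s2 -> A2 i x)]).
  split.
    move=> i; case: (i \in s1); case: (i \in s2).
    + rewrite (_ : [set _ | _] = A1 i `&` A2 i); first exact: measurableI.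
      by apply/seteqP; split => x /= [] ? ?; split; auto.
    + rewrite (_ : [set _ | _] = A1 i) //.
      by apply/seteqP; split => x /=; [move=> []; auto|move=> ?; split].
    + rewrite (_ : [set _ | _] = A2 i) //.
      by apply/seteqP; split => x /=; [move=> []; auto|move=> ?; split].
    + by rewrite (_ : [set _ | _] = setT) //; apply/seteqP; split.
  apply/seteqP; split => c /=.
    by move=> [h1 h2] i _; split; auto.
  move=> h; split => i is_.
    by apply: (h i _).1 => //; rewrite mem_cat is_.
  by apply: (h i _).2 => //; rewrite mem_cat is_ orbT.
- by move=> _; exists [::], (fun _ => setT); split => //; apply/seteqP; split.
- by rewrite bigcup_const.
- move=> _ [s [A [mA ->]]]; rewrite n1E n2E !restr_cylinder.
  have [h|h] := pselect (forall i, i \in s -> ~~ D i -> A i 0).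
    have e U : [set _ : U | forall i, i \in s -> ~~ D i -> A i 0] = setT.
      by apply/seteqP; split.
    rewrite !e !setIT; apply: same_law => //; first by rewrite filter_uniq ?undup_uniq.
    by move=> i; rewrite mem_filter => /andP[].
  have e U : [set _ : U | forall i, i \in s -> ~~ D i -> A i 0] = set0.
    by apply/seteqP; split.
  by rewrite !e !setI0 !measure0.
- by move=> _; rewrite n1E preimage_setT (le_lt_trans (probability_le1 _ _)) // ltry.
Qed.

End Transfer.
End Cylinders.

Section LawOfLargeNumbers.
Context (R : realType) (I : eqType) d (T : measurableType d) (P : probability T R).
Variables (D : pred I) (ell : I -> probability R R) (X : I -> T -> R).
Hypothesis iX : independent_on P D ell X.
Local Open Scope ereal_scope.

Let mX i : measurable_fun setT (X i). Proof. by have [] := iX. Qed.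

Lemma law_on i A : D i -> measurable A -> P (X i @^-1` A) = ell i A.
Proof.
move=> Di mA; have [_ /(_ [:: i] (fun _ => A) isT)] := iX.
rewrite box_cons box_nil setIT big_seq1; apply => //.
by move=> j; rewrite inE => /eqP ->.
Qed.

Lemma expectation_on i (f : R -> \bar R) : D i -> measurable_fun setT f ->
  (forall x, 0 <= f x) -> \int[P]_t f (X i t) = \int[ell i]_x f x.
Proof.
move=> Di mf f0; have := ge0_integral_pushforward (mX i) P measurableT mf.
rewrite preimage_setT => <- //; apply: eq_measure_integral => A mA _.
exact: law_on.
Qed.

Lemma expectation_pair i j (f g : R -> \bar R) : D i -> D j -> i != j ->
  measurable_fun setT f -> measurable_fun setT g ->
  (forall x, 0 <= f x) -> (forall x, 0 <= g x) ->
  \int[P]_t (f (X i t) * g (X j t)) = (\int[ell i]_x f x) * (\int[ell j]_x g x).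
Proof.
move=> Di Dj ij mf mg f0 g0.
have mXij : measurable_fun setT (fun t => (X i t, X j t)) by exact: measurable_fun_pair.
have mF : measurable_fun setT (fun x : R * R => f x.1 * g x.2).
  by apply: emeasurable_funM; apply: measurableT_comp.
have := ge0_integral_pushforward mXij P measurableT mF.
rewrite preimage_setT /comp /= => <-; last by move=> y _; exact: mule_ge0.
rewrite (@eq_measure_integral _ _ _ _ (prodP (ell i) (ell j))); last first.
  move=> A mA _; rewrite /pushforward.
  transitivity (P (setT `&` (fun t => (X i t, X j t)) @^-1` A)); first by rewrite setTI.
  rewrite -[RHS]mul1e; apply: joint_law_trace => // B C mB mC.
  rewrite setTI mul1e.
  have [_ /(_ [:: i; j] (fun k => if k == i then B else C))] := iX.
  rewrite !box_cons box_nil setIT !big_cons big_nil mule1 !eqxx eq_sym (negPf ij).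
  apply => //=; first by rewrite inE ij.
    by move=> k; rewrite !inE => /orP[] /eqP ->.
  by move=> k; case: ifP.
rewrite fubini_tonelli1 //; last by move=> x; exact: mule_ge0.
rewrite -ge0_integralZr //; first last.
- by apply: integral_ge0 => x _.
apply: eq_integral => x _; rewrite /fubini_F /=.
by rewrite ge0_integralZl.
Qed.

Section WeakLaw.
Variables (f : R -> R) (m v : R).
Hypothesis mf : measurable_fun setT f.
Hypothesis f_ge0 : (forall x, 0 <= f x)%R.

Let S (s : seq I) (t : T) : R := (\sum_(i <- s) f (X i t))%R.

Let S_ge0 s t : (0 <= S s t)%R. Proof. by apply: sumr_ge0 => i _. Qed.

Let mfX i : measurable_fun setT (fun t => f (X i t)).
Proof. exact: measurableT_comp. Qed.

Let mS s : measurable_fun setT (S s).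
Proof.
elim: s => [|i s IH]; first by rewrite (_ : S [::] = cst 0%R) //;
  apply/funext => t; rewrite /S big_nil.
rewrite (_ : S (i :: s) = (fun t => f (X i t) + S s t)%R).
  exact: measurable_funD.
by apply/funext => t; rewrite /S big_cons.
Qed.

Let mean (s : seq I) := forall i, i \in s -> D i /\ \int[ell i]_x (f x)%:E = m%:E /\
  \int[ell i]_x ((f x) ^+ 2)%:E <= v%:E.

Let ES s : mean s -> \int[P]_t (S s t)%:E = ((size s)%:R * m)%:E.
Proof.
elim: s => [|i s IH] ms.
  rewrite mul0r integral0_eq // => t _; by rewrite /S big_nil.
have [Di [Em _]] := ms i (mem_head _ _).
under eq_integral do rewrite /S big_cons EFinD.
rewrite ge0_integralD //; first last.
- by apply/measurable_EFinP; exact: mS.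
- by move=> t _; rewrite lee_fin S_ge0.
- by apply/measurable_EFinP; exact: mfX.
- by move=> t _; rewrite lee_fin.
rewrite IH; last by move=> j js; apply: ms; rewrite inE js orbT.
rewrite (expectation_on (f := fun x => (f x)%:E)) ?Em //; first last.
  by apply/measurable_EFinP.
by rewrite -EFinD /= -[in RHS]natr1 mulrDl mul1r addrC.
Qed.

Let EXS i s : mean (i :: s) -> i \notin s ->
  \int[P]_t (f (X i t) * S s t)%:E = ((size s)%:R * m ^+ 2)%:E.
Proof.
elim: s => [|j s IH] ms.
  by rewrite mul0r integral0_eq // => t _; rewrite /S big_nil mulr0.
rewrite inE negb_or => /andP[ij nis].
under eq_integral do rewrite /S big_cons mulrDr EFinD.
have [Di [Emi _]] := ms i (mem_head _ _).
have [Dj [Emj _]] : D j /\ \int[ell j]_x (f x)%:E = m%:E /\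
  \int[ell j]_x ((f x) ^+ 2)%:E <= v%:E by apply: ms; rewrite !inE eqxx orbT.
rewrite ge0_integralD //; first last.
- by apply/measurable_EFinP; apply: measurable_funM => //; exact: mS.
- by move=> t _; rewrite lee_fin mulr_ge0 // S_ge0.
- by apply/measurable_EFinP; exact: measurable_funM.
- by move=> t _; rewrite lee_fin mulr_ge0.
rewrite IH //; last by move=> k; rewrite inE => /orP[/eqP ->|ks]; apply: ms;
  rewrite !inE ?eqxx // ks !orbT.
under eq_integral do rewrite EFinM.
rewrite (expectation_pair (f := fun x => (f x)%:E) (g := fun x => (f x)%:E)) //;
  try by apply/measurable_EFinP.
by rewrite Emi Emj -EFinM -EFinD -[in RHS]natr1 mulrDl mul1r addrC expr2.
Qed.

Let ES2 s : uniq s -> mean s ->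
  \int[P]_t ((S s t) ^+ 2)%:E <= ((size s)%:R * v + (size s)%:R ^+ 2 * m ^+ 2)%:E.
Proof.
elim: s => [|i s IH] us ms.
  by rewrite mul0r expr0n /= mul0r addr0 integral0_eq // => t _; rewrite /S big_nil expr0n.
move: us => /= /andP[nis us].
have ms' : mean s by move=> j js; apply: ms; rewrite inE js orbT.
have [Di [Em Ev]] := ms i (mem_head _ _).
under eq_integral do rewrite /S big_cons sqrrD -addrA EFinD EFinD.
have m1 : measurable_fun setT (fun t => (f (X i t) ^+ 2)%:E).
  by apply/measurable_EFinP; exact: measurable_funX.
have m2 : measurable_fun setT (fun t => (f (X i t) * S s t *+ 2)%:E).
  apply/measurable_EFinP; under eq_fun do rewrite -mulr_natl.
  by apply: measurable_funM => //; apply: measurable_funM => //; exact: mS.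
have m3 : measurable_fun setT (fun t => (S s t ^+ 2)%:E).
  by apply/measurable_EFinP; apply: measurable_funX; exact: mS.
rewrite ge0_integralD //; first last.
- by apply: emeasurable_funD.
- move=> t _; apply: adde_ge0; rewrite lee_fin; last exact: sqr_ge0.
  by rewrite mulrn_wge0 // mulr_ge0 // S_ge0.
- by move=> t _; rewrite lee_fin sqr_ge0.
rewrite ge0_integralD //; first last.
- by move=> t _; rewrite lee_fin sqr_ge0.
- by move=> t _; rewrite lee_fin mulrn_wge0 // mulr_ge0 // S_ge0.
have -> : \int[P]_t (f (X i t) * S s t *+ 2)%:E = ((size s)%:R * m ^+ 2 *+ 2)%:E.
  under eq_integral do rewrite -mulr_natl EFinM.
  rewrite ge0_integralZl_EFin //; first by rewrite EXS // -EFinM -[in RHS]mulr_natl.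
  - by move=> t _; rewrite lee_fin mulr_ge0 // S_ge0.
  - by apply/measurable_EFinP; apply: measurable_funM => //; exact: mS.
rewrite (expectation_on (f := fun x => ((f x) ^+ 2)%:E)) //; first last.
- by move=> x; rewrite lee_fin sqr_ge0.
- by apply/measurable_EFinP; exact: measurable_funX.
apply: (le_trans (leeD Ev (leeD (lexx _) (IH us ms')))).
rewrite -!EFinD lee_fin /= -[(size s).+1%:R]natr1.
set n : R := (size s)%:R; have n0 : (0 <= n)%R by rewrite ler0n.
have := sqr_ge0 m; set M := (m ^+ 2)%R => M0.
by rewrite sqrrD expr1n mulr1 !mulrDl mul1r -mulrnAl; lra.
Qed.

Lemma weak_law s (e : R) : (0 < e)%R -> uniq s ->
  (forall i, i \in s -> D i /\ \int[ell i]_x (f x)%:E = m%:E /\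
    \int[ell i]_x ((f x) ^+ 2)%:E <= v%:E) ->
  P [set t | (e <= `|\sum_(i <- s) f (X i t) - (size s)%:R * m|)%R] <=
  ((size s)%:R * v / e ^+ 2)%:E.
Proof.
move=> e0 us ms; set n : R := (size s)%:R.
have mV : measurable_fun setT (fun t => ((S s t - n * m) ^+ 2)%:E).
  apply/measurable_EFinP; apply: measurable_funX; apply: measurable_funB => //.
have V0 t : 0 <= ((S s t - n * m) ^+ 2)%:E by rewrite lee_fin sqr_ge0.
have m0 : (0 <= m)%R \/ n = 0%R.
  case: (posnP (size s)) => [s0|]; first by right; rewrite /n s0.
  rewrite -has_predT => /hasP[i /ms[_ [Em _]] _]; left.
  by rewrite -lee_fin -Em integral_ge0 // => x _; rewrite lee_fin.
have nm0 : (0 <= n * m)%R.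
  by case: m0 => [m0|->]; rewrite ?mul0r // mulr_ge0 ?ler0n.
have var : \int[P]_t ((S s t - n * m) ^+ 2)%:E <= (n * v)%:E.
  have E1 : \int[P]_t (((S s t - n * m) ^+ 2)%:E + (2 * (n * m) * S s t)%:E) =
      \int[P]_t ((S s t ^+ 2)%:E + ((n * m) ^+ 2)%:E).
    by apply: eq_integral => t _; rewrite -!EFinD; congr EFin; ring.
  move: E1; rewrite ge0_integralD //; first last.
  - by apply/measurable_EFinP; apply: measurable_funM.
  - by move=> t _; rewrite lee_fin mulr_ge0 // mulr_ge0.
  rewrite ge0_integralD //; first last.
  - by move=> t _; rewrite lee_fin sqr_ge0.
  - by apply/measurable_EFinP; apply: measurable_funX.
  - by move=> t _; rewrite lee_fin sqr_ge0.
  rewrite [X in _ + X = _](_ : _ = (2 * (n * m) * (n * m))%:E); last first.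
    under eq_integral do rewrite EFinM.
    rewrite ge0_integralZl_EFin //; first by rewrite ES // -EFinM.
    - by move=> t _; rewrite lee_fin.
    - by apply/measurable_EFinP.
    - by rewrite mulr_ge0.
  rewrite [X in _ = _ + X](_ : _ = ((n * m) ^+ 2)%:E); last first.
    rewrite integral_cst // -[RHS]mule1; congr (_ * _); exact: probability_setT.
  move=> E1; have h := leeD2r ((n * m) ^+ 2)%:E (ES2 us ms).
  move: h; rewrite -/n -E1 -leeBrDr // => /le_trans; apply.
  rewrite leeBlDr // -!EFinD lee_fin.
  by have -> : (n * v + n ^+ 2 * m ^+ 2 + (n * m) ^+ 2 = n * v + 2 * (n * m) * (n * m))%R by ring.
set A := [set t | _].
have mA : measurable A.
  by apply: measurable_le => //; apply: measurableT_comp => //; apply: (measurable_funB (mS s)).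
have e20 : (0 < e ^+ 2)%R by rewrite exprn_gt0.
rewrite EFinM lee_pdivlMr //; apply: (le_trans _ var).
rewrite muleC -[A]setIT -(integral_indic P measurableT mA).
rewrite -ge0_integralZl_EFin //; last 2 first.
- by apply/measurable_EFinP; exact: measurable_indic.
- exact: ltW.
apply: ge0_le_integral => //.
- by move=> t _; rewrite -EFinM lee_fin mulr_ge0 // ltW.
- apply/measurable_EFinP; apply: measurable_funM => //; exact: measurable_indic.
- move=> t _; rewrite -EFinM lee_fin indicE.
  case: (boolP (t \in A)) => [|_]; last by rewrite mulr0 sqr_ge0.
  rewrite inE /= mulr1 => At; rewrite -[leRHS]real_normK ?num_real //.
  by rewrite ler_sqr // nnegrE ltW.
Qed.

End WeakLaw.
End LawOfLargeNumbers.

(** * Laws preserved by the local move *)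

Section MeasureProbability.
Context d (T : measurableType d) (R : realType).
Variable nu : {measure set T -> \bar R}.
Hypothesis nuT : nu setT = 1%E.

Let nu' : set T -> \bar R := nu.

HB.instance Definition _ := Measure.on nu'.
HB.instance Definition _ := Measure_isProbability.Build _ _ _ nu' nuT.

Lemma measure_probability : exists m : probability T R, forall A, m A = nu A.
Proof. by exists nu'. Qed.

End MeasureProbability.

Section Mixtures.
Context (R : realType).
Local Open Scope ereal_scope.
Implicit Types (m a b : probability R R).

Definition mixture (p : R) m a b :=
  forall A : set R, measurable A -> m A = p%:E * a A + (1 - p)%:E * b A.

Lemma mixture_exists p a b : (0 <= p <= 1)%R -> exists m, mixture p m a b.
Proof.
move=> /andP[p0 p1]; have q0 : (0 <= 1 - p)%R by rewrite subr_ge0.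
pose nu : {measure set R -> \bar R} :=
  measure_add (mscale (NngNum p0) a) (mscale (NngNum q0) b).
have nuE A : nu A = p%:E * a A + (1 - p)%:E * b A.
  exact: measure_addE.
have nuT : nu setT = 1 by rewrite nuE !probability_setT !mule1 -EFinD subrKC.
by have [m mE] := measure_probability nuT; exists m => A mA; rewrite mE.
Qed.

Lemma integral_mixture p m a b (f : R -> \bar R) : (0 <= p <= 1)%R -> mixture p m a b ->
  measurable_fun setT f -> (forall x, 0 <= f x) ->
  \int[m]_x f x = p%:E * \int[a]_x f x + (1 - p)%:E * \int[b]_x f x.
Proof.
move=> /andP[p0 p1] E mf f0; have q0 : (0 <= 1 - p)%R by rewrite subr_ge0.
rewrite (@eq_measure_integral _ _ _ _
  (measure_add (mscale (NngNum p0) a) (mscale (NngNum q0) b))); last first.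
  by move=> A mA _; rewrite E //; apply/esym; exact: measure_addE.
by rewrite ge0_integral_measure_add // !ge0_integral_mscale.
Qed.

Lemma ray_unique (m1 m2 : {measure set R -> \bar R}) : m1 setT < +oo ->
  (forall x : R, m1 `]x, +oo[%classic = m2 `]x, +oo[%classic) ->
  forall A : set R, measurable A -> m1 A = m2 A.
Proof.
move=> foo E A mA.
apply: (measure_unique (@RGenOInfty.G R) (fun n => `](- n%:R)%R, +oo[%classic)) => //.
- exact: RGenOInfty.measurableE.
- move=> _ _ [x ->] [y ->]; exists (Num.max x y).
  by apply/seteqP; split => z /=; rewrite !in_itv /= !andbT gt_max;
    [move=> [-> ->]|move=> /andP[]].
- by move=> n; exists (- n%:R)%R.
- apply/seteqP; split => // x _.
  exists (Num.truncn (- x)).+1 => //=; rewrite in_itv /= andbT ltrNl.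
  exact: truncnS_gt.
- by move=> _ [x ->].
- move=> n; apply: le_lt_trans foo; apply: le_measure; rewrite ?inE //.
Qed.

Lemma full_inter d (T : measurableType d) (m : probability T R) (D A : set T) :
  measurable D -> m D = 1 -> measurable A -> m A = m (A `&` D).
Proof.
move=> mD mD1 mA; have mDc : m (~` D) = 0.
  by rewrite probability_setC // mD1 subee.
rewrite (measureDI m mA mD).
rewrite [X in X + _](_ : _ = 0) ?add0e //; apply/eqP; rewrite eq_le measure_ge0 andbT.
by rewrite -mDc; apply: le_measure; rewrite ?inE;
  [exact: measurableD|exact: measurableC|move=> x []].
Qed.

Lemma eq_full d (T : measurableType d) (m : probability T R) (D A B : set T) :
  measurable D -> m D = 1 -> measurable A -> measurable B ->
  (forall x, D x -> A x <-> B x) -> m A = m B.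
Proof.
move=> mD mD1 mA mB AB; rewrite (full_inter mD mD1 mA) (full_inter mD mD1 mB).
by congr (m _); apply/seteqP; split => x [] ? Dx; split=> //; apply/AB.
Qed.

Lemma eq_integral_full d (T : measurableType d) (m : probability T R) (D : set T)
    (f g : T -> \bar R) :
  measurable D -> m D = 1 -> measurable_fun setT f -> measurable_fun setT g ->
  (forall x, 0 <= f x) -> (forall x, 0 <= g x) -> (forall x, D x -> f x = g x) ->
  \int[m]_x f x = \int[m]_x g x.
Proof.
move=> mD mD1 mf mg f0 g0 fg; have mDc : m (~` D) = 0.
  by rewrite probability_setC // mD1 subee.
rewrite (ge0_negligible_integral (measurableC mD)) //.
rewrite [RHS](ge0_negligible_integral (measurableC mD)) //.
by apply: eq_integral => x; rewrite inE setTD setCK => /fg.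
Qed.

Lemma prodP_ysection d1 d2 (T1 : measurableType d1) (T2 : measurableType d2)
    (m1 : probability T1 R) (m2 : probability T2 R) E :
  measurable E -> prodP m1 m2 E = \int[m2]_y m1 (ysection E y).
Proof.
move=> mE; have := @product_measure_unique _ _ _ _ _ m1 m2 [the {measure set _ -> \bar R} of (m1 \x^ m2)%E] _ E mE.
by apply => A B mA mB; exact: product_measure2E.
Qed.

Lemma integral_diracP (x : R) (f : R -> \bar R) : measurable_fun setT f ->
  \int[dirac x]_y f y = f x.
Proof. by move=> mf; rewrite integral_dirac // diracT mul1e. Qed.

(* [W] is drawn from [nuW] with probability [p] and vanishes otherwise, the
   edges carry [Q] (positive with probability [pq]) and [G] (positive with
   probability [u]). *)
Section MovePreserving.
Variables (p pq u : R) (W Q G nuW nuQ nuX nuN : probability R R).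
Hypothesis p01 : (0 <= p <= 1)%R.
Hypothesis pq01 : (0 <= pq <= 1)%R.
Hypothesis u01 : (0 <= u <= 1)%R.
Hypothesis mixW : mixture p W nuW (dirac (0%R : R)).
Hypothesis mixQ : mixture pq Q nuQ (dirac (0%R : R)).
Hypothesis mixG : mixture u G nuX nuN.
Hypothesis nuW_pos : nuW `]0%R, +oo[%classic = 1.
Hypothesis nuX_pos : nuX `]0%R, +oo[%classic = 1.
Hypothesis nuQ_pos : nuQ `]0%R, +oo[%classic = 1.
Hypothesis nuN_neg : nuN `]-oo, 0%R]%classic = 1.
Hypothesis weights : (pq * (1 - p) = (1 - pq) * (u * p))%R.
Hypothesis memoryless : forall A B : set R, measurable A -> measurable B ->
  prodP nuX nuW [set t | A (Num.min t.1 t.2) /\ B (t.1 - t.2)%R] = nuQ A * G B.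

Let mmin : measurable_fun setT (fun t : R * R => Num.min t.1 t.2).
Proof. by apply: measurable_minr; [exact: measurable_fst|exact: measurable_snd]. Qed.

Let msub : measurable_fun setT (fun t : R * R => (t.1 - t.2)%R).
Proof. by apply: measurable_funB; [exact: measurable_fst|exact: measurable_snd]. Qed.

Lemma memoryless_joint (E : set (R * R)%type) : measurable E ->
  prodP nuX nuW [set t : (R * R)%type | E (Num.min t.1 t.2, t.1 - t.2)%R] = prodP nuQ G E.
Proof.
move=> mE; have := @joint_law_trace _ _ _ _ _ _ _ (prodP nuX nuW) setT 1 nuQ G
  (fun t => Num.min t.1 t.2) (fun t => t.1 - t.2)%R measurableT lee01 isT mmin msub.
move=> /(_ _ _ mE); rewrite setTI mul1e; apply => A B mA mB.
by rewrite setTI mul1e -memoryless.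
Qed.

Lemma memoryless_inverse (E : set (R * R)%type) : measurable E ->
  prodP nuQ G [set t : (R * R)%type | E (t.1 + pos t.2, t.1 + neg t.2)%R] = prodP nuX nuW E.
Proof.
move=> mE; rewrite -memoryless_joint; last first.
  have mf : measurable_fun setT (fun t : R * R => (t.1 + pos t.2, t.1 + neg t.2)%R).
    apply: measurable_fun_pair; apply: measurable_funD; try exact: measurable_fst.
      by apply: measurable_pos; exact: measurable_snd.
    by apply: measurable_neg_part; exact: measurable_snd.
  by rewrite -[X in measurable X]setTI; exact: mf.
have K (x w : R) : (Num.min x w + pos (x - w), Num.min x w + neg (x - w))%R = (x, w).
  by have [[? [-> ->]]|[? [-> ->]]] := posP (x - w);
    have [[? ->]|[? ->]] := minP x w; congr (_, _); lra.
by congr (prodP _ _ _); apply/seteqP; split => -[x w] /=; rewrite K.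
Qed.

Section Rectangle.
Variables A B C : set R.
Hypotheses (mA : measurable A) (mB : measurable B) (mC : measurable C).

Let S (z : R) : set (R * R)%type :=
  [set t | [/\ A (top t.1 t.2 z), B (right t.1 t.2 z) & C (dual t.1 t.2 z)]].

Let K : set (R * R)%type := [set t | A (Num.min t.1 t.2) /\ B (t.1 - t.2)%R].

Let k (z : R) := nuX (ysection K z).

Let mK : measurable K.
Proof.
rewrite (_ : K = (fun t => Num.min t.1 t.2) @^-1` A `&` (fun t => t.1 - t.2)%R @^-1` B) //.
by apply: measurableI; apply: preimage_measurable.
Qed.

Let mk : measurable_fun setT k.
Proof. exact: measurable_fun_ysection. Qed.

Let mS3 : measurable [set t : (R * R) * R | S t.2 t.1].
Proof.
have mt1 : measurable_fun setT (fun t : (R * R) * R => t.1.1).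
  by apply: measurableT_comp => //; exact: measurable_fst.
have mt2 : measurable_fun setT (fun t : (R * R) * R => t.1.2).
  by apply: measurableT_comp => //; exact: measurable_snd.
have mt3 : measurable_fun setT (fun t : (R * R) * R => t.2) by exact: measurable_snd.
rewrite (_ : [set _ | _] = (fun t => top t.1.1 t.1.2 t.2) @^-1` A `&`
   ((fun t => right t.1.1 t.1.2 t.2) @^-1` B `&`
    (fun t => dual t.1.1 t.1.2 t.2) @^-1` C)); last first.
  by apply/seteqP; split => t /= [] // ? [].
apply: measurableI; first by apply: preimage_measurable => //; exact: measurable_top.
apply: measurableI; apply: preimage_measurable => //.
  exact: measurable_right.
exact: measurable_dual.
Qed.

Let SE z : S z = ysection [set t : (R * R) * R | S t.2 t.1] z.
Proof. by apply/seteqP; split => t; rewrite /ysection /= inE. Qed.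

Let mS z : measurable (S z).
Proof. by rewrite SE; exact: measurable_ysection. Qed.

Let law_Q (z : R) : (0 <= z)%R -> prodP nuQ G (S z) = k z * nuW C.
Proof.
move=> z0.
pose E : set (R * R)%type := ysection K z `*` C.
have mE : measurable E by apply: measurableX => //; exact: measurable_ysection.
rewrite -[RHS]prodPE //; last exact: measurable_ysection.
rewrite -memoryless_inverse //.
have mD : measurable (`]0%R, +oo[%classic `*` setT : set (R * R)%type) by exact: measurableX.
apply: (eq_full mD) => //.
- by rewrite prodPE // nuQ_pos probability_setT mule1.
- have mf : measurable_fun setT (fun t : R * R => (t.1 + pos t.2, t.1 + neg t.2)%R).
    apply: measurable_fun_pair; apply: measurable_funD; try exact: measurable_fst.
      by apply: measurable_pos; exact: measurable_snd.
    by apply: measurable_neg_part; exact: measurable_snd.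
  by rewrite -[X in measurable X]setTI; exact: mf.
move=> [x y] [/=]; rewrite in_itv /= andbT => x0 _; have y0 := pos_ge0 y.
have X0 : (x + pos y == 0)%R = false by apply/negbTE; rewrite gt_eqF // ltr_wpDr.
rewrite /S /E /ysection /= /top /right /dual X0 inE /K /= minC.
by split=> [[]|[[]]].
Qed.

Let law_0 (z : R) : (0 <= z)%R -> G (xsection (S z) (0%R : R)) =
  u%:E * ((\1_C (0%R : R))%:E * k z) + (1 - u)%:E * ((\1_A (0%R : R) * \1_C z)%:E * nuN B).
Proof.
move=> z0; have mx := measurable_xsection (0%R : R) (mS z).
rewrite mixG //; congr (_ * _ + _ * _).
- transitivity (nuX (if (0%R : R) \in C then ysection K z else set0)); last first.
    by rewrite indicE; case: ifP => _; rewrite ?mul1e // mul0e measure0.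
  apply: (eq_full _ nuX_pos) => //; first by case: ifP => // _; exact: measurable_ysection.
  move=> y /=; rewrite in_itv /= andbT => y0.
  have [[? [yE nE]]|[? _]] := posP y; last by lra.
  rewrite /xsection /S /= inE /= /top /right /dual add0r yE nE gt_eqF // addr0.
  case: ifPn => [|/negP]; rewrite inE => C0; last by split=> // -[].
  by rewrite /ysection /= inE /K /= minC; split=> [[]|[]].
- transitivity (nuN (if ((0%R : R) \in A) && (z \in C) then B else set0)); last first.
    rewrite !indicE; case: ((0%R : R) \in A); case: (z \in C);
    by rewrite /= ?mul1r ?mul0r ?mul1e ?mul0e ?measure0.
  apply: (eq_full _ nuN_neg) => //; first by case: ifP.
  move=> y /=; rewrite in_itv /= => y0.
  have yE : pos y = 0%R by have [[? [-> _]]|[? [-> _]]] := posP y; lra.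
  rewrite /xsection /S /= inE /= /top /right /dual add0r yE eqxx.
  case: ifPn => [/andP[]|/nandP[] /negP]; rewrite !inE => A0.
  + by move=> Cz; split=> [[]|].
  + by split=> // -[].
  + by split=> // -[].
Qed.

Let law_S (z : R) : (0 <= z)%R -> prodP Q G (S z) =
  (pq * fine (nuW C) + (1 - pq) * u * \1_C (0%R : R))%:E * k z +
  ((1 - pq) * (1 - u) * \1_A (0%R : R) * fine (nuN B))%:E * (\1_C z)%:E.
Proof.
move=> z0; have mx : measurable_fun setT (fun x => G (xsection (S z) x)).
  exact: measurable_fun_xsection.
transitivity (\int[Q]_x G (xsection (S z) x)) => //.
rewrite (integral_mixture pq01 mixQ) // integral_diracP // law_0 //.
rewrite [X in _ * X + _](_ : _ = k z * nuW C); last by rewrite -law_Q.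
have fk : k z = (fine (k z))%:E by rewrite fineK // fin_num_measure //; exact: measurable_ysection.
have fW : nuW C = (fine (nuW C))%:E by rewrite fineK // fin_num_measure.
have fN : nuN B = (fine (nuN B))%:E by rewrite fineK // fin_num_measure.
rewrite fk fW fN !(=^~ EFinM, =^~ EFinD) /=; congr EFin; ring.
Qed.

Let int_k : \int[nuW]_z k z = nuQ A * G B.
Proof. by rewrite -memoryless // prodP_ysection. Qed.

Lemma law_rectangle : prodP (prodP Q G) W [set t | [/\ A (top t.1.1 t.1.2 t.2),
    B (right t.1.1 t.1.2 t.2) & C (dual t.1.1 t.1.2 t.2)]] = Q A * (G B * W C).
Proof.
pose f z := prodP Q G (S z).
have mf : measurable_fun setT f.
  rewrite (_ : f = fun z => prodP Q G (ysection [set t : (R * R) * R | S t.2 t.1] z)).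
    exact: measurable_fun_ysection.
  by apply/funext => z; rewrite /f SE.
rewrite prodP_ysection //; under eq_integral do rewrite -SE -/(f _).
rewrite (integral_mixture p01 mixW) // integral_diracP //.
set c1 := (pq * fine (nuW C) + (1 - pq) * u * \1_C (0%R : R))%R.
set c2 := ((1 - pq) * (1 - u) * \1_A (0%R : R) * fine (nuN B))%R.
have [/andP[p0 p1] /andP[q0 q1] /andP[u0 u1]] := And3 p01 pq01 u01.
have c10 : (0 <= c1)%R.
  by rewrite addr_ge0 ?mulr_ge0 // ?subr_ge0 // fine_ge0.
have c20 : (0 <= c2)%R.
  by rewrite /c2 !mulr_ge0 // ?subr_ge0 // fine_ge0.
have mC1 : measurable_fun setT (fun z => (\1_C z)%:E : \bar R).
  by apply/measurable_EFinP; exact: measurable_indic.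
rewrite (_ : \int[nuW]_z f z = c1%:E * (nuQ A * G B) + c2%:E * nuW C); last first.
  rewrite (@eq_integral_full _ _ nuW `]0%R, +oo[%classic f
    (fun z => c1%:E * k z + c2%:E * (\1_C z)%:E)) //.
  - rewrite ge0_integralD //.
    + rewrite !ge0_integralZl_EFin // int_k; congr (_ + _ * _).
      by rewrite integral_indic // setIT.
    + by move=> z _; rewrite mule_ge0.
    + exact: measurable_funeM.
    + by move=> z _; rewrite -EFinM lee_fin mulr_ge0.
    + exact: measurable_funeM.
  - by apply: emeasurable_funD; exact: measurable_funeM.
  - by move=> z; rewrite adde_ge0 // ?mule_ge0 // -?EFinM lee_fin // mulr_ge0.
  - by move=> z; rewrite /= in_itv /= andbT => z0; rewrite /f law_S // ltW.
have k0 : k (0%R : R) = (\1_A (0%R : R))%:E * nuX B.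
  transitivity (nuX (if (0%R : R) \in A then B else set0)); last first.
    by rewrite indicE; case: ifP => _; rewrite ?mul1e // mul0e measure0.
  apply: (eq_full _ nuX_pos) => //; first exact: measurable_ysection.
    by case: ifP.
  move=> y /=; rewrite in_itv /= andbT => y0.
  rewrite /ysection /= inE /K /= subr0 min_r ?ltW //.
  by case: ifPn => [|/negP]; rewrite inE => A0; split=> // -[].
have WC : W C = p%:E * nuW C + (1 - p)%:E * (\1_C (0%R : R))%:E := mixW mC.
have QA : Q A = pq%:E * nuQ A + (1 - pq)%:E * (\1_A (0%R : R))%:E := mixQ mA.
rewrite /f law_S // -/c1 -/c2 k0 QA WC mixG //.
have fin (m : probability R R) (E : set R) : measurable E -> m E = (fine (m E))%:E.
  by move=> mE; rewrite fineK // fin_num_measure.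
rewrite (fin nuW C mC) (fin nuX B mB) (fin nuN B mB) (fin nuQ A mA) /c1 /c2 /=.
rewrite !(=^~ EFinM, =^~ EFinD) /=; congr EFin.
set xW := fine (nuW C); set xX := fine (nuX B); set xN := fine (nuN B); set xQ := fine (nuQ A).
set a := \1_A _; set c := \1_C _; apply/eqP; rewrite -subr_eq0; apply/eqP.
transitivity ((pq * (1 - p) - (1 - pq) * (u * p)) *
   (a * xX * xW - c * xQ * (u * xX + (1 - u) * xN)))%R.
  by ring.
by rewrite weights subrr mul0r.
Qed.

End Rectangle.

Lemma mixture_move_preserving : move_preserving Q G W.
Proof. by move=> A B C mA mB mC; exact: law_rectangle. Qed.

End MovePreserving.
End Mixtures.

(** * Exponential and Bernoulli boundary laws *)

Section Exponential.
Context (R : realType).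
Local Open Scope ereal_scope.
Notation leb := (@lebesgue_measure R).
Implicit Types (l k : R) (m : probability R R).

Definition is_exponential l m := [/\ (0 < l)%R, m `]0%R, +oo[%classic = 1,
  (forall x : R, (0 <= x)%R -> m `[x, +oo[%classic = (expR (- l * x))%:E),
  (forall x : R, (0 <= x)%R -> m `]x, +oo[%classic = (expR (- l * x))%:E) &
  (forall f : R -> \bar R, measurable_fun setT f -> (forall x, 0 <= f x) ->
    \int[m]_x f x = \int[leb]_x (f x * (exponential_pdf l x)%:E))].

Lemma exponential_exists l : (0 < l)%R -> exists m : probability R R,
  is_exponential l m /\ forall A : set R, m A = exponential_prob l A.
Proof.
move=> l0; have pdf0 := exponential_pdf_ge0 (ltW l0).
have mpdf : measurable_fun setT (fun x => (exponential_pdf l x)%:E : \bar R).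
  by apply/measurable_EFinP; exact: measurable_exponential_pdf.
pose e := exponential_distribution_exponential_prob__canonical__probability_measure_Probability l0.
have mid : measurable_fun setT (fun x : measurableTypeR R => x : R).
  by move=> _ A mA; rewrite setTI; exact: mA.
have [m mE] : exists m : probability R R, forall A : set R, m A = exponential_prob l A.
  have [nu nuE] := pushforward_measure e mid.
  have nuT : nu setT = 1 by rewrite nuE preimage_setT; exact: probability_setT e.
  by have [m mE] := measure_probability nuT; exists m => A; rewrite mE nuE.
exists m; split => //.
have mU (A B : set R) : measurable A -> measurable B -> A `&` B = set0 ->
    m (A `|` B) = m A + m B by exact: measureU.
have neg0 : m `]-oo, 0%R[%classic = 0.
  rewrite mE /exponential_prob integral0_eq // => x /=; rewrite in_itv /= => x0.
  by rewrite lt0_exponential_pdf.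
have pt0 : m [set (0%R : R)] = 0 by rewrite mE /exponential_prob integral_set1.
have le0 : m `]-oo, 0%R]%classic = 0.
  rewrite (_ : `]-oo, 0%R]%classic = `]-oo, 0%R[%classic `|` [set (0%R : R)]).
    rewrite mU ?neg0 ?pt0 ?adde0 //.
    by apply/seteqP; split => // x [/=]; rewrite in_itv /= => /[swap] ->; rewrite ltxx.
  apply/seteqP; split => x /=; rewrite !in_itv /=.
    by rewrite le_eqVlt => /orP[/eqP ->|]; [right|left].
  by move=> [/ltW|->].
have pos1 : m `]0%R, +oo[%classic = 1.
  by rewrite -setCitvl probability_setC // le0 sube0.
have tail (x : R) : (0 <= x)%R -> m `]x, +oo[%classic = (expR (- l * x))%:E.
  rewrite le_eqVlt => /orP[/eqP <-|x0]; first by rewrite mulr0 expR0 pos1.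
  rewrite -setCitvl probability_setC //.
  rewrite (_ : `]-oo, x]%classic = `]-oo, 0%R[%classic `|` `[0%R, x]%classic); last first.
    apply/seteqP; split => y /=; rewrite !in_itv /=.
      by move=> yx; case: (ltP y 0%R) => y0; [left|right; rewrite yx].
    by move=> [/ltW/le_trans|/andP[_]//]; apply; exact: ltW.
  rewrite mU //; last first.
    apply/seteqP; split => // y [/=]; rewrite !in_itv /= => y0 /andP[+ _].
    by rewrite leNgt y0.
  have ex := exponential_prob_itv0c l x0.
  rewrite neg0 add0e mE ex; transitivity ((1 - (1 - expR (- l * x)))%R%:E : \bar R) => //.
  by congr EFin; ring.
split => //.
- move=> x x0; rewrite -tail // (_ : `[x, +oo[%classic = [set x] `|` `]x, +oo[%classic).
    rewrite mU //; first by rewrite mE /exponential_prob integral_set1 add0e.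
    by apply/seteqP; split => // y [/= ->]; rewrite in_itv /= ltxx.
  apply/seteqP; split => y /=; rewrite !in_itv /= !andbT.
    by rewrite le_eqVlt => /orP[/eqP ->|]; [left|right].
  by move=> [->|/ltW].
- move=> f mf f0.
  have -> : \int[m]_x f x = \int[e]_x f x.
    have <- := ge0_integral_pushforward mid e measurableT mf (fun x _ => f0 x).
    by apply: eq_measure_integral => A mA _; exact: mE.
  have dom : e `<< leb.
    apply/null_content_dominatesP => A mA A0.
    by apply: null_set_integral => //; exact: measurable_funTS.
  rewrite -(Radon_Nikodym_SigmaFinite.change_of_variables dom) //.
  apply: ge0_ae_eq_integral => //.
  - apply: emeasurable_funM => //; apply: (measurable_int leb).
    exact: (Radon_Nikodym_SigmaFinite.f_integrable dom).
  - exact: emeasurable_funM.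
  - by move=> x _; rewrite mule_ge0 //; exact: Radon_Nikodym_SigmaFinite.f_ge0.
  - by move=> x _; rewrite mule_ge0 // lee_fin.
  apply: ae_eqe_mul2l; apply: integral_ae_eq => //.
    exact: (Radon_Nikodym_SigmaFinite.f_integrable dom).
  by move=> E _ mE'; rewrite -(Radon_Nikodym_SigmaFinite.f_integral dom).
Qed.

Lemma exponential_ray k m (x : R) : is_exponential k m -> (x <= 0)%R ->
  m `]x, +oo[%classic = 1.
Proof.
move=> [_ m1 _ _ _] x0; apply/eqP; rewrite eq_le probability_le1 //= -m1.
apply: le_measure; rewrite ?inE // => y /=; rewrite !in_itv /= !andbT.
exact: le_lt_trans.
Qed.

Lemma exponential_shift l k (m ms : probability R R) (c a : R) : (0 < l)%R ->
  is_exponential k m -> is_exponential (l + k) ms -> (0 <= c)%R -> (0 <= a)%R ->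
  \int[m]_w (\1_(`]a, +oo[%classic) w * expR (- l * (w + c)))%:E =
  (expR (- l * c) * (k / (l + k)))%:E * ms `]a, +oo[%classic.
Proof.
move=> l0 [k0 _ _ _ mI] [s0 _ _ _ sI] c0 a0.
have mi : measurable_fun setT (\1_(`]a, +oo[%classic) : R -> R).
  exact: measurable_indic.
have me : measurable_fun setT (fun w : R => expR (- l * (w + c))).
  apply: measurableT_comp; first exact: measurable_expR.
  by apply: measurable_funM => //; apply: measurable_funD.
have mf : measurable_fun setT
    (fun w => (\1_(`]a, +oo[%classic) w * expR (- l * (w + c)))%:E : \bar R).
  by apply/measurable_EFinP; exact: measurable_funM.
rewrite (mI _ mf); last by move=> x; rewrite lee_fin mulr_ge0 // expR_ge0.
have -> : ms `]a, +oo[%classic = \int[leb]_x ((\1_(`]a, +oo[%classic) x)%:E *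
    (exponential_pdf (l + k) x)%:E).
  rewrite -sI; first by rewrite integral_indic // setIT.
    exact/measurable_EFinP.
  by move=> x; rewrite lee_fin.
have mg : measurable_fun setT (fun x => (\1_(`]a, +oo[%classic) x)%:E *
    (exponential_pdf (l + k) x)%:E : \bar R).
  apply: emeasurable_funM; apply/measurable_EFinP => //.
  exact: measurable_exponential_pdf.
transitivity (\int[leb]_x ((expR (- l * c) * (k / (l + k)))%:E *
    ((\1_(`]a, +oo[%classic) x)%:E * (exponential_pdf (l + k) x)%:E))); last first.
  apply: ge0_integralZl_EFin => //.
  - by move=> x _; rewrite -EFinM lee_fin mulr_ge0 // exponential_pdf_ge0 // ltW.
  - by rewrite mulr_ge0 ?expR_ge0 // divr_ge0 ?ltW // ltW.
apply: eq_integral => x _; rewrite -!EFinM; congr EFin.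
case: (ltP x 0%R) => x0; first by rewrite !lt0_exponential_pdf // !mulr0.
rewrite !exponential_pdfE //.
have -> : (expR (- l * (x + c)) = expR (- l * c) * expR (- l * x))%R.
  by rewrite -expRD; congr expR; ring.
have -> : (expR (- (l + k) * x) = expR (- l * x) * expR (- k * x))%R.
  by rewrite -expRD; congr expR; ring.
by field; rewrite gt_eqF.
Qed.

Section Memoryless.
Variables (l k : R) (nuX nuW nuQ nuN G : probability R R).
Hypothesis eX : is_exponential l nuX.
Hypothesis eW : is_exponential k nuW.
Hypothesis eQ : is_exponential (l + k) nuQ.
Hypothesis nuNE : forall A, measurable A -> nuN A = nuW (-%R @^-1` A).
Hypothesis mixG : mixture (k / (l + k)) G nuX nuN.

Let l0 : (0 < l)%R. Proof. by case: eX. Qed.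
Let k0 : (0 < k)%R. Proof. by case: eW. Qed.

Let G_ray_ge0 (b : R) : (0 <= b)%R ->
  G `]b, +oo[%classic = (expR (- l * b) * (k / (l + k)))%:E.
Proof.
move=> b0; rewrite mixG // nuNE //.
have -> : nuW (-%R @^-1` `]b, +oo[%classic) = 0.
  have [_ W1 _ _ _] := eW; apply/eqP; rewrite eq_le measure_ge0 andbT.
  rewrite (full_inter _ W1) //; last first.
    by apply: preimage_measurable => //; exact: oppr_measurable.
  rewrite (_ : _ `&` _ = set0) ?measure0 //; apply/seteqP; split => // x [/=].
  by rewrite !in_itv /= !andbT; lra.
by have [_ _ _ -> // _] := eX; rewrite mule0 adde0 -EFinM mulrC.
Qed.

Let G_ray_lt0 (b : R) : (b < 0)%R ->
  G `]b, +oo[%classic = (1 - expR (k * b) * (l / (l + k)))%:E.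
Proof.
move=> b0; rewrite mixG // nuNE // (exponential_ray eX (ltW b0)).
have -> : -%R @^-1` `]b, +oo[%classic = ~` `[(- b)%R, +oo[%classic.
  by apply/seteqP; split => x /=; rewrite !in_itv /= !andbT; [move=> ?; apply/negP; lra|move/negP; lra].
have [_ _ Wc _ _] := eW.
rewrite probability_setC // Wc ?oppr_ge0 ?ltW // mule1.
transitivity ((k / (l + k) + (1 - k / (l + k)) * (1 - expR (- k * - b)))%R%:E : \bar R) => //.
congr EFin; rewrite mulrNN; field; have := l0; have := k0; by move=> ? ?; rewrite gt_eqF // addr_gt0.
Qed.

Let quadrant (a b : R) : set (R * R)%type :=
  [set t | (a < Num.min t.1 t.2)%R /\ (b < t.1 - t.2)%R].

Let mmin : measurable_fun setT (fun t : R * R => Num.min t.1 t.2).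
Proof. by apply: measurable_minr; [exact: measurable_fst|exact: measurable_snd]. Qed.

Let msub : measurable_fun setT (fun t : R * R => (t.1 - t.2)%R).
Proof. by apply: measurable_funB; [exact: measurable_fst|exact: measurable_snd]. Qed.

Let mpair (A B : set R) : measurable A -> measurable B ->
  measurable [set t : (R * R)%type | A (Num.min t.1 t.2) /\ B (t.1 - t.2)%R].
Proof.
by move=> mA mB; apply: measurableI; [exact: (preimage_measurable mmin)|exact: (preimage_measurable msub)].
Qed.

Let ray_setE (a : R) : `]a, +oo[%classic = [set x | a < x]%R.
Proof. by apply/seteqP; split => x /=; rewrite in_itv /= andbT. Qed.

Let mquadrant a b : measurable (quadrant a b).
Proof.
have := mpair (measurable_itv `]a, +oo[) (measurable_itv `]b, +oo[).
by rewrite !ray_setE.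
Qed.

Let quadrant_ge0 (a b : R) : (0 <= a)%R -> (0 <= b)%R ->
  prodP nuX nuW (quadrant a b) = nuQ `]a, +oo[%classic * G `]b, +oo[%classic.
Proof.
move=> a0 b0; rewrite prodP_ysection // G_ray_ge0 //.
have := exponential_shift l0 eW eQ b0 a0; rewrite [X in _ = X -> _]muleC => <-.
have [_ W1 _ _ _] := eW; apply: (eq_integral_full _ W1) => //.
- exact: measurable_fun_ysection.
- apply/measurable_EFinP; apply: measurable_funM; first exact: measurable_indic.
  apply: measurableT_comp; first exact: measurable_expR.
  by apply: measurable_funM => //; apply: measurable_funD.
move=> w /=; rewrite in_itv /= andbT => w0.
have wb0 : (0 <= w + b)%R by rewrite addr_ge0 // ltW.
have [_ _ _ Xt _] := eX.
rewrite indicE ray_setE; case: (boolP (w \in _)) => [|/negP]; rewrite inE /= => aw.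
  rewrite mul1r -Xt // ray_setE; congr (nuX _).
  apply/seteqP; split => x; rewrite /ysection /= inE /quadrant /= lt_min; first by lra.
  by move=> ?; split; [apply/andP; split|]; lra.
rewrite mul0r (_ : ysection _ _ = set0) ?measure0 //.
apply/seteqP; split => // x; rewrite /ysection /= inE /quadrant /= lt_min.
by move=> [/andP[]]; lra.
Qed.

Let quadrant_lt0 (a b : R) : (0 <= a)%R -> (b < 0)%R ->
  prodP nuX nuW (quadrant a b) = nuQ `]a, +oo[%classic * G `]b, +oo[%classic.
Proof.
move=> a0 b0; rewrite G_ray_lt0 //.
pose H : set (R * R)%type := [set t | (a < Num.min t.1 t.2)%R /\ (t.1 - t.2 <= b)%R].
have mH : measurable H.
  have := mpair (measurable_itv `]a, +oo[) (measurable_itv `]-oo, b]).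
  by rewrite ray_setE (_ : `]-oo, b]%classic = [set x | x <= b]%R).
have [_ _ _ Xt _] := eX; have [_ _ Wc Wt _] := eW; have [_ _ _ Qt _] := eQ.
have QE : nuQ `]a, +oo[%classic = (expR (- (l + k) * a))%:E by rewrite Qt.
have both : prodP nuX nuW (quadrant a b `|` H) = nuQ `]a, +oo[%classic.
  rewrite (_ : _ `|` _ = `]a, +oo[%classic `*` `]a, +oo[%classic).
    rewrite prodPE // Xt // Wt // QE -EFinM -expRD; congr (expR _)%:E; ring.
  rewrite !ray_setE; apply/seteqP; split => -[x y] /=.
    by rewrite /quadrant /H /= lt_min => -[[/andP[]]|[/andP[]]].
  move=> [ax ay]; rewrite /quadrant /H /= lt_min ax ay.
  by case: (ltP b (x - y)%R) => ?; [left|right].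
have PH : prodP nuX nuW H = (expR (k * b) * (l / (l + k)))%:E * nuQ `]a, +oo[%classic.
  have eQ' : is_exponential (k + l) nuQ by rewrite addrC.
  have b0' : (0 <= - b)%R by lra.
  have := exponential_shift k0 eX eQ' b0' a0; rewrite mulrNN [(k + l)%R]addrC => <-.
  have [_ X1 _ _ _] := eX; apply: (eq_integral_full _ X1) => //.
  - exact: measurable_fun_xsection.
  - apply/measurable_EFinP; apply: measurable_funM; first exact: measurable_indic.
    apply: measurableT_comp; first exact: measurable_expR.
    by apply: measurable_funM => //; apply: measurable_funD.
  move=> x /=; rewrite in_itv /= andbT => x0.
  have xb0 : (0 <= x - b)%R by lra.
  rewrite indicE ray_setE; case: (boolP (x \in _)) => [|/negP]; rewrite inE /= => ax.
    rewrite mul1r -Wc //; congr (nuW _).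
    apply/seteqP; split => w; rewrite /xsection /= inE /H /= in_itv /= andbT lt_min.
      by move=> [_]; lra.
    by move=> ?; split; [apply/andP; split|]; lra.
  rewrite mul0r (_ : xsection _ _ = set0) ?measure0 //.
  apply/seteqP; split => // w; rewrite /xsection /= inE /H /= lt_min.
  by move=> [/andP[]]; lra.
have dis : quadrant a b `&` H = set0.
  by apply/seteqP; split => // -[x y] [[/= _ h1] [/= _ h2]]; lra.
have := measureU (prodP nuX nuW) (mquadrant a b) mH dis.
rewrite [LHS]both [X in _ = _ + X]PH QE -EFinM.
have -> : prodP nuX nuW (quadrant a b) = (fine (prodP nuX nuW (quadrant a b)))%:E.
  by rewrite fineK // fin_num_measure.
rewrite [X in _ = X + _ -> _](_ : _ = (fine (prodP nuX nuW (quadrant a b)))%:E); last first.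
  by rewrite fineK // fin_num_measure.
rewrite -EFinD -EFinM => -[e]; congr EFin; lra.
Qed.

Let quadrantE (a b : R) :
  prodP nuX nuW (quadrant a b) = nuQ `]a, +oo[%classic * G `]b, +oo[%classic.
Proof.
have pos_a a' : (0 <= a')%R ->
    prodP nuX nuW (quadrant a' b) = nuQ `]a', +oo[%classic * G `]b, +oo[%classic.
  by move=> a0; case: (ltP b 0%R) => b0; [exact: quadrant_lt0|exact: quadrant_ge0].
case: (leP 0%R a) => [|a0]; first exact: pos_a.
rewrite (exponential_ray eQ (ltW a0)) -(exponential_ray eQ (lexx _)) -pos_a //.
have [_ X1 _ _ _] := eX; have [_ W1 _ _ _] := eW.
have mD : measurable (`]0%R, +oo[%classic `*` `]0%R, +oo[%classic : set (R * R)%type).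
  exact: measurableX.
apply: (eq_full mD) => //; first by rewrite prodPE // X1 W1 mule1.
move=> [x y] [/=]; rewrite !in_itv /= !andbT => x0 y0.
have m0 : (0 < Num.min x y)%R by rewrite lt_min x0 y0.
rewrite /quadrant /= m0 (lt_trans a0 m0).
by split.
Qed.

Lemma measure_ray_unique (m : {measure set (R * R)%type -> \bar R}) (f : R * R -> R)
    (c : \bar R) (nu : probability R R) (C : set (R * R)%type) :
  measurable_fun setT f -> measurable C -> m setT < +oo -> 0 <= c -> c \is a fin_num ->
  (forall x : R, m (f @^-1` `]x, +oo[%classic `&` C) = c * nu `]x, +oo[%classic) ->
  forall A, measurable A -> m (f @^-1` A `&` C) = c * nu A.
Proof.
move=> mf mC moo c0 cf E A mA.
have [n1 n1E] := pushforward_measure (mrestr m mC) mf.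
pose n2 : {measure set R -> \bar R} := mscale (NngNum (fine_ge0 c0)) nu.
have n2E B : n2 B = c * nu B by rewrite -[X in _ = X * _]fineK.
have -> : m (f @^-1` A `&` C) = n1 A by rewrite n1E.
rewrite -n2E; apply: ray_unique => //.
  by rewrite n1E; apply: le_lt_trans moo; apply: le_measure; rewrite ?inE //; apply: measurableI => //; exact: preimage_measurable.
by move=> x; rewrite n1E n2E -E.
Qed.

Lemma exponential_memoryless (A B : set R) : measurable A -> measurable B ->
  prodP nuX nuW [set t | A (Num.min t.1 t.2) /\ B (t.1 - t.2)%R] = nuQ A * G B.
Proof.
move=> mA mB.
have Poo : prodP nuX nuW setT < +oo by apply: (le_lt_trans (probability_le1 _ _)); rewrite ?ltry.
have fin (m : probability R R) C : measurable C -> m C \is a fin_num.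
  by move=> mC; exact: fin_num_measure.
pose K : set (R * R)%type := (fun t => Num.min t.1 t.2) @^-1` A `&` (fun t => t.1 - t.2)%R @^-1` B.
rewrite muleC; transitivity (prodP nuX nuW K) => //; rewrite /K.
apply: (@measure_ray_unique _ _ _ nuQ ((fun t : R * R => t.1 - t.2)%R @^-1` B)) => //.
- exact: preimage_measurable.
- exact: fin.
move=> a; rewrite setIC muleC.
apply: (@measure_ray_unique _ _ _ G ((fun t : R * R => Num.min t.1 t.2) @^-1` `]a, +oo[%classic)) => //.
- exact: preimage_measurable.
- exact: fin.
move=> b; rewrite -quadrantE; congr (prodP _ _ _).
by apply/seteqP; split => t; rewrite /quadrant /= !in_itv /= !andbT => -[].
Qed.

End Memoryless.

(* A crude bound on the second moment, from [expR (l * x / 2) >= (l * x) ^ 2 / 16]. *)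
Lemma exponential_moments l m : is_exponential l m ->
  \int[m]_x (pos x)%:E = (l^-1)%:E /\
  \int[m]_x ((pos x) ^+ 2)%:E <= (32 * (l^-1) ^+ 2)%:E.
Proof.

move=> el; have [l0 m1 Tc To mI] := el.
have mpos : measurable_fun setT (@pos R) by apply: measurable_pos; exact: measurable_id.
split.
- pose X : {RV m >-> R} := mfun_Sub (mem_set mpos).
  have XE : (X : R -> R) = @pos R by [].
  have X0 x : (0 <= X x)%R by rewrite XE pos_ge0.
  have := ge0_expectation_ccdf X0; rewrite expectation_def XE => ->.
  have -> : \int[leb]_(r in `[0%R, +oo[) ccdf X r =
      \int[leb]_r ((l^-1)%:E * (exponential_pdf l r)%:E).
    rewrite [LHS]integral_mkcond; apply: eq_integral => r _.
    rewrite patchE; case: ifPn => [|/negP]; rewrite inE /= in_itv /= andbT => r0.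
      rewrite exponential_pdfE // -EFinM mulrA mulVf ?gt_eqF // mul1r -To //.
      rewrite /ccdf /distribution /pushforward; congr (m _).
      apply/seteqP; split => x; rewrite /preimage /= !in_itv /= !andbT.
        by have [[? [-> _]]|[? [-> _]]] := posP x; lra.
      by have [[? [-> _]]|[? [-> _]]] := posP x; lra.
    by rewrite lt0_exponential_pdf ?mule0 // ltNge; exact/negP.
  rewrite ge0_integralZl_EFin ?integral_exponential_pdf ?mule1 //.
  - by move=> x _; rewrite lee_fin exponential_pdf_ge0 // ltW.
  - by apply/measurable_EFinP; exact: measurable_exponential_pdf.
  - by rewrite invr_ge0 ltW.
- have m2 : measurable_fun setT (fun x => ((pos x) ^+ 2)%:E : \bar R).
    by apply/measurable_EFinP; exact: measurable_funX.
  have l20 : (0 < l / 2)%R by rewrite divr_gt0.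
  have me k : measurable_fun setT (fun x => (exponential_pdf k x)%:E : \bar R).
    by apply/measurable_EFinP; exact: measurable_exponential_pdf.
  rewrite mI //; last by move=> x; rewrite lee_fin sqr_ge0.
  apply: (@le_trans _ _ (\int[leb]_r ((32 * (l^-1) ^+ 2)%:E * (exponential_pdf (l / 2) r)%:E))).
    apply: ge0_le_integral => //.
    + by move=> x _; apply: mule_ge0; rewrite lee_fin ?sqr_ge0 // exponential_pdf_ge0 // ltW.
    + exact: emeasurable_funM m2 (me l).
    + by apply: emeasurable_funM => //; exact: me.
    move=> x _; rewrite -!EFinM lee_fin.
    case: (ltP x 0%R) => x0; first by rewrite !lt0_exponential_pdf // !mulr0.
    rewrite !exponential_pdfE //.
    have [[_ [-> _]]|[? _]] := posP x; last by lra.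
    have -> : (expR (- l * x) = expR (- (l / 2) * x) * expR (- (l / 2) * x))%R.
      by rewrite -expRD; congr expR; field.
    have e0 := expR_gt0 (- (l / 2) * x)%R; set e := expR _ in e0 *.
    have lx0 : (0 <= l * x)%R by rewrite mulr_ge0 // ltW.
    have ee : (e * (l * x / 4) ^+ 2 <= 1)%R.
      have h : (l * x / 4 <= expR (l * x / 4))%R.
        by apply: le_trans (expR_ge1Dx _); lra.
      have E1 : (1 = e * (expR (l * x / 4)) ^+ 2)%R.
        by rewrite /e expr2 -!expRD -[LHS]expR0; congr expR; field.
      rewrite [leRHS]E1.
      rewrite ler_pM2l // ler_sqr ?nnegrE ?expR_ge0 //; lra.
    have -> : (x ^+ 2 * (l * (e * e)) = (16 / l * e) * (e * (l * x / 4) ^+ 2))%R.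
      by field; rewrite gt_eqF.
    have -> : (32 * l^-1 ^+ 2 * (l / 2 * e) = (16 / l * e) * 1)%R.
      by field; rewrite gt_eqF.
    by rewrite ler_wpM2l // mulr_ge0 ?divr_ge0 // ltW.
  rewrite ge0_integralZl_EFin ?integral_exponential_pdf ?mule1 //.
  - by move=> x _; rewrite lee_fin exponential_pdf_ge0 // ltW.
  - exact: me.
  - by rewrite mulr_ge0 // sqr_ge0.
Qed.

End Exponential.

Section Geometric.
Context (R : realType).
Local Open Scope ereal_scope.

Let mpos : measurable_fun setT (@pos R).
Proof. by apply: measurable_pos; exact: measurable_id. Qed.

Let mshift : measurable_fun setT (fun x : R => (x + 1)%R).
Proof. exact: measurable_funD. Qed.

(* The integer part of an exponential variable of rate [- ln u]. *)
Lemma geometric_exists (u : R) : (0 < u < 1)%R -> exists m mS : probability R R,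
  [/\ (forall A, measurable A -> mS A = m ((fun x => x + 1)%R @^-1` A)),
      mixture u m mS (dirac (0%R : R)), m `[0%R, +oo[%classic = 1,
      \int[m]_x (pos x)%:E = (u / (1 - u))%:E &
      exists v : R, \int[m]_x ((pos x) ^+ 2)%:E <= v%:E].
Proof.
move=> /andP[u0 u1].
have k0 : (0 < - ln u)%R by rewrite oppr_gt0 ln_lt0 // u0 u1.
have [e [eE _]] := exponential_exists k0.
have [_ e1 Tc To _] := eE.
pose fl (x : R) : R := (Num.truncn x)%:R%R.
have ray (x : R) : (0 <= x)%R ->
    fl @^-1` `]x, +oo[%classic = `[((Num.truncn x).+1%:R)%R, +oo[%classic.
  move=> x0; apply/seteqP; split => y /=; rewrite !in_itv /= !andbT /fl => h.
    by rewrite -truncn_gt_nat -(ltr_nat R) (le_lt_trans _ h) // truncn_le.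
  by apply: (lt_le_trans (truncnS_gt x)); rewrite ler_nat truncn_gt_nat.
have mfl : measurable_fun setT fl.
  by apply: nondecreasing_measurable => // x y xy; rewrite ler_nat le_truncn.
have [n1 n1E] := pushforward_measure e mfl.
have n1T : n1 setT = 1 by rewrite n1E preimage_setT; exact: probability_setT e.
have [m mE'] := measure_probability n1T.
have mE A : m A = e (fl @^-1` A) by rewrite mE' n1E.
have [n2 n2E] := pushforward_measure m mshift.
have n2T : n2 setT = 1 by rewrite n2E preimage_setT; exact: probability_setT m.
have [mS mSE'] := measure_probability n2T.
have mSE A : mS A = m ((fun x => x + 1)%R @^-1` A) by rewrite mSE' n2E.
have fl0 y : (0 <= fl y)%R by rewrite ler0n.
have m0 : m `[0%R, +oo[%classic = 1.
  rewrite mE (_ : _ @^-1` _ = setT); first exact: probability_setT e.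
  by apply/seteqP; split => // y _ /=; rewrite in_itv /= fl0.
have tail (x : R) : (0 <= x)%R -> m `]x, +oo[%classic = (u ^+ (Num.truncn x).+1)%:E.
  move=> x0; rewrite mE ray // Tc // opprK mulrC expRM_natl lnK //.
have tail_neg (x : R) : (x < 0)%R -> m `]x, +oo[%classic = 1.
  move=> x0; apply/eqP; rewrite eq_le probability_le1 //= -m0.
  by apply: le_measure; rewrite ?inE // => y /=; rewrite !in_itv /= !andbT; exact: lt_le_trans.
have mixm : mixture u m mS (dirac (0%R : R)).
  have u01 : (0 <= u <= 1)%R by rewrite !ltW.
  have [m3 m3E] := mixture_exists mS (dirac (0%R : R)) u01.
  suff E A : measurable A -> m A = m3 A by move=> A mA; rewrite E // m3E.
  have moo : m setT < +oo by rewrite [X in X < _](_ : _ = 1) ?ltry //; exact: probability_setT m.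
  apply: ray_unique moo _ _ => x.
  rewrite m3E // mSE.
  have -> : (fun x0 : R => x0 + 1)%R @^-1` `]x, +oo[%classic = `](x - 1)%R, +oo[%classic.
    by apply/seteqP; split => y /=; rewrite !in_itv /= !andbT ltrBlDr.
  case: (ltP x 0%R) => x0.
    rewrite !tail_neg //; last by lra.
    rewrite [X in _ + _ * X](_ : _ = \d_(0%R : R) `]x, +oo[%classic) // diracE mem_set ?mule1; last by rewrite /= in_itv /= x0.
    by rewrite -EFinD subrKC.
  rewrite [X in _ + _ * X](_ : _ = \d_(0%R : R) `]x, +oo[%classic) // diracE memNset ?mule0 ?adde0; last first.
    by rewrite /= in_itv /= andbT; apply/negP; rewrite -leNgt.
  rewrite tail //; case: (ltP x 1%R) => x1.
    rewrite tail_neg; last by lra.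
    by rewrite mule1 (_ : Num.truncn x = 0%N) ?expr1 //; apply/eqP; rewrite truncn_eq // x0.
  rewrite tail; last by lra.
  rewrite -EFinM -exprS; congr (u ^+ _)%:E; congr S.
  have x10 : (0 <= x - 1)%R by rewrite subr_ge0.
  have xn : (x - 1)%R \is Num.nneg by rewrite nnegrE.
  have nat1 : (1%R : R) \is a Num.nat by rewrite rpred1.
  by have := truncnD nat1 xn; rewrite truncn1 add1n subrKC => ->.
have flb (x : R) : (pos (fl x) <= pos x)%R.
  have [[_ [-> _]]|[n0 _]] := posP (fl x); last by move: n0; rewrite ltNge ler0n.
  have [[x0 [-> _]]|[x0 [-> _]]] := posP x; first by rewrite truncn_le.
  by rewrite /fl (_ : Num.truncn x = 0%N) //; apply/truncn0Pn; rewrite -ltNge; lra.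
have intE (f : R -> \bar R) : measurable_fun setT f -> (forall x, 0 <= f x) ->
    \int[m]_x f x = \int[e]_x f (fl x).
  move=> mf f0; rewrite -(ge0_integral_pushforward mfl e measurableT mf (fun x _ => f0 x)).
  by apply: eq_measure_integral => A mA _; rewrite mE.
have [eE1 eE2] := exponential_moments eE.
have mm : measurable_fun setT (fun x => (pos x)%:E : \bar R) by exact/measurable_EFinP.
have mm2 : measurable_fun setT (fun x => ((pos x) ^+ 2)%:E : \bar R).
  by apply/measurable_EFinP; exact: measurable_funX.
have sq : exists v : R, \int[m]_x ((pos x) ^+ 2)%:E <= v%:E.
  eexists; apply: le_trans eE2; rewrite intE //; last by move=> x; rewrite lee_fin sqr_ge0.
  apply: ge0_le_integral => //.
  - by move=> x _; rewrite lee_fin sqr_ge0.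
  - exact: (measurableT_comp mm2 mfl).
  - by move=> x _; rewrite lee_fin ler_sqr ?nnegrE ?pos_ge0.
exists m, mS; split => //.
have [v1 v1E] : exists v : R, \int[m]_x (pos x)%:E = v%:E.
  exists (fine (\int[m]_x (pos x)%:E)); rewrite fineK // ge0_fin_numE; last first.
    by apply: integral_ge0 => x _; rewrite lee_fin pos_ge0.
  rewrite intE //; last by move=> x; rewrite lee_fin pos_ge0.
  apply: (@le_lt_trans _ _ (\int[e]_x (pos x)%:E)); last by rewrite eE1 ltry.
  apply: ge0_le_integral => //.
  - by move=> x _; rewrite lee_fin pos_ge0.
  - exact: (measurableT_comp mm mfl).
  - by move=> x _; rewrite lee_fin.
have u01 : (0 <= u <= 1)%R by rewrite !ltW.
have p0 x : 0 <= (pos x)%:E :> \bar R by rewrite lee_fin pos_ge0.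
have := integral_mixture u01 mixm mm p0.
rewrite integral_diracP // (_ : pos 0 = 0)%R; last by rewrite /pos maxxx.
rewrite mule0 adde0 v1E.
have -> : \int[mS]_x (pos x)%:E = (1 + v1)%:E.
  have := ge0_integral_pushforward mshift m measurableT mm (fun x _ => p0 x).
  rewrite preimage_setT => h; transitivity (\int[m]_x (pos (x + 1))%:E).
    by rewrite -[RHS]h; apply: eq_measure_integral => A mA _; rewrite mSE.
  transitivity (\int[m]_x (1 + (pos x)%:E)).
    apply: (eq_integral_full _ m0) => //.
    - exact: (measurableT_comp mm mshift).
    - exact: emeasurable_funD.
    - by move=> x; exact: adde_ge0.
    move=> x /=; rewrite in_itv /= andbT => x0; rewrite -EFinD; congr EFin.
    by have [[_ [-> _]]|[? _]] := posP x; have [[_ [-> _]]|[? _]] := posP (x + 1)%R; lra.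
  rewrite ge0_integralD // v1E integral_cst // EFinD; congr (_ + _).
  by rewrite mul1e; exact: probability_setT m.
rewrite -EFinM => -[h]; congr EFin; have u10 : (1 - u != 0)%R by rewrite subr_eq0 gt_eqF.
by apply: (mulIf u10); rewrite divfK //; lra.
Qed.
End Geometric.

Section Models.
Context (R : realType).
Local Open Scope ereal_scope.
Implicit Types (W : probability R R) (nu : R -> probability R R).

Let mpos : measurable_fun setT (@pos R).
Proof. by apply: measurable_pos; exact: measurable_id. Qed.

Let mm : measurable_fun setT (fun x : R => (pos x)%:E).
Proof. exact/measurable_EFinP. Qed.

Let mm2 : measurable_fun setT (fun x : R => ((pos x) ^+ 2)%:E).
Proof. by apply/measurable_EFinP; exact: measurable_funX. Qed.

Let p0 (x : R) : 0 <= (pos x)%:E. Proof. by rewrite lee_fin pos_ge0. Qed.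
Let p20 (x : R) : 0 <= ((pos x) ^+ 2)%:E. Proof. by rewrite lee_fin sqr_ge0. Qed.

Let dirac_in (x : R) (A : set R) : A x -> (dirac x : probability R R) A = 1.
Proof. by move=> Ax; rewrite [LHS](_ : _ = \d_x A) // diracE mem_set. Qed.

Definition moments (P : probability R R) (m : R) :=
  \int[P]_y (pos y)%:E = m%:E /\ exists v : R, \int[P]_y ((pos y) ^+ 2)%:E <= v%:E.

(* [Q s] is the law of the bottom edges with parameter [s], of mean [mq s]. The law [G]
   preserving a move between the parameters [s'] and [s] serves as the law of the left
   edges when [s = 1], with mean [ma s'], and as the law of the store otherwise. *)
Definition move_model W (mq ma : R -> R) := exists Q : R -> probability R R,
  [/\ Q 1%R = W,
      forall s, (0 < s <= 1)%R -> Q s `[0%R, +oo[%classic = 1 /\ moments (Q s) (mq s) &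
      forall s' s, (0 < s')%R -> (s' < s <= 1)%R -> exists G : probability R R,
        [/\ move_preserving (Q s') G (Q s), G `]0%R, +oo[%classic = (s' / s)%:E,
            exists v : R, \int[G]_y ((pos y) ^+ 2)%:E <= v%:E &
            s = 1%R -> \int[G]_y (pos y)%:E = (ma s')%:E]].

Definition memoryless_pair (u : R) (nuW nuQ : probability R R) (m : R) :=
  exists nuX nuN G : probability R R,
  [/\ mixture u G nuX nuN, nuX `]0%R, +oo[%classic = 1, nuN `]-oo, 0%R]%classic = 1,
      moments nuX m &
      forall A B : set R, measurable A -> measurable B ->
        prodP nuX nuW [set t | A (Num.min t.1 t.2) /\ B (t.1 - t.2)%R] = nuQ A * G B].

Lemma moments_mixture (p m : R) P a b : (0 <= p <= 1)%R -> mixture p P a b ->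
  b `]-oo, 0%R]%classic = 1 -> moments a m -> moments P (p * m)%R.
Proof.
move=> p01 mix b0 [am [v av]]; have p_ge0 : (0 <= p)%R by case/andP: p01.
have zero (f : R -> \bar R) : measurable_fun setT f -> (forall x, 0 <= f x) ->
    (forall x, (x <= 0)%R -> f x = 0) -> \int[b]_x f x = 0.
  move=> mf f0 fz; have <- : \int[b]_x (cst 0 x : \bar R) = 0 by rewrite integral0.
  by apply: (eq_integral_full _ b0) => // x /=; rewrite in_itv /= => /fz.
have pz (x : R) : (x <= 0)%R -> pos x = 0%R.
  by move=> x0; have [[? [-> _]]|[? [-> _]]] := posP x; lra.
split.
  rewrite (integral_mixture p01 mix) // (zero (fun y => (pos y)%:E)) //; last by move=> x /pz ->.
  by rewrite mule0 adde0 am EFinM.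
exists (p * v)%R; rewrite (integral_mixture p01 mix) // (zero (fun y => ((pos y) ^+ 2)%:E)) //.
  by rewrite mule0 adde0 EFinM lee_pmul // integral_ge0.
by move=> x /pz ->; rewrite expr0n.
Qed.

Lemma thinned_model (p : R) nu W (mu ma : R -> R) : (0 < p <= 1)%R ->
  mixture p W (nu 1%R) (dirac (0%R : R)) ->
  (forall s, (0 < s <= 1)%R -> nu s `]0%R, +oo[%classic = 1 /\ moments (nu s) (mu s)) ->
  (forall s' s, (0 < s')%R -> (s' < s <= 1)%R ->
    exists m, memoryless_pair (s' / s) (nu s) (nu s') m /\
      (s = 1%R -> s' * m = ma s')%R) ->
  move_model W (fun s => p * s / (1 - p + p * s) * mu s)%R ma.
Proof.
move=> /andP[p_gt0 p1] mixW nuE pairE.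
pose t (s : R) := (p * s / (1 - p + p * s))%R.
have den (s : R) : (0 < s)%R -> (0 < 1 - p + p * s)%R.
  by move=> s0; rewrite ltr_wpDl ?subr_ge0 // mulr_gt0.
have t01 s : (0 < s)%R -> (0 <= t s <= 1)%R.
  move=> s0; apply/andP; split.
    by rewrite /t divr_ge0 ?mulr_ge0 // ltW // den.
  by rewrite /t ler_pdivrMr ?den // mul1r lerDr subr_ge0.
have d0 : dirac (0%R : R) `]-oo, 0%R]%classic = 1 :> \bar R.
  by rewrite diracE mem_set //= in_itv /= lexx.
have /choice [Q QE] : forall s : R, exists Qs : probability R R, (s = 1%R -> Qs = W) /\
    ((0 < s)%R -> mixture (t s) Qs (nu s) (dirac (0%R : R))).
  move=> s; have [->|s1] := eqVneq s 1%R.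
    by exists W; split=> // _; rewrite /t mulr1 subrK divr1.
  case: (ltP 0%R s) => s0.
    have [Qs QsE] := mixture_exists (nu s) (dirac (0%R : R)) (t01 s s0).
    by exists Qs; split=> [/eqP|]; [rewrite (negPf s1)|].
  by exists W; split=> // /eqP; rewrite (negPf s1).
exists Q; split => [|s /andP[s0 s1]|s' s s'0 /andP[ss s1]].
- by apply: (QE _).1.
- have mix := (QE s).2 s0; have [npos nmom] := nuE s (introT andP (conj s0 s1)).
  split; last exact: (moments_mixture (t01 s s0) mix d0 nmom).
  rewrite mix //.
  rewrite [X in _ * X + _](_ : _ = 1); last first.
    apply/eqP; rewrite eq_le probability_le1 //= -npos.
    by apply: le_measure; rewrite ?inE // => x /=; rewrite !in_itv /= !andbT => /ltW.
  rewrite [X in _ + _ * X](_ : _ = \d_(0%R : R) `[0%R, +oo[%classic) // diracE mem_set.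
    by rewrite !mule1 -EFinD subrKC.
  by rewrite /= in_itv /= lexx.
have s0 : (0 < s)%R by exact: lt_trans ss.
have [m [[nuX [nuN [G [mixG X0 N0 Xm K]]]] mE]] := pairE s' s s'0 (introT andP (conj ss s1)).
have u01 : (0 <= s' / s <= 1)%R.
  by rewrite divr_ge0 ?ler_pdivrMr ?mul1r ?ltW.
have [Gm Gv] := moments_mixture u01 mixG N0 Xm.
exists G; split => //.
- apply: (mixture_move_preserving (t01 s s0) (t01 s' s'0) u01 ((QE s).2 s0) ((QE s').2 s'0) mixG) => //.
  + by have [] := nuE s (introT andP (conj s0 s1)).
  + by have [] := nuE s' (introT andP (conj s'0 (ltW (lt_le_trans ss s1)))).
  + rewrite /t; have h1 := den s s0; have h2 := den s' s'0; field.
    by rewrite !gt_eqF.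
- rewrite mixG // X0 mule1 (_ : nuN `]0%R, +oo[%classic = 0) ?mule0 ?adde0 //.
  by rewrite -setCitvl probability_setC // N0 subee.
- by move=> s_1; rewrite Gm -mE // s_1 divr1.
Qed.

Lemma exponential_model (p a : R) W : (0 < p <= 1)%R -> (0 < a)%R ->
  (forall A, measurable A -> W A = law_BerExp p a A) ->
  move_model W (fun s => p * s / (1 - p + p * s) * (s / a))%R
               (fun s => s ^+ 2 / (a * (1 - s)))%R.
Proof.
move=> p01 a0 WE.
have /choice [nu nuE] : forall s : R, exists m : probability R R, (0 < s)%R ->
    is_exponential (a / s) m /\ forall A : set R, m A = exponential_prob (a / s) A.
  move=> s; case: (ltP 0%R s) => s0; last by exists W.
  by have [m mE] := exponential_exists (divr_gt0 a0 s0); exists m.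
apply: (thinned_model (nu := nu) (p := p) (mu := fun s => s / a)%R) => //.
- move=> A mA; rewrite WE // /law_BerExp addeC; congr (_ * _ + _).
  have [_ ->] := nuE 1%R ltr01; rewrite divr1 /exponential_prob.
  rewrite integral_mkcond [RHS]integral_mkcond; apply: eq_integral => x _.
  rewrite !patchE in_setI; case: (x \in A) => //=.
  case: (ltP x 0%R) => x0.
    by rewrite lt0_exponential_pdf // memNset //= => /le_lt_trans/(_ x0); rewrite ltxx.
  by rewrite exponential_pdfE // mem_set // mulNr.
- move=> s /andP[s0 _]; have [e _] := nuE s s0; have [e0 e1 _ _ _] := e; split=> //.
  have [h1 h2] := exponential_moments e; split; last by eexists; exact: h2.
  by rewrite h1 invf_div.
move=> s' s s'0 /andP[ss s1]; have s0 : (0 < s)%R by exact: lt_trans ss.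
have l0 : (0 < a / s' - a / s)%R.
  by rewrite subr_gt0 ltr_pM2l // ltf_pV2.
have [nuX [eX _]] := exponential_exists l0.
have [eW _] := nuE s s0.
have eQ : is_exponential (a / s' - a / s + a / s) (nu s').
  by rewrite subrK; have [] := nuE s' s'0.
have uE : ((a / s) / (a / s' - a / s + a / s) = s' / s)%R.
  by rewrite subrK; field; rewrite !gt_eqF.
have u01 : (0 <= (a / s) / (a / s' - a / s + a / s) <= 1)%R.
  by rewrite uE divr_ge0 ?ler_pdivrMr ?mul1r ?ltW.
have [n1 n1E] := pushforward_measure (nu s) (@oppr_measurable R setT).
have n1T : n1 setT = 1 by rewrite n1E preimage_setT; exact: probability_setT (nu s).
have [nuN nuNE'] := measure_probability n1T.
have nuNE A : measurable A -> nuN A = nu s (-%R @^-1` A) by rewrite nuNE' n1E.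
have [G mixG] := mixture_exists nuX nuN u01.
have [h1 h2] := exponential_moments eX.
exists (a / s' - a / s)^-1%R; split; last first.
  move=> s_1; have s'1 : (0 < 1 - s')%R by rewrite subr_gt0 -s_1.
  have -> : (a / s' - a / s = a * (1 - s') / s')%R by rewrite s_1; field; rewrite gt_eqF.
  by field; rewrite !gt_eqF.
exists nuX, nuN, G; split => //.
- by rewrite -uE.
- by case: eX.
- rewrite nuNE //; have [_ W1 _ _ _] := eW.
  have mN : measurable (-%R @^-1` `]-oo, 0%R]%classic : set R).
    by apply: preimage_measurable => //; exact: oppr_measurable.
  apply/eqP; rewrite eq_le probability_le1 //= -W1; apply: le_measure; rewrite ?inE //.
  by move=> x /=; rewrite !in_itv /= !andbT; lra.
- by split => //; eexists; exact: h2.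
move=> A B mA mB; exact: (exponential_memoryless eX eW eQ nuNE mixG).
Qed.

Lemma bernoulli_model (p : R) W : (0 < p < 1)%R ->
  (forall A, measurable A -> W A = law_Ber p A) ->
  move_model W (fun s => p * s / (1 - p + p * s) * 1)%R (fun s => s / (1 - s))%R.
Proof.
move=> /andP[p_gt0 p1] WE; have p01 : (0 < p <= 1)%R by rewrite p_gt0 ltW.
apply: (thinned_model (nu := fun _ => dirac (1%R : R)) (p := p) (mu := fun _ => 1%R)) => //.
- by move=> A mA; rewrite WE // /law_Ber addeC.
- move=> s _; split; first by apply: dirac_in; rewrite /= in_itv /= ltr01.
  have p1E : pos 1 = 1%R :> R by have [[_ [-> _]]|[? _]] := posP (1%R : R); lra.
  split; first by rewrite integral_diracP // p1E.
  by exists 1%R; rewrite integral_diracP // p1E expr1n.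
move=> s' s s'0 /andP[ss s1]; have s0 : (0 < s)%R by exact: lt_trans ss.
have u01 : (0 < s' / s < 1)%R by rewrite divr_gt0 //= ltr_pdivrMr // mul1r.
have [G [nuX [XE mixG G0 Gm [v Gv]]]] := geometric_exists u01.
exists (1 / (1 - s' / s))%R; split; last first.
  by move=> ->; rewrite divr1 mulrA mulr1.
exists nuX, (dirac (0%R : R)), G.
have mshift : measurable_fun setT (fun x : R => (x + 1)%R) by exact: measurable_funD.
have X1 : nuX `[1%R, +oo[%classic = 1.
  rewrite XE // -G0; congr (G _).
  by apply/seteqP; split=> x /=; rewrite !in_itv /= !andbT lerDr.
split => //.
- apply/eqP; rewrite eq_le probability_le1 //= -X1.
  apply: le_measure; rewrite ?inE // => x /=; rewrite !in_itv /= !andbT.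
  exact: lt_le_trans.
- by apply: dirac_in; rewrite /= in_itv /= lexx.
- have u01w : (0 <= s' / s <= 1)%R by rewrite !ltW; case/andP: u01.
  have up : (0 < s' / s)%R by case/andP: u01.
  have zero (f : R -> \bar R) : measurable_fun setT f -> f 0%R = 0 ->
      \int[dirac (0%R : R)]_x f x = 0 by move=> mf <-; rewrite integral_diracP.
  have pos0 : pos 0 = 0%R :> R by rewrite /pos maxxx.
  split.
    move: Gm; rewrite (integral_mixture u01w mixG) // zero //; last by rewrite pos0.
    rewrite mule0 adde0; set I := integral _ _ _.
    move=> IE; have -> : I = ((s' / s)^-1)%:E * ((s' / s)%:E * I).
      by rewrite muleA -EFinM mulVf ?mul1e // gt_eqF.
    by rewrite IE -EFinM mulrA mulVf // gt_eqF.
  exists (v / (s' / s))%R; move: Gv; rewrite (integral_mixture u01w mixG) // zero //; last first.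
    by rewrite pos0 expr0n.
  rewrite mule0 adde0 => Iv; rewrite EFinM lee_pdivlMr //.
  by rewrite muleC.
move=> A B mA mB; set E := [set t | _].
have mE : measurable E.
  apply: measurableI; (apply: preimage_measurable => //).
    by apply: measurable_minr; [exact: measurable_fst|exact: measurable_snd].
  by apply: measurable_funB; [exact: measurable_fst|exact: measurable_snd].
have mB1 : measurable ((fun x : R => x - 1)%R @^-1` B).
  by apply: preimage_measurable => //; exact: measurable_funB.
rewrite prodP_ysection // integral_diracP; last exact: measurable_fun_ysection.
transitivity (nuX (if (1%R : R) \in A then (fun x : R => x - 1)%R @^-1` B else set0)).
  apply: (eq_full _ X1) => //; first exact: measurable_ysection.
    by case: ifP.
  move=> x /=; rewrite in_itv /= andbT => x1.
  rewrite /ysection /= inE /E /= min_r //.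
  by case: ifPn => [|/negP]; rewrite inE => A1; split=> // -[].
rewrite [X in _ = X * _](_ : _ = (\1_A (1%R : R))%:E); last by exact: diracE.
rewrite indicE; case: ifP => _; last by rewrite measure0 mul0e.
by rewrite mul1e XE //; congr (G _); apply/seteqP; split=> x /=; rewrite addrK.
Qed.

End Models.

(** * Critical directions *)

Section Curves.
Context (R : realType).
Implicit Types (mq ma c : R -> R).

Definition unit_point (u : R) := 0 < u < 1.

(* [c u] is the limit of [(mq u - mq v) / (ma u - ma v)] as [v] tends to [u], the slope
   of the direction in which the height with parameter [u] is a Busemann function. *)
Definition critical_curve mq ma c :=
  [/\ (forall u, unit_point u -> 0 <= ma u /\ 0 < c u),
      (forall v u, unit_point v -> unit_point u -> v < u -> ma v < ma u /\ c u < c v),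
      (forall u y, unit_point u -> c u < y -> exists v, [/\ unit_point v, v < u &
        mq u - mq v < y * (ma u - ma v)]) &
      (forall u y, unit_point u -> y < c u -> exists v, [/\ unit_point v, u < v &
        y * (ma v - ma u) < mq v - mq u])].

Lemma critical_curve_slope mq ma (k : R -> R -> R) :
  (forall u, unit_point u -> 0 <= ma u /\ 0 < k u u) ->
  (forall v u, unit_point v -> unit_point u -> v < u -> ma v < ma u /\ k u u < k v v) ->
  (forall u v, unit_point u -> unit_point v -> mq v - mq u = k u v * (ma v - ma u)) ->
  (forall u, unit_point u -> k u x @[x --> u] --> k u u) ->
  critical_curve mq ma (fun u => k u u).
Proof.
move=> h1 h2 slope kc; split=> // u y u01 cy; have /andP[u0 u1] := u01.
- have /nbhs_ballP[e /= e0 be] : \forall x \near u, k u x < y.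
    exact: (cvgr_lt (k u u) (kc u u01)).
  pose v := Num.max (u / 2) (u - e / 2).
  have [v1 v2 vu] : [/\ u / 2 <= v, u - e / 2 <= v & v < u].
    by rewrite /v; case: (leP (u / 2) (u - e / 2)) => ?; split; lra.
  have v01 : unit_point v by apply/andP; split; lra.
  exists v; split=> //; have [mvu _] := h2 v u v01 u01 vu.
  have kv : k u v < y by apply: be; rewrite /ball /= ger0_norm; lra.
  have -> : mq u - mq v = k u v * (ma u - ma v) by have := slope u v u01 v01; lra.
  by rewrite ltr_pM2r // subr_gt0.
- have /nbhs_ballP[e /= e0 be] : \forall x \near u, y < k u x.
    exact: (cvgr_gt (k u u) (kc u u01)).
  pose v := Num.min ((1 + u) / 2) (u + e / 2).
  have [v1 v2 vu] : [/\ v <= (1 + u) / 2, v <= u + e / 2 & u < v].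
    by rewrite /v; case: (leP ((1 + u) / 2) (u + e / 2)) => ?; split; lra.
  have v01 : unit_point v by apply/andP; split; lra.
  exists v; split=> //; have [mvu _] := h2 u v u01 v01 vu.
  have kv : y < k u v by apply: be; rewrite /ball /= ler0_norm; lra.
  by rewrite slope // ltr_pM2r // subr_gt0.
Qed.

Lemma bernoulli_curve (p : R) : 0 < p < 1 ->
  exists c, critical_curve (fun s => p * s / (1 - p + p * s) * 1) (fun s => s / (1 - s)) c.
Proof.
move=> /andP[p0 p1].
pose k u v : R := p * (1 - p) * ((1 - u) / (1 - p + p * u)) * ((1 - v) / (1 - p + p * v)).
have den u : unit_point u -> 0 < 1 - p + p * u /\ 0 < 1 - u.
  by move=> /andP[u0 u1]; have := mulr_gt0 p0 u0; split; lra.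
exists (fun u => k u u); apply: (critical_curve_slope (k := k)).
- move=> u u01; have [D0 d0] := den u u01; have /andP[u0 u1] := u01; split.
    by rewrite divr_ge0 // ltW.
  by rewrite /k; do !apply: mulr_gt0; rewrite ?divr_gt0 ?subr_gt0 ?invr_gt0.
- move=> v u v01 u01 vu; have [Du du] := den u u01; have [Dv dv] := den v v01.
  have /andP[v0 v1] := v01; have /andP[u0 u1] := u01.
  split; first by rewrite ltr_pdivrMr // mulrAC ltr_pdivlMr //; nra.
  have h : (1 - u) / (1 - p + p * u) < (1 - v) / (1 - p + p * v).
    by rewrite ltr_pdivrMr // mulrAC ltr_pdivlMr //; nra.
  have h0 : 0 < (1 - u) / (1 - p + p * u) by rewrite divr_gt0.
  rewrite /k -[X in X < _]mulrA -[X in _ < X]mulrA ltr_pM2l ?mulr_gt0 ?subr_gt0 //.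
  by rewrite -!expr2 ltr_sqr ?nnegrE ?ltW // (lt_trans h0).
- move=> u v u01 v01; have [Du du] := den u u01; have [Dv dv] := den v v01.
  by rewrite /k; field; rewrite !gt_eqF.
- move=> u u01; have [Du du] := den u u01; apply: cvgM; first exact: cvg_cst.
  apply: cvgM; first by apply: cvgB; [exact: cvg_cst|exact: cvg_id].
  apply: cvgV; first by rewrite gt_eqF.
  by apply: cvgD; [exact: cvg_cst|apply: cvgM; [exact: cvg_cst|exact: cvg_id]].
Qed.

Lemma exponential_curve (p a : R) : 0 < p <= 1 -> 0 < a ->
  exists c, critical_curve (fun s => p * s / (1 - p + p * s) * (s / a))
               (fun s => s ^+ 2 / (a * (1 - s))) c.
Proof.
move=> /andP[p0 p1] a0.
pose k u v : R := p * ((1 - p) * (u + v) + p * (u * v)) * ((1 - u) / (1 - p + p * u)) *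
  ((1 - v) / ((1 - p + p * v) * (u + v - u * v))).
have den u : unit_point u -> 0 < 1 - p + p * u /\ 0 < 1 - u.
  by move=> /andP[u0 u1]; have := mulr_gt0 p0 u0; split; lra.
have den2 u v : unit_point u -> unit_point v -> 0 < u + v - u * v.
  by move=> /andP[u0 u1] /andP[v0 v1]; nra.
exists (fun u => k u u); apply: (critical_curve_slope (k := k)).
- move=> u u01; have [D0 d0] := den u u01; have /andP[u0 u1] := u01; split.
    by rewrite divr_ge0 ?sqr_ge0 // ltW // mulr_gt0.
  rewrite /k; apply: mulr_gt0; last by rewrite divr_gt0 // mulr_gt0 // den2.
  apply: mulr_gt0; last by rewrite divr_gt0.
  apply: mulr_gt0 => //; rewrite ltr_wpDl ?mulr_ge0 ?mulr_gt0 ?subr_ge0 //.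
  by rewrite addr_ge0 // ltW.
- move=> v u v01 u01 vu; have [Du du] := den u u01; have [Dv dv] := den v v01.
  have /andP[v0 v1] := v01; have /andP[u0 u1] := u01.
  split.
    rewrite ltr_pdivrMr ?mulr_gt0 // mulrAC ltr_pdivlMr ?mulr_gt0 //.
    rewrite mulrCA [X in _ < X]mulrCA ltr_pM2l //.
    have : 0 < (u - v) * (u * (1 - v) + v) by rewrite mulr_gt0 ?subr_gt0 // addr_gt0 ?mulr_gt0.
    by lra.
  have kE x : unit_point x -> k x x = p * ((1 + (1 - p) / (1 - p + p * x)) *
      ((1 - x) ^+ 2 / (2 - x)) / (1 - p + p * x)).
    move=> x01; have [Dx dx] := den x x01; have := den2 x x x01 x01.
    have /andP[x0 x1] := x01; rewrite /k => D2; field; rewrite !gt_eqF //; lra.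
  rewrite !kE // ltr_pM2l //.
  have A : 1 + (1 - p) / (1 - p + p * u) <= 1 + (1 - p) / (1 - p + p * v).
    by rewrite lerD2l ler_wpM2l ?subr_ge0 // lef_pV2 // lerD2l ler_pM2l // ltW.
  have A0 : 0 < 1 + (1 - p) / (1 - p + p * u).
    by rewrite ltr_pwDl // divr_ge0 ?subr_ge0 // ltW.
  have B : (1 - u) ^+ 2 / (2 - u) < (1 - v) ^+ 2 / (2 - v).
    have h1 : 0 < 2 - u by lra.
    have h2 : 0 < 2 - v by lra.
    rewrite ltr_pdivrMr // mulrAC ltr_pdivlMr //.
    have : 0 < (u - v) * ((1 - u) + (1 - v) + (1 - u) * (1 - v)).
      by apply: mulr_gt0; [rewrite subr_gt0|have := mulr_gt0 du dv; lra].
    by lra.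
  have B0 : 0 < (1 - u) ^+ 2 / (2 - u) by rewrite divr_gt0 ?exprn_gt0 //; lra.
  have C : (1 - p + p * u)^-1 <= (1 - p + p * v)^-1.
    by rewrite lef_pV2 // lerD2l ler_pM2l // ltW.
  have C0 : 0 < (1 - p + p * u)^-1 by rewrite invr_gt0.
  apply: (@lt_le_trans _ _ ((1 + (1 - p) / (1 - p + p * u)) * ((1 - v) ^+ 2 / (2 - v)) * (1 - p + p * u)^-1)).
    by rewrite ltr_pM2r // ltr_pM2l.
  have B1 := lt_trans B0 B; apply: ler_pM => //; last by rewrite ler_pM2r.
    by apply: mulr_ge0; exact: ltW.
  exact: ltW.
- move=> u v u01 v01; have [Du du] := den u u01; have [Dv dv] := den v v01.
  by have ? := den2 u v u01 v01; rewrite /k; field; rewrite !gt_eqF.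
- move=> u u01; have [Du du] := den u u01; have D2 := den2 u u u01 u01.
  apply: cvgM; last first.
    apply: cvgM; first by apply: cvgB; [exact: cvg_cst|exact: cvg_id].
    apply: cvgV; first by rewrite gt_eqF // mulr_gt0.
    apply: cvgM.
      by apply: cvgD; [exact: cvg_cst|apply: cvgM; [exact: cvg_cst|exact: cvg_id]].
    apply: cvgB; first by apply: cvgD; [exact: cvg_cst|exact: cvg_id].
    by apply: cvgM; [exact: cvg_cst|exact: cvg_id].
  apply: cvgM; last exact: cvg_cst.
  apply: cvgM; first exact: cvg_cst.
  apply: cvgD; (apply: cvgM; first exact: cvg_cst).
    by apply: cvgD; [exact: cvg_cst|exact: cvg_id].
  by apply: cvgM; [exact: cvg_cst|exact: cvg_id].
Qed.
End Curves.

(** * The two-layer environment *)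

Inductive slot := Store | Bottom of bool & nat | Side of bool & nat | Bulk of nat & nat.

Definition slot_code (i : slot) : nat * (bool * (nat * nat)) :=
  match i with
  | Store => (0, (true, (0, 0)))
  | Bottom l k => (1, (l, (k, 0)))
  | Side l j => (2, (l, (j, 0)))
  | Bulk k j => (3, (true, (k, j)))
  end%N.

Definition slot_decode (c : nat * (bool * (nat * nat))) : slot :=
  match c with
  | (0, _) => Store
  | (1, (l, (k, _))) => Bottom l k
  | (2, (l, (j, _))) => Side l j
  | (_, (_, (k, j))) => Bulk k j
  end%N.

Lemma slot_codeK : cancel slot_code slot_decode.
Proof. by case. Qed.

HB.instance Definition _ := Equality.copy slot (can_type slot_codeK).

Section Independence.
Context (R : realType) (I : eqType) d (T : measurableType d) (P : probability T R).
Variables (D : pred I) (ell : I -> probability R R) (X : I -> T -> R).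

Lemma independent_on_sub (D' : pred I) : {subset D' <= D} ->
  independent_on P D ell X -> independent_on P D' ell X.
Proof.
by move=> DD [mX E]; split=> // s A us sD mA; apply: E => // i /sD; exact: DD.
Qed.

Lemma independent_on_pos (B : pred I) :
  (forall i, D i -> B i -> ell i `[0, +oo[%classic = 1%E) ->
  independent_on P D ell X ->
  independent_on P D ell (fun i t => if B i then pos (X i t) else X i t).
Proof.
move=> Bpos [mX E]; have mpos i := measurable_pos (mX i).
have mp : measurable_fun setT (@pos R) by apply: measurable_pos; exact: measurable_id.
split=> [i|s A us sD mA]; first by case: (B i).
pose A' i := if B i then @pos R @^-1` A i else A i.
have mA' i : measurable (A' i) by rewrite /A'; case: (B i) => //; exact: preimage_measurable.
transitivity (P (box X s A')).
  by congr (P _); apply: eq_box => i _; rewrite /A'; case: (B i).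
rewrite E //; apply: eq_big_seq => i /sD Di; rewrite /A'.
case: ifP => // Bi; apply: (eq_full _ (Bpos i Di Bi)) => //.
  exact: preimage_measurable.
move=> x /=; rewrite in_itv /= andbT => x0.
by have [[_ [-> _]]|[? _]] := posP x; [|lra].
Qed.

End Independence.

Section Environment.
Context (R : realType) (N H : nat) d (T : measurableType d) (P : probability T R).
Variables (Qv Qu Gv Gu Z W : probability R R).
Variable X : slot -> T -> R.

Definition slot_law (i : slot) : probability R R :=
  match i with
  | Store => Z
  | Bottom l _ => if l then Qu else Qv
  | Side l _ => if l then Gu else Gv
  | Bulk _ _ => W
  end.

Definition in_window (i : slot) : bool :=
  match i with
  | Store => true
  | Bottom _ k => (k < N)%N
  | Side _ j => (j < H)%N
  | Bulk k j => (k < N)%N && (j < H)%N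
  end.

Hypothesis iX : independent_on P in_window slot_law X.
Hypothesis moveV : move_preserving Qv Gv W.
Hypothesis moveU : move_preserving Qu Gu W.
Hypothesis moveZ : move_preserving Qv Z Qu.

Implicit Types (t : T) (l : bool).

Let b0 t k := X (Bottom false k) t.
Let q0 t k := X (Bottom true k) t.
Let h0 t j := X (Side false j) t.
Let g0 t j := X (Side true j) t.
Let rr t k j := X (Bulk k j) t.

Definition middle_weight t := weight (b0 t) (h0 t) (rr t).
Definition env_weight t := weight (q0 t) (g0 t) (middle_weight t).
Definition env_horiz l t := if l then horiz (q0 t) (g0 t) (middle_weight t)
  else horiz (b0 t) (h0 t) (rr t).
Definition env_vert l t := if l then vert (q0 t) (g0 t) (middle_weight t)
  else vert (b0 t) (h0 t) (rr t).

(* the boundary and the weights once the first [M] columns, and the first [n] rows of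
   column [M], have been moved *)
Definition state M n (i : slot) t : R :=
  match i with
  | Store => X Store t
  | Bottom l k => env_horiz l t k (if (k < M)%N then H else if k == M then n else 0)
  | Side l j => env_vert l t (if (j < H)%N then (if (j < n)%N then M.+1 else M) else 0) j
  | Bulk k j => if (k < M)%N && (j < H)%N || (k == M) && (j < n)%N then env_weight t k j
                else rr t k j
  end.

Lemma state_step M n i t : (n < H)%N -> state M n.+1 i t =
  update (Bottom true M) (Side true n) (Bulk M n)
    (fun i => update (Bottom false M) (Side false n) (Bulk M n) ((state M n)^~ t) i) i.
Proof.
move=> nH; have eB l l' k k' : (Bottom l k == Bottom l' k') = (l == l') && (k == k').
  by apply/eqP/andP => [[-> ->]|[/eqP -> /eqP ->]].
have eS l l' k k' : (Side l k == Side l' k') = (l == l') && (k == k').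
  by apply/eqP/andP => [[-> ->]|[/eqP -> /eqP ->]].
have eU k j k' j' : (Bulk k j == Bulk k' j') = (k == k') && (j == j').
  by apply/eqP/andP => [[-> ->]|[/eqP -> /eqP ->]].
have BS l k l' j : (Bottom l k == Side l' j) = false by [].
have BU l k k' j : (Bottom l k == Bulk k' j) = false by [].
have SB l k l' j : (Side l j == Bottom l' k) = false by [].
have SU l k l' j : (Side l j == Bulk l' k) = false by [].
have UB k j l' k' : (Bulk k j == Bottom l' k') = false by [].
have US k j l' k' : (Bulk k j == Side l' k') = false by [].
have CB l k : (Store == Bottom l k) = false by [].
have CS l k : (Store == Side l k) = false by [].
have CU l k : (Store == Bulk l k) = false by [].
pose E := (eB, eS, eU, (BS, BU, SB), (SU, UB, US), (CB, CS, CU)).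
rewrite /update ?E ?eqxx ?E /= !ltnn !eqxx !nH !andbF /=.
case: i => [|l k|l j|k j]; rewrite ?E //=.
- case: (eqVneq k M) => [->|kM]; last by rewrite !andbF.
  by rewrite ltnn !andbT; case: l.
- case: (eqVneq j n) => [->|jn].
    by rewrite nH ltnSn !andbT ltnn; case: l.
  have -> : (j < n.+1)%N = (j < n)%N by rewrite ltnS leq_eqVlt (negPf jn).
  by rewrite !andbF.
- case: (eqVneq k M) => [->|kM] //=.
  case: (eqVneq j n) => [->|jn]; first by rewrite ltnn ltnSn.
  by have -> : (j < n.+1)%N = (j < n)%N by rewrite ltnS leq_eqVlt (negPf jn).
Qed.

Lemma state_independent M n : (M <= N)%N -> (n <= H)%N -> (M < N)%N || (n == 0) ->
  independent_on P in_window slot_law (state M n).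
Proof.
have eq_ind (Y Y' : slot -> T -> R) : Y = Y' -> independent_on P in_window slot_law Y' ->
    independent_on P in_window slot_law Y by move=> ->.
have step M' n' : (M' < N)%N -> (n' < H)%N -> independent_on P in_window slot_law (state M' n') ->
    independent_on P in_window slot_law (state M' n'.+1).
  move=> MN nH iY.
  have sub l : {subset [:: Bottom l M'; Side l n'; Bulk M' n'] <= in_window}.
    by move=> i; rewrite !inE => /or3P[] /eqP -> /=; rewrite /in_mem /= ?MN ?nH.
  have i1 := independent_on_update iY (isT : uniq [:: Bottom false M'; Side false n'; Bulk M' n'])
    (sub false) moveV.
  have i2 := independent_on_update i1 (isT : uniq [:: Bottom true M'; Side true n'; Bulk M' n'])
    (sub true) moveU.
  by apply: eq_ind i2; apply/funext => i; apply/funext => t; exact: state_step.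
have full M' : independent_on P in_window slot_law (state M' 0) -> (M' < N)%N ->
    forall n', (n' <= H)%N -> independent_on P in_window slot_law (state M' n').
  by move=> i0 MN; elim=> [|n' IHn] nH //; apply: step => //; apply: IHn; exact: ltnW.
have zero M' : (M' <= N)%N -> independent_on P in_window slot_law (state M' 0).
  elim: M' => [|M' IH] MN.
    apply: eq_ind iX; apply/funext => i; apply/funext => t.
    by case: i => [|[] k|[] j|k j] //=; rewrite ?if_same ?ltn0 ?andbF //; case: ifP => //; case: ifP.
  apply: eq_ind (full M' (IH (ltnW MN)) MN H (leqnn H)).
  apply/funext => i; apply/funext => t; case: i => [|l k|l j|k j] //=.
  - case: (ltngtP k M') => [kM|kM|->]; rewrite ?ltnS ?(ltnW kM) ?leqnn //.
    by rewrite leqNgt kM /= if_same.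
  - by case: (ltnP j H).
  - rewrite ltnS leq_eqVlt andbF orbF; case: (eqVneq k M') => [->|kM] /=.
      by rewrite ltnn.
    by rewrite orbF.
by move=> MN nH /orP[MN'|/eqP ->]; [apply: full => //|]; apply: zero.
Qed.

(* the store at column [N - i] of row [0], in place of the initial store *)
Fixpoint content_state i (s : slot) t : R :=
  if i is i'.+1 then
    update (Bottom false (N - i)) Store (Bottom true (N - i)) ((content_state i')^~ t) s
  else X s t.

Definition env_content t i := signed_store (q0 t) (b0 t) N (X Store t) i.

Lemma content_stateE i t : (i <= N)%N ->
  [/\ content_state i Store t = env_content t i,
      (forall l k, (k < N - i)%N -> content_state i (Bottom l k) t = X (Bottom l k) t) &
      (forall l j, content_state i (Side l j) t = X (Side l j) t)].
Proof.
elim: i => [//|i IH] iN; have [IC IB IS] := IH (ltnW iN).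
have BC l k : (Bottom l k == Store) = false by [].
have CB l k : (Store == Bottom l k) = false by [].
have lt : (N - i.+1 < N - i)%N by lia.
split=> [|l k kN|l j].
- by rewrite /= /update CB eqxx IC !IB.
- rewrite /= /update BC.
  have ne l' : (Bottom l k == Bottom l' (N - i.+1)) = false.
    by apply/negbTE/eqP => -[_ kE]; move: kN; rewrite kE ltnn.
  by rewrite !ne IB // (leq_trans kN) // ltnW.
- by rewrite /= /update IS.
Qed.

Lemma content_state_independent i : (i <= N)%N ->
  independent_on P in_window slot_law (content_state i).
Proof.
elim: i => [//|i IH] iN.
apply: (independent_on_update (IH (ltnW iN))) => //.
by move=> s; rewrite !inE => /or3P[] /eqP -> //=; rewrite /in_mem /= ltn_subrL /=; lia.
Qed.

End Environment.

Lemma environment_exists (R : realType) N H (Qv Qu Gv Gu Z W : probability R R) :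
  Qv `[0, +oo[%classic = 1%E -> Qu `[0, +oo[%classic = 1%E -> W `[0, +oo[%classic = 1%E ->
  exists d (T : measurableType d) (P : probability T R) (X : slot -> T -> R),
    independent_on P (in_window N H) (slot_law Qv Qu Gv Gu Z W) X /\
    (forall l k t, 0 <= X (Bottom l k) t) /\ (forall k j t, 0 <= X (Bulk k j) t).
Proof.
move=> Qv0 Qu0 W0.
pose ds := Store :: map (Bottom false) (iota 0 N) ++ map (Bottom true) (iota 0 N) ++
  map (Side false) (iota 0 H) ++ map (Side true) (iota 0 H) ++
  [seq Bulk k j | k <- iota 0 N, j <- iota 0 H].
have dsE : {subset in_window N H <= mem ds}.
  move=> i wi0; have wi : in_window N H i by exact: wi0.
  change (is_true (i \in ds)); rewrite inE !mem_cat; case: i wi {wi0} => [|l k|l j|k j] wi.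
  - by [].
  - have kN : k \in iota 0 N by rewrite mem_iota.
    by case: l {wi}; rewrite (map_f _ kN) ?orbT.
  - have jH : j \in iota 0 H by rewrite mem_iota.
    by case: l {wi}; rewrite (map_f _ jH) ?orbT.
  - case/andP: wi => kN jH; do 5 (apply/orP; right).
    by apply/allpairsP; exists (k, j); split=> //=; rewrite mem_iota.
have [d [T [P [Y iY]]]] := independent_on_exists ds (slot_law Qv Qu Gv Gu Z W).
pose B (i : slot) := match i with Bottom _ _ | Bulk _ _ => true | _ => false end.
exists d, T, P, (fun i t => if B i then pos (Y i t) else Y i t); split.
  apply: independent_on_pos; last exact: independent_on_sub iY.
  by case=> [|[] k|l j|k j] //=.
by split=> *; exact: pos_ge0.
Qed.

Section Deterministic.
Variable R : realType.

Lemma partial_sum_grid (x : nat -> R) (d I : nat) (a e : R) : (forall j, 0 <= x j) ->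
  (0 < d)%N -> 0 <= a ->
  (forall k, (k <= I)%N -> `|\sum_(i < k * d) x i - (k * d)%:R * a| <= e) ->
  forall j, (j <= I * d)%N -> `|\sum_(i < j) x i - j%:R * a| <= e + d%:R * a.
Proof.
move=> x0 d0 a0 H j jI; pose S n := \sum_(i < n) x i.
have mono n m : (n <= m)%N -> S n <= S m.
  by move=> /subnK <-; elim: (m - n)%N => [|k IH] //; rewrite addSn /S big_ord_recr /= -/(S _) ler_wpDr.
have da0 : 0 <= d%:R * a by rewrite mulr_ge0.
have kd := leq_trunc_div j d; have kd' := ltn_ceil j d0; set k := (j %/ d)%N in kd kd'.
have kI : (k <= I)%N by rewrite -(leq_pmul2r d0) (leq_trans kd).
have := H k kI; rewrite -/(S _) -/(S _) !ler_norml => /andP[h1 h2].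
have jk : (k * d)%:R * a <= j%:R * a by rewrite ler_wpM2r // ler_nat.
have jk' : j%:R * a <= (k * d)%:R * a + d%:R * a.
  by rewrite -mulrDl ler_wpM2r // -natrD ler_nat addnC -mulSn ltnW.
have m1 := mono _ _ kd.
move: (kI); rewrite leq_eqVlt => /orP[/eqP kE|kI'].
  have jE : j = (k * d)%N by apply/eqP; rewrite eqn_leq kd andbT kE.
  by rewrite jE; apply/andP; split; lra.
have := H k.+1 kI'; rewrite -/(S _) !ler_norml => /andP[h3 h4].
have m2 := mono _ _ (ltnW kd').
have e' : (k.+1 * d)%:R * a = (k * d)%:R * a + d%:R * a by rewrite mulSn natrD mulrDl addrC.
by apply/andP; split; lra.
Qed.

(* Up to fluctuations, the store decreases at speed [b - a] whenever it does not
   consist of the last arrival alone. *)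
Lemma store_growth (z h g : nat -> R) (n : nat) (a b e : R) :
  (forall j, z j.+1 = h j + pos (z j - g j)) -> (forall j, 0 <= h j) ->
  0 <= z 0 -> 0 <= a <= b ->
  (forall j, (j <= n)%N -> `|\sum_(i < j) h i - j%:R * a| <= e) ->
  (forall j, (j <= n)%N -> `|\sum_(i < j) g i - j%:R * b| <= e) ->
  z n <= z 0 + 6 * e + a.
Proof.
move=> zE h0 z0 /andP[a0 ab] hH hG.
pose S n := \sum_(i < n) h i; pose U n := \sum_(i < n) g i.
have e0 : 0 <= e by apply: le_trans (hH 0%N isT).
suff main j : (j <= n)%N -> z j <= z 0 + 4 * e + a + (S j - j%:R * a) - (U j - j%:R * b).
  have := main n (leqnn n); have := hH n (leqnn n); have := hG n (leqnn n).
  rewrite -/(S n) -/(U n) !ler_norml => /andP[? ?] /andP[? ?] ?; lra.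
elim: j => [_|j IH jn].
  by rewrite /S /U !big_ord0; lra.
have := IH (ltnW jn); have := hH _ jn; have := hH _ (ltnW jn); have := hG _ jn.
have := zE j; have := h0 j.
rewrite /S /U !big_ord_recr /= -/(S j) -/(U j) -natr1 !mulrDl !mul1r !ler_norml.
move=> hj zj /andP[? ?] /andP[? ?] /andP[? ?] ?.
by rewrite zj; have [[? [-> _]]|[? [-> _]]] := posP (z j - g j); lra.
Qed.

Section Good.
Variables (N : nat) (q0 g0 b0 h0 : nat -> R) (rr : nat -> nat -> R) (zN : R).
Hypothesis q0_ge0 : forall k, 0 <= q0 k.
Hypothesis b0_ge0 : forall k, 0 <= b0 k.
Hypothesis rr_ge0 : forall k j, 0 <= rr k j.
Variables (M d I : nat) (mqv mqu mav mau e : R).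
Hypothesis MN : (M <= N)%N.
Hypothesis d0 : (0 < d)%N.
Hypothesis mavu : 0 <= mav <= mau.
Let r := weight b0 h0 rr.
Hypothesis sum_b : `|\sum_(i < M) b0 i - M%:R * mqv| <= e.
Hypothesis sum_q : `|\sum_(i < M) q0 i - M%:R * mqu| <= e.
Hypothesis sum_h : forall k, (k <= I)%N ->
  `|\sum_(j < k * d) pos (vert b0 h0 rr M j) - (k * d)%:R * mav| <= e.
Hypothesis sum_g : forall k, (k <= I)%N ->
  `|\sum_(j < k * d) pos (vert q0 g0 r M j) - (k * d)%:R * mau| <= e.
Hypothesis store_M : pos (signed_store q0 b0 N zN (N - M)) <= e.
Hypothesis start : forall j, (j < 2)%N -> pos (g0 j) <= e.

Definition slack : R := 10 * e + 6 * (d%:R * mau) + mau.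

Let Fu := height q0 g0 r.
Let Fv := height2 q0 g0 b0 h0 rr N zN.

Let e0 : 0 <= e. Proof. by apply: le_trans sum_b. Qed.
Let mau0 : 0 <= mau. Proof. by case/andP: mavu => /le_trans; apply. Qed.
Let dmau0 : 0 <= d%:R * mau. Proof. by rewrite mulr_ge0. Qed.

Lemma slack_ge : 2 * e <= slack.
Proof. by have := e0; have := mau0; have := dmau0; rewrite /slack; lra. Qed.

Let r_ge0 k j : (k < N)%N -> 0 <= r k j.
Proof. by move=> kN; apply: (weight_ge0 h0 (N := N)). Qed.

Let sum_horiz (U V : nat -> nat -> R) n :
  potential U V 0 0 - potential U V M n = \sum_(i < M) U i 0%N - \sum_(j < n) V M j.
Proof. by rewrite /potential !big_ord0; ring. Qed.

Lemma mean_u k : (k <= I)%N -> Fu 0 0 - Fu M (k * d) <= M%:R * mqu - (k * d)%:R * mau + slack.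
Proof.
move=> kI; have := sum_g kI; have := sum_q; have := slack_ge.
rewrite /Fu /height sum_horiz !ler_norml => ? /andP[? ?] /andP[? ?].
by rewrite [X in X - _](_ : _ = \sum_(i < M) q0 i) //; lra.
Qed.

Lemma start_u j : (j <= 2)%N -> Fu 0 j <= Fu 0 0 + slack.
Proof.
have := slack_ge; have := e0.
have h i : Fu 0 i.+1 - Fu 0 i = pos (g0 i) by exact: heightV.
have s0 := start (j := 0) isT; have s1 := start (j := 1) isT.
have := h 0%N; have := h 1%N.
by case: j => [|[|[|//]]] *; lra.
Qed.

Lemma start_v j : (j <= 2)%N -> Fv 0 j <= Fv 0 0 + slack.
Proof.
have := slack_ge; have := e0.
have h i : Fv 0 i.+1 - Fv 0 i <= pos (g0 i).
  by rewrite /Fv (height2V q0 g0 b0 h0 rr N zN 0 i) ge_min lexx.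
have s0 := start (j := 0) isT; have s1 := start (j := 1) isT.
have := h 0%N; have := h 1%N.
by case: j => [|[|[|//]]] *; lra.
Qed.

Lemma mean_v k : (k <= I)%N -> Fv 0 0 - Fv M (k * d) <= M%:R * mqv - (k * d)%:R * mav + slack.
Proof.
move=> kI; have kdI : (k * d <= I * d)%N by rewrite leq_pmul2r.
have [mav0 mav_u] := andP mavu.
have Eb : e + d%:R * mav <= e + d%:R * mau by rewrite lerD2l ler_wpM2l.
have st : store q0 g0 b0 h0 rr N zN M (k * d) <= e + 6 * (e + d%:R * mau) + mav.
  apply: (@le_trans _ _ (store q0 g0 b0 h0 rr N zN M 0 + 6 * (e + d%:R * mau) + mav)); last first.
    by rewrite /= !lerD2r.
  apply: (@store_growth _ (fun j => pos (vert b0 h0 rr M j)) (fun j => pos (vert q0 g0 r M j)) _ _ mau) => //.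
  - by move=> j; exact: pos_ge0.
  - exact: store_ge0.
  - move=> j jk; apply: le_trans Eb; have ph i := pos_ge0 (vert b0 h0 rr M i).
    by apply: (partial_sum_grid ph d0 mav0 sum_h); exact: leq_trans kdI.
  - move=> j jk; have pg i := pos_ge0 (vert q0 g0 r M i).
    by apply: (partial_sum_grid pg d0 mau0 sum_g); exact: leq_trans kdI.
have := sum_h kI; have := sum_b.
rewrite !ler_norml => /andP[? ?] /andP[? ?].
have := sum_horiz (horiz b0 h0 rr) (fun k j => pos (vert b0 h0 rr k j)) (k * d)%N.
have := store_ge0 q0 g0 b0 h0 rr N zN 0 0.
rewrite [X in _ = X - _](_ : _ = \sum_(i < M) b0 i) //.
rewrite /Fv /height2 /height /slack; lra.
Qed.

Lemma left_u k j : (k < N)%N -> Fu k.+1 j <= Fu k j.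
Proof.
move=> kN; rewrite -subr_ge0 (@heightU _ q0 g0 r N) //.
by apply: (@horiz_ge0 _ q0 g0 r N).
Qed.

Lemma left_v k j : (k < N)%N -> Fv k.+1 j <= Fv k j.
Proof.
move=> kN; rewrite -subr_ge0 /Fv /height2.
have := @heightU _ b0 h0 rr N (fun k _ => b0_ge0 k) (fun k j _ => rr_ge0 k j) k j kN.
have := @store_left _ q0 g0 b0 h0 rr N zN (fun k _ => q0_ge0 k) (fun k _ => b0_ge0 k) (fun k j _ => rr_ge0 k j) k j kN.
have q' := @horiz_ge0 _ q0 g0 r N (fun k _ => q0_ge0 k) r_ge0 k j kN.
have b' := @horiz_ge0 _ b0 h0 rr N (fun k _ => b0_ge0 k) (fun k j _ => rr_ge0 k j) k j kN.
have s' := store_ge0 q0 g0 b0 h0 rr N zN k.+1 j.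
move: q'; rewrite /r => q'.
set s := store _ _ _ _ _ _ _ k j => sE bE.
by have [[? [pE _]]|[? [pE _]]] := posP (store q0 g0 b0 h0 rr N zN k.+1 j + horiz b0 h0 rr k j -
  horiz q0 g0 (weight b0 h0 rr) k j); rewrite sE pE; lra.
Qed.

Lemma up_u k j : Fu k j <= Fu k j.+1.
Proof. by rewrite -subr_ge0 heightV pos_ge0. Qed.

Lemma up_v k j : Fv k j <= Fv k j.+1.
Proof. by rewrite -subr_ge0 /Fv height2V le_min pos_ge0 store_ge0. Qed.

End Good.
End Deterministic.

Section HoldsBut.
Context (R : realType) d (T : measurableType d) (P : probability T R).
Implicit Types (x y : R) (Q : T -> Prop).

(* [Q] need not be measurable. *)
Definition holds_but x Q :=
  exists B : set T, [/\ measurable B, (P B <= x%:E)%E & forall t, ~ B t -> Q t].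

Lemma holds_but_imply x y Q Q' : x <= y -> (forall t, Q t -> Q' t) ->
  holds_but x Q -> holds_but y Q'.
Proof.
move=> xy QQ [B [mB PB BQ]]; exists B; split=> // [|t /BQ]; last exact: QQ.
by apply: (le_trans PB); rewrite lee_fin.
Qed.

Lemma holds_but_and x y Q Q' : holds_but x Q -> holds_but y Q' ->
  holds_but (x + y) (fun t => Q t /\ Q' t).
Proof.
move=> [B [mB PB BQ]] [B' [mB' PB' BQ']]; exists (B `|` B'); split; first exact: measurableU.
  apply: (le_trans (measureU2 P mB mB')).
  by rewrite EFinD leeD.
by move=> t /not_orP[nB nB']; split; [exact: BQ|exact: BQ'].
Qed.

Lemma holds_but_forall n x (Q : nat -> T -> Prop) : (forall k, (k < n)%N -> holds_but x (Q k)) ->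
  holds_but (n%:R * x) (fun t => forall k, (k < n)%N -> Q k t).
Proof.
elim: n => [|n IH] H.
  by exists set0; rewrite measure0 mul0r; split.
have h := holds_but_and (IH (fun k kn => H k (ltnW kn))) (H n (ltnSn n)).
apply: holds_but_imply h; first by rewrite -natr1 mulrDl mul1r.
move=> t [h1 h2] k; rewrite ltnS leq_eqVlt => /orP[/eqP ->//|]; exact: h1.
Qed.

Lemma holds_but_range (K N : nat) C (Q : nat -> T -> Prop) : (0 < K)%N -> 0 <= C ->
  (forall l, (K <= l)%N -> (l <= N)%N -> holds_but (C / (l ^ 2)%:R) (Q l)) ->
  holds_but (2 * C / K%:R) (fun t => forall l, (K <= l)%N -> (l <= N)%N -> Q l t).
Proof.
move=> K0 C0 H.
have K0' : 0 < K%:R :> R by rewrite ltr0n.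
suff main n : (K + n <= N)%N -> holds_but (2 * C / K%:R - C / (K + n)%:R)
    (fun t => forall l, (K <= l)%N -> (l <= K + n)%N -> Q l t).
  case: (leqP K N) => [KN|NK].
    have := main (N - K)%N; rewrite subnKC // => /(_ (leqnn _)); apply: holds_but_imply => //.
    by rewrite gerBl divr_ge0.
  exists set0; rewrite measure0 lee_fin; split=> //; first by rewrite divr_ge0 // mulr_ge0.
  by move=> t _ l Kl lN; have := leq_trans (leq_trans NK Kl) lN; rewrite ltnn.
elim: n => [|n IH] KN.
  rewrite addn0 in KN *; apply: holds_but_imply (H K (leqnn K) KN).
    rewrite natrX (_ : 2 * C / K%:R - C / K%:R = C / K%:R); last by field; rewrite gt_eqF.
    rewrite ler_wpM2l // lef_pV2 ?posrE ?exprn_gt0 //.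
    by rewrite expr2 ler_peMl ?ler1n // ltW.
  by move=> t h l Kl lK; have -> : l = K by apply/eqP; rewrite eqn_leq lK.
rewrite addnS in KN; have h := holds_but_and (IH (ltnW KN)) (H _ (leq_trans (leq_addr n K) (leqnSn _)) KN).
apply: holds_but_imply h; last first.
  move=> t [h1 h2] l Kl; rewrite addnS leq_eqVlt => /orP[/eqP ->//|]; exact: h1.
rewrite addnS natrX -[(K + n).+1%:R]natr1; have a0 : 0 < (K + n)%:R :> R by rewrite ltr0n addn_gt0 K0.
move: a0; move: ((K + n)%:R : R) => a a0.
rewrite -subr_ge0 [X in 0 <= X](_ : _ = C / (a * (a + 1) ^+ 2)); last first.
  by field; rewrite !gt_eqF // addr_gt0.
by rewrite divr_ge0 // mulr_ge0 ?sqr_ge0 // ltW.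
Qed.

Lemma holds_but_le x (Q : T -> Prop) (C E : set T) : measurable C -> measurable E ->
  holds_but x Q -> (forall t, C t -> Q t -> E t) -> (P C <= P E + x%:E)%E.
Proof.
move=> mC mE [B [mB PB BQ]] H.
apply: (@le_trans _ _ (P (E `|` B))).
  apply: le_measure; rewrite ?inE //; first exact: measurableU.
  by move=> t Ct; have [?|/BQ Qt] := pselect (B t); [right|left; exact: H].
by apply: (le_trans (measureU2 P mE mB)); rewrite leeD.
Qed.

End HoldsBut.

Section Tails.
Context (R : realType) (I : eqType) d (T : measurableType d) (P : probability T R).
Variables (D : pred I) (ell : I -> probability R R) (X : I -> T -> R).
Hypothesis iX : independent_on P D ell X.

Definition moment_bound (m : probability R R) (a s : R) :=
  (\int[m]_x (pos x)%:E = a%:E /\ \int[m]_x ((pos x) ^+ 2)%:E <= s%:E)%E.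

Let mpos : measurable_fun setT (@pos R).
Proof. by apply: measurable_pos; exact: measurable_id. Qed.

Lemma holds_but_sum (a s e : R) (l : seq I) : 0 < e -> uniq l ->
  (forall i, i \in l -> D i /\ moment_bound (ell i) a s) ->
  holds_but P ((size l)%:R * s / e ^+ 2)
    (fun t => `|\sum_(i <- l) pos (X i t) - (size l)%:R * a| <= e).
Proof.
move=> e0 ul H; exists [set t | e <= `|\sum_(i <- l) pos (X i t) - (size l)%:R * a|]; split.
- apply: measurable_le => //; apply: measurableT_comp => //.
  apply: measurable_funB => //; have [mX _] := iX.
  by apply: measurable_sum => i; exact: measurable_pos.
- by apply: (weak_law iX mpos (@pos_ge0 R) e0 ul) => i il; have [? []] := H i il.
by move=> t /negP; rewrite -ltNge => /ltW.
Qed.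

Lemma holds_but_tail (s e : R) (i : I) : 0 < e -> D i ->
  (\int[ell i]_x ((pos x) ^+ 2)%:E <= s%:E)%E ->
  holds_but P (s / e ^+ 2) (fun t => pos (X i t) <= e).
Proof.
move=> e0 Di H; exists [set t | e <= pos (X i t)].
have [mX _] := iX; have mA : measurable [set t | e <= pos (X i t)].
  by apply: measurable_le => //; exact: measurable_pos.
have e20 : 0 < e ^+ 2 by rewrite exprn_gt0.
split=> //; last by move=> t /negP; rewrite -ltNge => /ltW.
rewrite EFinM lee_pdivlMr //; apply: (le_trans _ H).
rewrite -(expectation_on iX Di (f := fun x => ((pos x) ^+ 2)%:E)%E); last 2 first.
- by apply/measurable_EFinP; exact: measurable_funX.
- by move=> x; rewrite lee_fin sqr_ge0.
rewrite muleC -[[set _ | _]]setIT -(integral_indic P measurableT mA).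
rewrite -ge0_integralZl_EFin //; last 2 first.
- by apply/measurable_EFinP; exact: measurable_indic.
- exact: ltW.
apply: ge0_le_integral => //.
- by move=> t _; rewrite -EFinM lee_fin mulr_ge0 // ltW.
- by apply/measurable_EFinP; apply: measurable_funM => //; exact: measurable_indic.
- by apply/measurable_EFinP; apply: measurable_funX; exact: measurable_pos.
move=> t _; rewrite -EFinM lee_fin indicE.
case: (boolP (t \in [set t | e <= pos (X i t)])) => [|_]; last by rewrite mulr0 sqr_ge0.
by rewrite inE /= mulr1 => At; rewrite ler_sqr // nnegrE ltW // (lt_le_trans e0).
Qed.

Lemma independent_on_reindex (J : eqType) (f : J -> I) : injective f ->
  independent_on P (D \o f) (ell \o f) (X \o f).
Proof.
move=> finj; have [mX E] := iX; split=> [j|s A us sD mA]; first exact: mX.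
pose B i : set R := if pselect (exists2 j, f j = i & j \in s) is left h then A (sval (cid2 h)) else setT.
have BE j : j \in s -> B (f j) = A j.
  rewrite /B => js; case: pselect => [h|[]]; last by exists j.
  by case: cid2 => j' /= /finj ->.
have mB i : measurable (B i) by rewrite /B; case: pselect.
have us' : uniq (map f s) by rewrite map_inj_uniq.
transitivity (P (box X (map f s) B)).
  congr (P _); apply/seteqP; split => t h i /=.
    by move=> /mapP[j js ->]; rewrite BE //; exact: h.
  by move=> js; have := h (f i) (map_f _ js); rewrite /= BE.
rewrite E // => [|i /mapP[j js ->]]; last exact: sD js.
by rewrite big_map; apply: eq_big_seq => j js; rewrite /= BE.
Qed.

End Tails.

Section Grids.
Context (R : realType).
Implicit Types (c : nat -> nat -> R).

Lemma passage_local c c' r m n : (r <= n)%N ->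
  (forall k j, (k < m)%N -> (j <= n)%N -> c k j = c' k j) ->
  passage c r m n = passage c' r m n.
Proof.
elim: m n => [|m IHm] n rn E; first by rewrite !passage0.
have row : (r <= n)%N -> passage c r m.+1 r = passage c' r m.+1 r.
  move=> rn'; rewrite !passage_row E // IHm // => k j km jr.
  by apply: E; [exact: ltnW|exact: leq_trans rn'].
elim: n rn E row => [|n IHn] rn E row; move: (rn); rewrite leq_eqVlt => /orP[/eqP rE|rn'] //;
  try by rewrite -rE row // rE.
rewrite !passageSS //; congr (Num.min (_ + _) _).
- by apply: IHm => // k j km; apply: E; exact: ltnW.
- exact: E.
- apply: IHn => // [k j km jn|_]; first by apply: E => //; exact: ltnW.
  by apply: row; exact: ltnW.
Qed.

Definition window (N H : nat) : pred (nat * nat) := fun x => (x.1 < N)%N && (x.2 < H)%N.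

Definition grid d (T : measurableType d) (P : probability T R) W N H
    (Y : nat * nat -> T -> R) := independent_on P (window N H) (fun _ => W) Y.

Definition at_grid U (Y : nat * nat -> U -> R) (t : U) (k j : nat) : R := Y (k, j) t.

Lemma grid_transfer d (T : measurableType d) (P : probability T R)
    d' (T' : measurableType d') (P' : probability T' R) W N H Y Y' (E : set (config R (nat * nat)%type)) :
  grid P W N H Y -> grid P' W N H Y' -> measurable E ->
  P ((fun t => restr (window N H) Y t) @^-1` E) =
  P' ((fun t => restr (window N H) Y' t) @^-1` E).
Proof.
move=> [mY EY] [mY' EY'] mE; apply: transfer => // s A us sD mA.
by rewrite EY // EY'.
Qed.

Lemma restr_passage U (Y : nat * nat -> U -> R) N H t r m n :
  (r <= n)%N -> (m <= N)%N -> (n < H)%N ->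
  passage (fun k j => (restr (window N H) Y t : nat * nat -> R) (k, j)) r m n =
  passage (at_grid Y t) r m n.
Proof.
move=> rn mN nH; apply: passage_local => // k j km jn.
by rewrite /restr /window /= (leq_trans km mN) (leq_ltn_trans jn nH).
Qed.

Lemma measurable_config_passage r m n :
  measurable_fun setT (fun c : config R (nat * nat)%type =>
    passage (fun k j => (c : nat * nat -> R) (k, j)) r m n).
Proof.
by have := measurable_passage r m n (fun k j => @measurable_coord R _ (k, j)).
Qed.

End Grids.

Record layer_laws (R : realType) (W : probability R R) (mq ma : R -> R) (v u s : R)
    (Qv Qu Gv Gu Z : probability R R) : Prop := LayerLaws {
  moveV : move_preserving Qv Gv W;
  moveU : move_preserving Qu Gu W;
  moveZ : move_preserving Qv Z Qu;
  boundQ : forall l : bool, moment_bound (if l then Qu else Qv) (mq (if l then u else v)) s;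
  boundG : forall l : bool, moment_bound (if l then Gu else Gv) (ma (if l then u else v)) s;
  boundZ : (\int[Z]_x ((pos x) ^+ 2)%:E <= s%:E)%E;
  Qv_ge0 : Qv `[0, +oo[%classic = 1%E;
  Qu_ge0 : Qu `[0, +oo[%classic = 1%E;
  W_ge0 : W `[0, +oo[%classic = 1%E;
  Gv_pos : Gv `]0, +oo[%classic = v%:E;
  Gu_pos : Gu `]0, +oo[%classic = u%:E;
  Z_pos : Z `]0, +oo[%classic = (v / u)%:E }.

Lemma layer_laws_exists (R : realType) (W : probability R R) mq ma (v u : R) :
  move_model W mq ma -> 0 < v -> v < u < 1 ->
  exists s Qv Qu Gv Gu Z, layer_laws W mq ma v u s Qv Qu Gv Gu Z.
Proof.
move=> [Q [Q1 QE GE]] v0 /andP[vu u1]; have u0 : 0 < u by exact: lt_trans vu.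
have v1 : v < 1 by exact: lt_trans u1.
have [Qv0 [Qvm [s1 Qvs]]] := QE v (introT andP (conj v0 (ltW v1))).
have [Qu0 [Qum [s2 Qus]]] := QE u (introT andP (conj u0 (ltW u1))).
have [W0 _] := QE 1 (introT andP (conj ltr01 (lexx _))).
have [Gv [mV Gvp [s3 Gvs] Gvm]] := GE v 1 v0 (introT andP (conj v1 (lexx _))).
have [Gu [mU Gup [s4 Gus] Gum]] := GE u 1 u0 (introT andP (conj u1 (lexx _))).
have [Z [mZ Zp [s5 Zs] _]] := GE v u v0 (introT andP (conj vu (ltW u1))).
pose s := Num.max s1 (Num.max s2 (Num.max s3 (Num.max s4 s5))).
have le x y : (x <= y%:E)%E -> y <= s -> (x <= s%:E)%E.
  by move=> xy ys; apply: (le_trans xy); rewrite lee_fin.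
exists s, (Q v), (Q u), Gv, Gu, Z; rewrite Q1 in mV mU W0.
split => //; rewrite ?Gvp ?Gup ?divr1 //.
- by case; split=> //; [apply: le Qus _|apply: le Qvs _]; rewrite /s !le_max lexx ?orbT.
- case; (split; [by rewrite ?Gum ?Gvm|]); [apply: le Gus _|apply: le Gvs _]; by rewrite /s !le_max lexx ?orbT.
- by apply: le Zs _; rewrite /s !le_max lexx ?orbT.
Qed.

Section EnvironmentBounds.
Context (R : realType) (W : probability R R) (mq ma : R -> R) (v u s : R).
Variables (Qv Qu Gv Gu Z : probability R R).
Hypothesis laws : layer_laws W mq ma v u s Qv Qu Gv Gu Z.
Context (N H : nat) d (T : measurableType d) (P : probability T R).
Variable X : slot -> T -> R.
Hypothesis iX : independent_on P (in_window N H) (slot_law Qv Qu Gv Gu Z W) X.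
Hypothesis bottom_ge0 : forall l k t, 0 <= X (Bottom l k) t.

Let param (l : bool) := if l then u else v.

Definition env_grid (x : nat * nat) t := state H X N 0 (Bulk x.1 x.2) t.

Lemma env_grid_independent : grid P W N H env_grid.
Proof.
have iN : independent_on P (in_window N H) (slot_law Qv Qu Gv Gu Z W) (state H X N 0).
  by apply: (state_independent iX (moveV laws) (moveU laws)); rewrite ?eqxx ?orbT.
have inj : injective (fun x : nat * nat => Bulk x.1 x.2) by move=> [a b] [a' b'] [-> ->].
exact: (independent_on_reindex iN inj).
Qed.

Lemma env_gridE k j t : (k < N)%N -> (j < H)%N -> at_grid env_grid t k j = env_weight X t k j.
Proof. by move=> kN jH; rewrite /at_grid /env_grid /= kN jH. Qed.

Lemma holds_but_bottom (l : bool) M e : (M <= N)%N -> 0 < e -> holds_but P (M%:R * s / e ^+ 2)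
  (fun t => `|\sum_(i < M) X (Bottom l i) t - M%:R * mq (param l)| <= e).
Proof.
move=> MN e0.
have inj : injective (Bottom l) by move=> ? ? [].
have := @holds_but_sum _ _ _ _ _ _ _ _ iX (mq (param l)) s e (map (Bottom l) (iota 0 M)) e0.
rewrite map_inj_uniq // iota_uniq size_map size_iota => /(_ isT); move=> h.
apply: holds_but_imply (h _) => // [t|i /mapP[k]]; last first.
  rewrite mem_iota => kM ->; split; first exact: leq_trans MN.
  exact: (boundQ laws l).
rewrite big_map [X in \sum_(i <- X) _](_ : _ = index_iota 0 M); last by rewrite /index_iota subn0.
rewrite big_mkord; congr (`|_ - _| <= _); apply: eq_bigr => i _.
by have [[_ [-> _]]|[h0 _]] := posP (X (Bottom l i) t); last by have := bottom_ge0 l i t; lra.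
Qed.

Lemma holds_but_side (l : bool) M n e : (M <= N)%N -> (n <= H)%N -> 0 < e ->
  holds_but P (n%:R * s / e ^+ 2)
  (fun t => `|\sum_(j < n) pos (env_vert X l t M j) - n%:R * ma (param l)| <= e).
Proof.
move=> MN nH e0.
have iM : independent_on P (in_window N H) (slot_law Qv Qu Gv Gu Z W) (state H X M 0).
  by apply: (state_independent iX (moveV laws) (moveU laws)); rewrite ?eqxx ?orbT.
have inj : injective (Side l) by move=> ? ? [].
have := @holds_but_sum _ _ _ _ _ _ _ _ iM (ma (param l)) s e (map (Side l) (iota 0 n)) e0.
rewrite map_inj_uniq // iota_uniq size_map size_iota => /(_ isT); move=> h.
apply: holds_but_imply (h _) => // [t|i /mapP[k]]; last first.
  rewrite mem_iota => kn ->; split; first exact: leq_trans nH.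
  exact: (boundG laws l).
rewrite big_map [X in \sum_(i <- X) _](_ : _ = index_iota 0 n); last by rewrite /index_iota subn0.
rewrite big_mkord; congr (`|_ - _| <= _); apply: eq_bigr => i _.
by rewrite /= (leq_trans (ltn_ord i) nH).
Qed.

Lemma holds_but_store M e : (M <= N)%N -> 0 < e ->
  holds_but P (s / e ^+ 2) (fun t => pos (env_content N X t (N - M)) <= e).
Proof.
move=> MN e0; have iC := content_state_independent iX (moveZ laws) (leq_subr M N).
have := holds_but_tail iC e0 (isT : in_window N H Store) (boundZ laws).
apply: holds_but_imply => // t; have [-> _ _] // := content_stateE X t (leq_subr M N).
Qed.

Lemma holds_but_start j e : (j < H)%N -> 0 < e ->
  holds_but P (s / e ^+ 2) (fun t => pos (X (Side true j) t) <= e).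
Proof.
move=> jH e0; have [_ b] := boundG laws true.
exact: (holds_but_tail iX e0 (jH : in_window N H (Side true j)) b).
Qed.

End EnvironmentBounds.

Section EnvironmentGood.
Context (R : realType) (W : probability R R) (mq ma : R -> R) (v u s : R).
Variables (Qv Qu Gv Gu Z : probability R R).
Hypothesis laws : layer_laws W mq ma v u s Qv Qu Gv Gu Z.
Hypothesis mavu : 0 <= ma v <= ma u.
Hypothesis s_ge0 : 0 <= s.
Context (N H : nat) d (T : measurableType d) (P : probability T R).
Variable X : slot -> T -> R.
Hypothesis iX : independent_on P (in_window N H) (slot_law Qv Qu Gv Gu Z W) X.
Hypothesis bottom_ge0 : forall l k t, 0 <= X (Bottom l k) t.
Hypothesis bulk_ge0 : forall k j t, 0 <= X (Bulk k j) t.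

Let param (l : bool) := if l then u else v.

Definition env_height (l : bool) t : nat -> nat -> R :=
  let q0 k := X (Bottom true k) t in let g0 j := X (Side true j) t in
  let b0 k := X (Bottom false k) t in let h0 j := X (Side false j) t in
  let rr k j := X (Bulk k j) t in
  if l then height q0 g0 (weight b0 h0 rr) else height2 q0 g0 b0 h0 rr N (X Store t).

Let r_ge0 t k j : 0 <= middle_weight X t k j.
Proof. by apply: (@weight_ge0 _ _ _ _ k.+1) => //. Qed.

Lemma env_weight_ge0 t k j : 0 <= env_weight X t k j.
Proof. by apply: (@weight_ge0 _ _ _ _ k.+1) => // *; exact: r_ge0. Qed.

Lemma env_busemann l t : busemann_like N (env_weight X t) (env_height l t).
Proof.
case: l; last by apply: busemann_height2.
by apply: busemann_height => // *; exact: r_ge0.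
Qed.

Lemma env_height_up l t k j : env_height l t k j <= env_height l t k j.+1.
Proof. by case: l; [exact: up_u|exact: up_v]. Qed.

Lemma env_height_left l t k j : (k < N)%N -> env_height l t k.+1 j <= env_height l t k j.
Proof. by case: l; [apply: left_u|apply: left_v]. Qed.

Definition controlled (M d I : nat) (mq' ma' e : R) (F : nat -> nat -> R) :=
  (forall k, (k <= I)%N -> F 0 0 - F M (k * d)%N <= M%:R * mq' - (k * d)%:R * ma' + e) /\
  (forall r, (r <= 2)%N -> F 0 r <= F 0 0 + e).

Lemma env_controlled M dd I e : (M <= N)%N -> (I * dd <= H)%N -> (1 < H)%N -> (0 < dd)%N -> 0 < e ->
  holds_but P (2 * (M%:R * s / e ^+ 2) + 2 * (I.+1%:R * ((I * dd)%:R * s / e ^+ 2)) + 3 * (s / e ^+ 2))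
    (fun t => forall l, controlled M dd I (mq (param l)) (ma (param l)) (slack dd (ma u) e) (env_height l t)).
Proof.
move=> MN IH H2 d0 e0.
have sums (l : bool) := holds_but_bottom laws iX bottom_ge0 l MN e0.
have e20 : 0 <= s / e ^+ 2 by rewrite divr_ge0 // sqr_ge0.
have sides (l : bool) : holds_but P (I.+1%:R * ((I * dd)%:R * s / e ^+ 2)) (fun t => forall k, (k < I.+1)%N ->
    `|\sum_(j < k * dd) pos (env_vert X l t M j) - (k * dd)%:R * ma (param l)| <= e).
  apply: holds_but_forall => k kI; have kd : (k * dd <= I * dd)%N by rewrite leq_pmul2r.
  apply: holds_but_imply (holds_but_side laws iX l MN (leq_trans kd IH) e0) => //.
  by rewrite -!mulrA ler_wpM2r // ler_nat.
have st := holds_but_store laws iX MN e0.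
have g01 j (jH : (j < H)%N) := holds_but_start laws iX jH e0.
have all := holds_but_and (holds_but_and (sums true) (sums false))
  (holds_but_and (holds_but_and (sides true) (sides false))
     (holds_but_and st (holds_but_and (g01 0%N (ltnW H2)) (g01 1%N H2)))).
apply: holds_but_imply all; first by lra.
move=> t [[sq sb] [[sg sh] [stM [s0 s1]]]] l.
have start j : (j < 2)%N -> pos (X (Side true j) t) <= e by case: j => [|[|]].
case: l; split.
- by move=> k kI; apply: (mean_u mavu sb sq) kI => k' k'I; exact: sg.
- by move=> r r2; exact: (start_u _ _ _ _ mavu sb start r2).
- move=> k kI; apply: (mean_v d0 mavu sb _ _ stM) kI => k' k'I; [exact: sh|exact: sg].
- by move=> r r2; apply: start_v mavu sb start _ r2.
Qed.

(* The exit point bound [F 0 0 <= passage + F M n] turns the control of the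
   heights into a lower bound on passage times. *)
Lemma env_lower M dd I e : (M <= N)%N -> (I * dd < H)%N -> (0 < dd)%N -> 0 < e ->
  holds_but P (M%:R * s / e ^+ 2 + I.+1%:R * ((I * dd)%:R * s / e ^+ 2))
    (fun t => forall k, (k < I.+1)%N ->
       M%:R * mq u - (k * dd)%:R * ma u - 2 * e <= passage (at_grid (env_grid N H X) t) 0 M (k * dd)).
Proof.
move=> MN IH d0 e0.
have e20 : 0 <= s / e ^+ 2 by rewrite divr_ge0 // sqr_ge0.
have sums := holds_but_bottom laws iX bottom_ge0 true MN e0.
have sides : holds_but P (I.+1%:R * ((I * dd)%:R * s / e ^+ 2)) (fun t => forall k, (k < I.+1)%N ->
    `|\sum_(j < k * dd) pos (env_vert X true t M j) - (k * dd)%:R * ma u| <= e).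
  apply: holds_but_forall => k kI; have kd : (k * dd <= I * dd)%N by rewrite leq_pmul2r.
  apply: holds_but_imply (holds_but_side laws iX true MN (leq_trans kd (ltnW IH)) e0) => //.
  by rewrite -!mulrA ler_wpM2r // ler_nat.
apply: holds_but_imply (holds_but_and sums sides) => // t [sq sg] k kI.
have kd : (k * dd <= I * dd)%N by rewrite leq_pmul2r.
have -> : passage (at_grid (env_grid N H X) t) 0 M (k * dd) = passage (env_weight X t) 0 M (k * dd).
  apply: passage_local => // i j iM jk; apply: env_gridE; first exact: leq_trans MN.
  exact: (leq_ltn_trans (leq_trans jk kd)).
have := busemann_passage (env_busemann true t) (env_height_up true t) MN (leq0n (k * dd)).
move: sq (sg k kI); rewrite !ler_norml /env_height /height /potential !big_ord0 /=.
move=> /andP[? ?] /andP[? ?].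
rewrite subrr [X in _ + (X - _)](_ : _ = \sum_(j < k * dd) pos (env_vert X true t M j)) //.
by rewrite [X in _ + (_ - X)](_ : _ = \sum_(i < M) X (Bottom true i) t) //; lra.
Qed.

End EnvironmentGood.

(** * Large scales *)

Section Constants.
Variable R : realType.

(* At width [M = l ^ 2] the heights are sampled at [I.+1] multiples of [dd], with [I]
   independent of [l]: the exceptional probability is then of order [1 / l ^ 2], which
   is summable over the scales. *)
Lemma scale_constants (g a b mq s y : R) : 0 < g -> 0 < a -> a <= b -> 0 <= s -> 0 <= y ->
  exists (de C : R) (D0 I K0 kap : nat), [/\ 0 < de, 0 <= C, (0 < K0)%N &
   forall l, (K0 <= l)%N -> let M := (l ^ 2)%N in let dd := (M %/ D0).+1 in
     let e := M%:R * de in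
     [/\ [/\ (0 < M)%N, 0 < e, (I * dd < kap * M)%N & ((Num.truncn (M%:R * y)).+3 < kap * M)%N],
         dd%:R * b + 3 * slack dd b e <= M%:R * g,
         M%:R * mq - (I * dd)%:R * a + 2 * slack dd b e < 0 &
         3 * (M%:R * s / e ^+ 2) + 3 * (I.+1%:R * ((I * dd)%:R * s / e ^+ 2)) + 3 * (s / e ^+ 2) <=
           C / M%:R]].
Proof.
move=> g0 a0 ab s0 y0; have b0 : 0 < b by exact: lt_le_trans ab.
pose D0 := (Num.truncn (57 * b / g)).+1.
pose I := (Num.truncn (D0%:R * (`|mq| + g) / a)).+1.
pose K0 := (Num.truncn ((66 * b + g) / g)).+1.
pose de := g / 90.
have de0 : 0 < de by rewrite divr_gt0.
exists de, (s / de ^+ 2 * (3 * (1 + I.+1%:R * (2 * I%:R) + 1))), D0, I, K0, (2 * I + Num.truncn y + 7)%N.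
split=> // [|l Kl M dd e].
  by rewrite mulr_ge0 ?divr_ge0 ?sqr_ge0.
have l0 : (0 < l)%N by apply: leq_trans Kl.
have M0 : (0 < M)%N by rewrite expn_gt0 l0.
have lM : (l <= M)%N by rewrite /M -mulnn leq_pmulr.
have M0' : 0 < M%:R :> R by rewrite ltr0n.
have ddM : (dd <= 2 * M)%N by rewrite /dd mul2n -addnn -addn1 leq_add // leq_div.
have D0' : 0 < D0%:R :> R by rewrite ltr0n.
have hD : 57 * b <= D0%:R * g by rewrite -ler_pdivrMr // ltW // truncnS_gt.
have hK : 66 * b + g <= M%:R * g.
  rewrite -ler_pdivrMr //; apply: ltW; apply: (lt_le_trans (truncnS_gt _)).
  by rewrite ler_nat (leq_trans Kl).
have hI : D0%:R * (`|mq| + g) < I%:R * a by rewrite -ltr_pdivrMr // truncnS_gt.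
have hD' : D0%:R * g <= 57 * b + g.
  rewrite /D0 -natr1 mulrDl mul1r lerD2r -ler_pdivlMr // truncn_le.
  by rewrite divr_ge0 ?mulr_ge0 // ltW.
have dd1 : D0%:R * dd%:R <= M%:R + D0%:R :> R.
  rewrite -natrM -natrD ler_nat /dd mulnS addnC leq_add2r mulnC.
  exact: leq_trunc_div.
have dd2 : M%:R <= D0%:R * dd%:R :> R.
  by rewrite -natrM ler_nat mulnC ltnW // ltn_ceil.
have slackE : dd%:R * b + 3 * slack dd b e = 19 * (dd%:R * b) + 30 * e + 3 * b.
  by rewrite /slack; ring.
have dd0 : 0 < dd%:R :> R by rewrite ltr0n.
have dg : 57 * (dd%:R * b) <= M%:R * g + D0%:R * g.
  apply: (@le_trans _ _ (D0%:R * dd%:R * g)); last by rewrite -mulrDl ler_pM2r.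
  by have := ler_wpM2r (ltW dd0) hD; lra.
have eE : 30 * e = M%:R * g / 3 by rewrite /e /de; field.
have e0 : 0 < e by rewrite mulr_gt0.
have ub : dd%:R * b + 3 * slack dd b e <= M%:R * g by rewrite slackE; lra.
split=> //.
- split => //.
  + apply: (@leq_ltn_trans (2 * I * M)%N); first by rewrite [(2 * I)%N]mulnC -mulnA leq_mul2l ddM orbT.
    by rewrite ltn_pmul2r // -addnA -[X in (X < _)%N]addn0 ltn_add2l addnS.
  + have h : (Num.truncn (M%:R * y) < M * (Num.truncn y).+1)%N.
      rewrite truncn_lt_nat ?mulr_ge0 // natrM ltr_pM2l // truncnS_gt.
      done.
    by move: h M0; clear; nia.
- have db0 : 0 <= dd%:R * b by rewrite mulr_ge0 // ltW.
  have sl0 : 0 <= slack dd b e by rewrite /slack; lra.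
  have h1 : 2 * slack dd b e <= M%:R * g by lra.
  have h2 : M%:R * (`|mq| + g) < (I * dd)%:R * a.
    apply: (@le_lt_trans _ _ (D0%:R * dd%:R * (`|mq| + g))).
      by rewrite ler_wpM2r // addr_ge0 // ltW.
    by rewrite natrM mulrAC [X in _ < X]mulrAC ltr_pM2r.
  have h3 : M%:R * mq <= M%:R * `|mq| by rewrite ler_pM2l // ler_norm.
  by move: h2; rewrite mulrDr; lra.
- have E : M%:R * s / e ^+ 2 = s / de ^+ 2 / M%:R.
    by rewrite /e; field; rewrite !gt_eqF.
  have -> : s / de ^+ 2 * (3 * (1 + I.+1%:R * (2 * I%:R) + 1)) / M%:R =
      3 * (M%:R * s / e ^+ 2) + 3 * (I.+1%:R * (2 * I%:R * (M%:R * s / e ^+ 2))) + 3 * (M%:R * s / e ^+ 2).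
    by rewrite E; field; rewrite !gt_eqF.
  have i0 : 0 <= (e ^+ 2)^-1 by rewrite invr_ge0 sqr_ge0.
  have h1 : (I * dd)%:R * s / e ^+ 2 <= 2 * I%:R * (M%:R * s / e ^+ 2).
    rewrite mulrA ler_wpM2r // mulrA ler_wpM2r // -!natrM ler_nat.
    by rewrite [(2 * I)%N]mulnC -mulnA leq_mul2l ddM orbT.
  have h2 : s / e ^+ 2 <= M%:R * s / e ^+ 2.
    by rewrite ler_wpM2r // ler_peMl // ler1n.
  have h3 : I.+1%:R * ((I * dd)%:R * s / e ^+ 2) <= I.+1%:R * (2 * I%:R * (M%:R * s / e ^+ 2)).
    by rewrite ler_wpM2l.
  by lra.
Qed.

End Constants.

Section Model.
Context (R : realType) (W : probability R R) (mq ma c : R -> R).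
Hypothesis model : move_model W mq ma.
Hypothesis curve : critical_curve mq ma c.

Let ma_ge0 u : unit_point u -> 0 <= ma u.
Proof. by move=> /(let: And4 h _ _ _ := curve in h u) []. Qed.

Let ma_lt v u : unit_point v -> unit_point u -> v < u -> ma v < ma u.
Proof. by move=> v01 u01 /(let: And4 _ h _ _ := curve in h v u v01 u01) []. Qed.

Lemma layer_bound_ge0 v u s Qv Qu Gv Gu Z : layer_laws W mq ma v u s Qv Qu Gv Gu Z -> 0 <= s.
Proof.
move=> laws; rewrite -lee_fin; apply: le_trans (boundZ laws).
by apply: integral_ge0 => x _; rewrite lee_fin sqr_ge0.
Qed.

Lemma grid_lower u : unit_point u -> exists2 s : R, 0 <= s &
  forall N H d (T : measurableType d) (P : probability T R) Y, grid P W N H Y ->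
  forall M dd I e, (M <= N)%N -> (I * dd < H)%N -> (0 < dd)%N -> 0 < e ->
  holds_but P (M%:R * s / e ^+ 2 + I.+1%:R * ((I * dd)%:R * s / e ^+ 2))
    (fun t => forall k, (k < I.+1)%N ->
       M%:R * mq u - (k * dd)%:R * ma u - 2 * e <= passage (at_grid Y t) 0 M (k * dd)).
Proof.
move=> u01; have /andP[u0 u1] := u01.
have v0 : 0 < u / 2 by rewrite divr_gt0.
have vu : u / 2 < u < 1 by rewrite u1 andbT; lra.
have v01 : unit_point (u / 2) by apply/andP; split; lra.
have [s [Qv [Qu [Gv [Gu [Z laws]]]]]] := layer_laws_exists model v0 vu.
exists s => [|N H d T P Y iY M dd I e MN IH d0 e0]; first exact: layer_bound_ge0 laws.
have [d' [T' [P' [X [iX [bge0 rge0]]]]]] := environment_exists N H Gv Gu Z (Qv_ge0 laws) (Qu_ge0 laws) (W_ge0 laws).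
have [B [mB PB BQ]] := env_lower laws (layer_bound_ge0 laws) iX bge0 rge0 MN IH d0 e0.
pose E : set (config R (nat * nat)%type) := [set cf | forall k, (k < I.+1)%N ->
  M%:R * mq u - (k * dd)%:R * ma u - 2 * e <=
  passage (fun i j => (cf : nat * nat -> R) (i, j)) 0 M (k * dd)].
have mE : measurable E.
  apply: measurable_forall => k _; apply: measurable_le => //.
  exact: measurable_config_passage.
have kd k : (k < I.+1)%N -> (k * dd < H)%N.
  by move=> kI; apply: leq_ltn_trans IH; rewrite leq_pmul2r.
have tr := grid_transfer iY (env_grid_independent laws iX) mE.
exists (~` ((fun t => restr (window N H) Y t) @^-1` E)).
have mpre : measurable ((fun t => restr (window N H) Y t) @^-1` E).
  have [mY _] := iY; rewrite -[_ @^-1` _]setTI; exact: (measurable_restr _ mY).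
split; first exact: measurableC.
  rewrite probability_setC // tr -probability_setC; last first.
    have [mY _] := env_grid_independent laws iX.
    by rewrite -[_ @^-1` _]setTI; exact: (measurable_restr _ mY).
  apply: le_trans PB; apply: le_measure; rewrite ?inE //.
    apply: measurableC; have [mY _] := env_grid_independent laws iX.
    by rewrite -[_ @^-1` _]setTI; exact: (measurable_restr _ mY).
  move=> t nE; apply: contrapT => nB; apply: nE => k kI.
  by rewrite restr_passage //; [exact: BQ|exact: kd].
move=> t /contrapT /= h k kI; have := h k kI; rewrite restr_passage //; exact: kd.
Qed.

End Model.

Section Scales.
Context (R : realType) (W : probability R R) (mq ma c : R -> R).
Hypothesis model : move_model W mq ma.
Hypothesis curve : critical_curve mq ma c.
Variables (v u s : R) (Qv Qu Gv Gu Z : probability R R).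
Hypothesis laws : layer_laws W mq ma v u s Qv Qu Gv Gu Z.
Hypothesis v01 : unit_point v.
Hypothesis u01 : unit_point u.
Hypothesis vu : v < u.

Let param (l : bool) := if l then u else v.

Let ma_ge0 x : unit_point x -> 0 <= ma x.
Proof. by have [h _ _ _] := curve; move=> /h[]. Qed.

Let c_gt0 x : unit_point x -> 0 < c x.
Proof. by have [h _ _ _] := curve; move=> /h[]. Qed.

Let ma_lt x y : unit_point x -> unit_point y -> x < y -> ma x < ma y.
Proof. by have [_ h _ _] := curve; move=> x01 y01 /(h x y x01 y01)[]. Qed.

Let ma_gt0 x : unit_point x -> 0 < ma x.
Proof.
move=> x01; have /andP[x0 x1] := x01.
have h : unit_point (x / 2) by apply/andP; split; lra.
by apply: le_lt_trans (ma_lt h x01 _); [exact: ma_ge0|lra].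
Qed.

Let param01 l : unit_point (param l). Proof. by case: l. Qed.

Let ma_param l : ma (param l) <= ma u.
Proof. by case: l => //; rewrite ltW // ma_lt. Qed.

Definition environment N H d (T : measurableType d) (P : probability T R) X :=
  [/\ independent_on P (in_window N H) (slot_law Qv Qu Gv Gu Z W) X,
      forall l k t, 0 <= X (Bottom l k) t & forall k j t, 0 <= X (Bulk k j) t].

Lemma scale_core (l : bool) (w y g : R) : unit_point w -> 0 <= y -> 0 < g ->
  exists (C : R) (kap K0 : nat), [/\ 0 <= C, (0 < K0)%N &
  forall N H d (T : measurableType d) (P : probability T R) X, environment N H P X ->
  forall k, (K0 <= k)%N -> let M := (k ^ 2)%N in (M <= N)%N -> (kap * M <= H)%N ->
  [/\ (0 < M)%N, ((Num.truncn (M%:R * y)).+3 < H)%N &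
  holds_but P (C / M%:R) (fun t => exists (dd I : nat) (e : R),
    [/\ (I * dd < H)%N, (0 < dd)%N /\ (2 <= H)%N,
      dd%:R * Num.max (ma u) (ma w) + 3 * e <= M%:R * g,
      M%:R * mq (param l) - (I * dd)%:R * ma (param l) + 2 * e < 0 &
      controlled M dd I (mq (param l)) (ma (param l)) e (env_height N X l t) /\
      forall k, (k <= I)%N -> M%:R * mq w - (k * dd)%:R * ma w - e <=
         passage (at_grid (env_grid N H X) t) 0 M (k * dd)])]].
Proof.
move=> w01 y0 g0.
have [sw sw0 lower] := grid_lower model w01.
have s0 := layer_bound_ge0 laws.
set b := Num.max (ma u) (ma w).
have bu : ma u <= b by rewrite le_max lexx.
have ab : ma (param l) <= b by apply: le_trans bu.
have u0 := ma_gt0 u01.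
have [de [C [D0 [I [K0 [kap [de0 C0 K00 H0]]]]]]] :=
  scale_constants (mq (param l)) g0 (ma_gt0 (param01 l)) ab (addr_ge0 s0 sw0) y0.
exists C, kap, K0; split => // N H d T P X [iX bge0 rge0] k Kk M MN kM.
have [[M0 e0 Id nH] h1 h2 h3] := H0 k Kk; rewrite -/M in M0 e0 Id nH h1 h2 h3.
have M0' : 0 < M%:R :> R by rewrite ltr0n.
set dd := (M %/ D0).+1 in Id h1 h2 h3; set e := M%:R * de in e0 h1 h2 h3.
have IH : (I * dd < H)%N by exact: leq_trans kM.
have H2 : (1 < H)%N by apply: leq_trans (leq_trans (ltnW nH) kM).
have sle : slack dd (ma u) e <= slack dd b e.
  by rewrite /slack lerD // lerD2l ler_pM2l // ler_wpM2l.
split=> //; first exact: leq_trans kM.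
have mavu : 0 <= ma v <= ma u by rewrite ma_ge0 //= ltW // ma_lt.
have good := env_controlled laws mavu s0 iX bge0 MN (ltnW IH) H2 (ltn0Sn _ : (0 < dd)%N) e0.
have low := lower N H d T P _ (env_grid_independent laws iX) M dd I e MN IH (ltn0Sn _) e0.
apply: holds_but_imply (holds_but_and good low).
  apply: le_trans h3; have i0 : 0 <= (e ^+ 2)^-1 by rewrite invr_ge0 sqr_ge0.
  have m0 : 0 <= M%:R / e ^+ 2 by rewrite divr_ge0 // sqr_ge0.
  have k0 : 0 <= I.+1%:R * ((I * dd)%:R / e ^+ 2).
    by rewrite mulr_ge0 // divr_ge0 // sqr_ge0.
  rewrite [X in _ <= X](_ : _ = (2 * (M%:R * s / e ^+ 2) + 2 * (I.+1%:R * ((I * dd)%:R * s / e ^+ 2)) + 3 * (s / e ^+ 2)) +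
     (M%:R * sw / e ^+ 2 + I.+1%:R * ((I * dd)%:R * sw / e ^+ 2)) +
     (M%:R / e ^+ 2 * (s + 2 * sw) + I.+1%:R * ((I * dd)%:R / e ^+ 2) * (s + 2 * sw) + 3 * (sw * (e ^+ 2)^-1))); last first.
    by field; rewrite gt_eqF.
  have sw' : 0 <= s + 2 * sw by rewrite addr_ge0 // mulr_ge0.
  by rewrite lerDl !addr_ge0 ?mulr_ge0.
move=> t [/(_ l)[c1 c2] lo]; exists dd, I, (slack dd b e); split=> //.
split; last first.
  move=> k' k'I; apply: le_trans (lo k' k'I); rewrite lerD2l lerN2.
  have b0 : 0 <= b by apply: le_trans bu; exact: ltW.
  by have db0 : 0 <= dd%:R * b; [rewrite mulr_ge0|rewrite /slack; lra].
split=> [k' k'I|r r2].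
  by apply: (le_trans (c1 k' k'I)); rewrite lerD2l.
by apply: (le_trans (c2 r r2)); rewrite lerD2l.
Qed.

Lemma env_grid_gap N H d (T : measurableType d) (X : slot -> T -> R) t r m n : (r < n)%N -> (m <= N)%N -> (n < H)%N ->
  gap (at_grid (env_grid N H X) t) r m n = gap (env_weight X t) r m n.
Proof.
move=> rn mN nH.
have E k j : (k < m)%N -> (j <= n)%N -> at_grid (env_grid N H X) t k j = env_weight X t k j.
  by move=> km jn; apply: env_gridE; [exact: leq_trans mN|exact: leq_ltn_trans nH].
by rewrite /gap !(passage_local _ E) // ltnW.
Qed.

Lemma scale_ge (l : bool) (y : R) : c (param l) < y ->
  exists (C : R) (kap K0 : nat), [/\ 0 <= C, (0 < K0)%N &
  forall N H d (T : measurableType d) (P : probability T R) X, environment N H P X ->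
  forall k, (K0 <= k)%N -> (k ^ 2 <= N)%N -> (kap * k ^ 2 <= H)%N ->
  ((Num.truncn ((k ^ 2)%:R * y)).+3 < H)%N /\
  holds_but P (C / (k ^ 2)%:R) (fun t => forall r, (r < 2)%N ->
    env_height N X l t 0 r - env_height N X l t 0 r.+1 <=
    gap (at_grid (env_grid N H X) t) r (k ^ 2) (Num.truncn ((k ^ 2)%:R * y)).+2)].
Proof.
move=> cy; have y0 : 0 < y by apply: lt_trans cy; exact: c_gt0.
have [_ _ below _] := curve; have [w [w01 wp slope]] := below _ _ (param01 l) cy.
have g0 : 0 < y * (ma (param l) - ma w) - (mq (param l) - mq w) by rewrite subr_gt0.
have [C [kap [K0 [C0 K00 core]]]] := scale_core l w01 (ltW y0) g0.
exists C, kap, K0; split => // N H d T P X env k Kk kN kH.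
have [M0 nH hb] := core N H d T P X env k Kk kN kH.
split=> //; apply: holds_but_imply hb => // t [dd [I [e [IH [d0 H2] key top0 [[c1 c2] lo]]]]] r r2.
have [iX bge0 rge0] := env.
have rn : (r < (Num.truncn ((k ^ 2)%:R * y)).+2)%N by exact: leq_trans r2 _.
rewrite (env_grid_gap X t rn kN (ltnW nH)).
have lo' k' : (k' <= I)%N -> (k ^ 2)%:R * mq w - (k' * dd)%:R * ma w - e <=
    passage (env_weight X t) 0 (k ^ 2) (k' * dd).
  move=> k'I; rewrite -(@passage_local _ (at_grid (env_grid N H X) t)); [exact: lo|by []|].
  move=> i j iM jk; apply: env_gridE; first exact: leq_trans kN.
  by apply: (leq_ltn_trans jk); apply: leq_ltn_trans IH; rewrite leq_pmul2r.
apply: (gap_ge_increment (env_busemann bge0 rge0 l t) (env_height_up N X l t) kN (ltnW IH)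
   (fun k j _ => env_weight_ge0 bge0 rge0 t k j) (fun k j kN => env_height_left bge0 rge0 l t j kN)
   c1 c2 top0 d0 H2 lo' r2 (ma_lt w01 (param01 l) wp) (ma_ge0 w01) (y := y)).
- have : dd%:R * ma (param l) <= dd%:R * Num.max (ma u) (ma w).
    by rewrite ler_wpM2l // le_max ma_param.
  by move: key; rewrite mulrBr mulrA; lra.
- by apply: ltW; apply: (lt_le_trans (truncnS_gt _)); rewrite ler_nat.
Qed.

Lemma scale_le (y : R) : 0 < y -> y < c u ->
  exists (C : R) (kap K0 : nat), [/\ 0 <= C, (0 < K0)%N &
  forall N H d (T : measurableType d) (P : probability T R) X, environment N H P X ->
  forall k, (K0 <= k)%N -> (k ^ 2 <= N)%N -> (kap * k ^ 2 <= H)%N ->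
  [/\ (1 < Num.truncn ((k ^ 2)%:R * y))%N, ((Num.truncn ((k ^ 2)%:R * y)).+3 < H)%N &
  holds_but P (C / (k ^ 2)%:R) (fun t => forall r, (r < 2)%N ->
    gap (at_grid (env_grid N H X) t) r (k ^ 2) (Num.truncn ((k ^ 2)%:R * y)) <=
    env_height N X true t 0 r - env_height N X true t 0 r.+1)]].
Proof.
move=> y0 cy.
have [_ _ _ above] := curve; have [w [w01 uw slope]] := above _ _ u01 cy.
have g0 : 0 < (mq w - mq u) - y * (ma w - ma u) by rewrite subr_gt0.
have [C [kap [K0 [C0 K00 core]]]] := scale_core true w01 (ltW y0) g0.
exists C, kap, (maxn K0 (Num.truncn (2 / y)).+1); split => // [|N H d T P X env k].
  by rewrite leq_max K00.
rewrite geq_max => /andP[Kk yk] kN kH.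
have [M0 nH hb] := core N H d T P X env k Kk kN kH.
have n2 : (1 < Num.truncn ((k ^ 2)%:R * y))%N.
  rewrite truncn_gt_nat -ler_pdivrMr //; apply: ltW; apply: (lt_le_trans (truncnS_gt _)).
  rewrite ler_nat (leq_trans yk) // -mulnn leq_pmulr //; exact: leq_trans yk.
split=> //; apply: holds_but_imply hb => // t [dd [I [e [IH [d0 H2] key top0 [[c1 c2] lo]]]]] r r2.
have [iX bge0 rge0] := env.
have rn : (r < Num.truncn ((k ^ 2)%:R * y))%N by exact: leq_trans r2 _.
rewrite (env_grid_gap X t rn kN); last by do 3 apply: ltnW.
have lo' k' : (k' <= I)%N -> (k ^ 2)%:R * mq w - (k' * dd)%:R * ma w - e <=
    passage (env_weight X t) 0 (k ^ 2) (k' * dd).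
  move=> k'I; rewrite -(@passage_local _ (at_grid (env_grid N H X) t)); [exact: lo|by []|].
  move=> i j iM jk; apply: env_gridE; first exact: leq_trans kN.
  by apply: (leq_ltn_trans jk); apply: leq_ltn_trans IH; rewrite leq_pmul2r.
apply: (gap_le_increment (env_busemann bge0 rge0 true t) (env_height_up N X true t) kN (ltnW IH)
   (fun k j _ => env_weight_ge0 bge0 rge0 t k j) (fun k j kN => env_height_left bge0 rge0 true t j kN)
   c1 c2 top0 d0 H2 lo' r2 rn (ma_lt u01 w01 uw) (y := y)).
- have : dd%:R * ma w <= dd%:R * Num.max (ma u) (ma w).
    by rewrite ler_wpM2l // le_max lexx orbT.
  by move: key; rewrite mulrBr mulrA; lra.
- by rewrite truncn_le mulr_ge0 // ltW.
Qed.

End Scales.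

(** * The coupling inequality *)

Section Limits.
Context (R : realType) d (T : measurableType d) (P : probability T R).

Lemma decreasing_bound (A : nat -> set T) (x : R) : (forall n, measurable (A n)) ->
  (forall n, A n.+1 `<=` A n) -> (forall n, (x%:E <= P (A n))%E) ->
  (x%:E <= P (\bigcap_n A n))%E.
Proof.
move=> mA decr xA.
have := @nonincreasing_cvg_mu _ _ _ P A.
have -> : (P (A 0%N) < +oo)%E by apply: (le_lt_trans (probability_le1 _ _)); rewrite ?ltry.
move=> /(_ isT mA (bigcapT_measurable mA)) h.
have {}h : P \o A @ \oo --> P (\bigcap_n A n).
  apply: h; apply/nonincreasing_seqP => n; exact/subsetPset.
rewrite -(cvg_lim _ h) //; apply: lime_ge; first by apply/cvg_ex; eexists; exact: h.
by near=> n; exact: xA.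
Unshelve. all: by end_near.
Qed.

Lemma bound_eps (x : R) (A : set T) : (forall e, 0 < e -> (x%:E <= P A + e%:E)%E) -> (x%:E <= P A)%E.
Proof. by move=> h; apply/lee_addgt0Pr => e; exact: h. Qed.

End Limits.

Lemma small_interval (R : realType) (m : probability R R) (e : R) : 0 < e ->
  exists2 h : R, 0 < h & (m `]0%R, h[%classic <= e%:E)%E.
Proof.
move=> e0; pose A n : set R := `]0, (n.+1%:R)^-1[%classic.
apply: contrapT => H.
have : (e%:E <= m (\bigcap_n A n))%E.
  apply: decreasing_bound => [n|n x|n]; first exact: measurable_itv.
    rewrite /A /= !in_itv /= => /andP[-> h]; apply: (lt_le_trans h).
    by rewrite lef_pV2 ?posrE // ler_nat.
  rewrite leNgt; apply/negP => h; apply: H; exists (n.+1%:R)^-1; first by rewrite invr_gt0.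
  exact: ltW.
rewrite (_ : \bigcap_n _ = set0) ?measure0 ?lee_fin ?leNgt ?e0 //.
apply/seteqP; split => // x h.
have := h 0%N Logic.I; rewrite /A /= in_itv /= => /andP[x0 _].
have := h (Num.truncn x^-1) Logic.I; rewrite /A /= in_itv /= => /andP[_].
by rewrite -[ltLHS]invrK ltf_pV2 ?posrE ?invr_gt0 // ltNge ltW // truncnS_gt.
Qed.

Section Coupling.
Context (R : realType) (W : probability R R) (mq ma c : R -> R).
Hypothesis model : move_model W mq ma.
Hypothesis curve : critical_curve mq ma c.
Context d (T : measurableType d) (P : probability T R) (omega : site -> T -> R).
Hypothesis iomega : independent_on P predT (fun _ => W) omega.

Let Y (x : nat * nat) t := omega (x.1%:Z, x.2%:Z) t.

Let grid_omega N H : grid P W N H Y.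
Proof.
have inj : injective (fun x : nat * nat => (x.1%:Z, x.2%:Z) : site) by move=> [a b] [a' b'] [-> ->].
have := independent_on_reindex iomega inj; exact: independent_on_sub.
Qed.

Definition angle r t := crit_angle (omega^~ t) (0%:Z, r%:Z).

Let mangle r : measurable_fun setT (angle r).
Proof. by apply: measurable_crit_angle; have [] := iomega. Qed.

Definition direction (x : R) := (1 + c x)^-1.

Variables (v u s : R) (Qv Qu Gv Gu Z : probability R R).
Hypothesis laws : layer_laws W mq ma v u s Qv Qu Gv Gu Z.
Hypothesis v01 : unit_point v.
Hypothesis u01 : unit_point u.
Hypothesis vu : v < u.
Variables (SZ S0 S1 SH : set R) (sb tb pb : nat -> bool).
Hypotheses (mSZ : measurable SZ) (mS0 : measurable S0) (mS1 : measurable S1) (mSH : measurable SH).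

(* The increments of the two heights at the origin column, in terms of the store
   and of the boundary variables [g 0], [g 1] and [h 0]. *)
Definition increment_u (z g0 g1 h : R) (r : nat) : R := if r is 0%N then pos g0 else pos g1.
Definition increment_v (z g0 g1 h : R) (r : nat) : R :=
  if r is 0%N then Num.min (pos g0) (pos z)
  else Num.min (pos g1) (pos h + pos (pos z - pos g0)).

Hypothesis pattern : forall z g0 g1 h, SZ z -> S0 g0 -> S1 g1 -> SH h -> forall r, (r < 2)%N ->
  [/\ sb r -> increment_v z g0 g1 h r <= 0, tb r -> increment_u z g0 g1 h r <= 0 &
      pb r -> 0 < increment_u z g0 g1 h r].

Definition good_scale (ys yt yp eta : R) (gp : nat -> nat -> nat -> R) (l : nat) :=
  forall r, (r < 2)%N ->
  [/\ sb r -> 0 <= gp r (l ^ 2)%N (Num.truncn ((l ^ 2)%:R * ys)).+2,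
      tb r -> 0 <= gp r (l ^ 2)%N (Num.truncn ((l ^ 2)%:R * yt)).+2 &
      pb r -> gp r (l ^ 2)%N (Num.truncn ((l ^ 2)%:R * yp)) <= - eta].

Lemma measurable_good_scale d' (U : measurableType d') ys yt yp eta
    (gp : nat -> nat -> nat -> U -> R) K n :
  (forall r m n, measurable_fun setT (gp r m n)) ->
  measurable [set t | forall l, (K <= l <= n)%N -> good_scale ys yt yp eta (fun r m n => gp r m n t) l].
Proof.
move=> mg; apply: measurable_forall => l _; apply: measurable_forall => r _.
by apply: measurable_and3; apply: measurable_imply; apply: measurable_le.
Qed.

Let x : R := fine (Z SZ * (Gu S0 * (Gu S1 * Gv SH)))%E.

Let eq_good_scale ys yt yp eta gp gp' l :
  (forall r n, (r < 2)%N -> n \in [:: (Num.truncn ((l ^ 2)%:R * ys)).+2;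
      (Num.truncn ((l ^ 2)%:R * yt)).+2; Num.truncn ((l ^ 2)%:R * yp)] ->
    gp r (l ^ 2)%N n = gp' r (l ^ 2)%N n) ->
  good_scale ys yt yp eta gp l -> good_scale ys yt yp eta gp' l.
Proof.
move=> E h r r2; have [h1 h2 h3] := h r r2.
by split=> b; rewrite -E ?inE ?eqxx ?orbT //; [exact: h1|exact: h2|exact: h3].
Qed.

Let restr_gap U (Y' : nat * nat -> U -> R) N H t r m n : (r < n)%N -> (m <= N)%N -> (n < H)%N ->
  gap (fun k j => (restr (window N H) Y' t : nat * nat -> R) (k, j)) r m n =
  gap (at_grid Y' t) r m n.
Proof. by move=> rn mN nH; rewrite /gap !restr_passage // ltnW. Qed.

(* Where the increment of a height at the origin vanishes the gap is eventually zero
   below its direction, where it is positive the gap stays away from zero above it. *)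
Lemma coupling_scales (ys yt yp e : R) : c v < ys -> c u < yt -> 0 < yp -> yp < c u -> 0 < e ->
  exists2 K : nat, (0 < K)%N & exists2 eta : R, 0 < eta & forall n,
  (x%:E <= P [set t | forall l, (K <= l <= n)%N ->
    good_scale ys yt yp eta (gap (corner (omega^~ t))) l] + e%:E)%E.
Proof.
move=> cys cyt yp0 cyp e0.
have [C1 [k1 [K1 [C10 K10 H1]]]] := scale_ge model curve laws v01 u01 vu (l := false) cys.
have [C2 [k2 [K2 [C20 K20 H2]]]] := scale_ge model curve laws v01 u01 vu (l := true) cyt.
have [C3 [k3 [K3 [C30 K30 H3]]]] := scale_le model curve laws v01 u01 vu yp0 cyp.
have e40 : 0 < e / 4 by rewrite divr_gt0.
have [eta eta0 small] := small_interval Gu e40.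
pose C := C1 + C2 + C3; have C0 : 0 <= C by rewrite !addr_ge0.
pose K := maxn (maxn K1 K2) (maxn K3 (Num.truncn (4 * C / e)).+1).
have K0 : (0 < K)%N by rewrite !leq_max K10.
have KC : 2 * C / K%:R <= e / 2.
  have h : 4 * C <= K%:R * e.
    rewrite -ler_pdivrMr //; apply: ltW; apply: (lt_le_trans (truncnS_gt _)).
    by rewrite ler_nat !leq_max leqnn !orbT.
  by rewrite ler_pdivrMr ?ltr0n //; lra.
exists K => //; exists eta => // n.
pose N := (n ^ 2)%N; pose H := ((k1 + k2 + k3) * n ^ 2 + 2)%N.
have H2' : (1 < H)%N by rewrite /H addn2.
have [d' [T' [P' [X env]]]] := environment_exists N H Gv Gu Z (Qv_ge0 laws) (Qu_ge0 laws) (W_ge0 laws).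
have env' : environment W Qv Qu Gv Gu Z N H P' X by case: env => ? [? ?].
have [iX bge0 rge0] := env'.
have sizes l : (K <= l <= n)%N -> [/\ (K1 <= l)%N, (K2 <= l)%N, (K3 <= l)%N &
    (l ^ 2 <= N)%N /\ [/\ (k1 * l ^ 2 <= H)%N, (k2 * l ^ 2 <= H)%N & (k3 * l ^ 2 <= H)%N]].
  move=> /andP[Kl ln]; have lN : (l ^ 2 <= N)%N by rewrite leq_sqr.
  move: Kl; rewrite !geq_max => /andP[/andP[? ?] /andP[? _]].
  have kb k : (k <= k1 + k2 + k3)%N -> (k * l ^ 2 <= H)%N.
    by move=> kk; apply: leq_trans (leq_addr _ _); exact: leq_mul.
  split; rewrite ?lN //; split; rewrite // ; split; apply: kb.
  - by rewrite -addnA leq_addr.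
  - by rewrite (leq_trans (leq_addl k1 k2)) ?leq_addr.
  - exact: leq_addl.
have small_n l : (K <= l <= n)%N -> (l ^ 2 <= N)%N /\ forall m, m \in [:: (Num.truncn ((l ^ 2)%:R * ys)).+2;
      (Num.truncn ((l ^ 2)%:R * yt)).+2; Num.truncn ((l ^ 2)%:R * yp)] -> (1 < m < H)%N.
  move=> ln; have [l1 l2 l3 [lN [m1 m2 m3]]] := sizes l ln; split=> // m.
  have [n1 _] := H1 N H _ _ P' X env' l l1 lN m1.
  have [n2 _] := H2 N H _ _ P' X env' l l2 lN m2.
  have [n30 n31 _] := H3 N H _ _ P' X env' l l3 lN m3.
  by rewrite !inE => /or3P[] /eqP ->; rewrite ?n30 /= ?(ltnW n1) ?(ltnW n2) //; do 3 apply: ltnW.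
have scales : holds_but P' (2 * C / K%:R) (fun t => forall l, (K <= l)%N -> (l <= n)%N ->
    [/\ forall r, (r < 2)%N -> env_height N X false t 0 r - env_height N X false t 0 r.+1 <=
        gap (at_grid (env_grid N H X) t) r (l ^ 2) (Num.truncn ((l ^ 2)%:R * ys)).+2,
     forall r, (r < 2)%N -> env_height N X true t 0 r - env_height N X true t 0 r.+1 <=
        gap (at_grid (env_grid N H X) t) r (l ^ 2) (Num.truncn ((l ^ 2)%:R * yt)).+2 &
     forall r, (r < 2)%N -> gap (at_grid (env_grid N H X) t) r (l ^ 2) (Num.truncn ((l ^ 2)%:R * yp)) <=
        env_height N X true t 0 r - env_height N X true t 0 r.+1]).
  apply: holds_but_range => // l Kl ln.
  have [l1 l2 l3 [lN [m1 m2 m3]]] := sizes l (introT andP (conj Kl ln)).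
  have [_ h1] := H1 N H _ _ P' X env' l l1 lN m1.
  have [_ h2] := H2 N H _ _ P' X env' l l2 lN m2.
  have [_ _ h3] := H3 N H _ _ P' X env' l l3 lN m3.
  apply: holds_but_imply (holds_but_and h1 (holds_but_and h2 h3)).
    by rewrite /C !mulrDl addrA.
  by move=> t [? [? ?]].
have start (r : nat) : (r < H)%N -> holds_but P' (e / 4) (fun t => 0 < pos (X (Side true r) t) ->
    eta <= pos (X (Side true r) t)).
  move=> rH; exists (X (Side true r) @^-1` `]0, eta[%classic); have [mX _] := iX.
  split; first exact: preimage_measurable.
    by rewrite (law_on iX) //.
  move=> t nB p0; have [[x0 [pE _]]|[_ [pE _]]] := posP (X (Side true r) t); last first.
    by move: p0; rewrite pE ltxx.
  rewrite leNgt; apply/negP => h; apply: nB; rewrite /= in_itv /=; move: p0 h; rewrite pE.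
  by move=> -> ->.
have good := holds_but_and scales (holds_but_and (start 0%N (ltnW H2')) (start 1%N H2')).
pose E : set (config R (nat * nat)%type) := [set cf | forall l, (K <= l <= n)%N ->
    good_scale ys yt yp eta (gap (fun k j => (cf : nat * nat -> R) (k, j))) l].
have mE : measurable E.
  apply: (@measurable_good_scale _ (config R (nat * nat)%type) _ _ _ _
    (fun r m n cf => gap (fun k j => (cf : nat * nat -> R) (k, j)) r m n)) => r i j.
  by apply: measurable_funB; exact: measurable_config_passage.
have tr := grid_transfer (grid_omega N H) (env_grid_independent laws iX) mE.
have -> : [set t | forall l, (K <= l <= n)%N -> good_scale ys yt yp eta (gap (corner (omega^~ t))) l] =
    (fun t => restr (window N H) Y t) @^-1` E.
  apply/seteqP; split => t /= h l ln; have [lN lm] := small_n l ln; apply: eq_good_scale (h l ln) => r m r2 /lm /andP[m1 mH];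
    by rewrite restr_gap //; exact: leq_trans m1.
rewrite tr.
pose A (i : slot) : set R := match i with
  | Store => SZ | Side true 0 => S0 | Side true 1 => S1 | Side false 0 => SH | _ => setT end.
have mA i : measurable (A i).
  by rewrite /A; case: i => [|? ?|[] [|[|?]]|? ?] //; exact: measurableT.
pose sl := [:: Store; Side true 0; Side true 1; Side false 0].
have [mC EC] := content_state_independent iX (moveZ laws) (leqnn N).
pose pat := box (content_state N X N) sl A.
have xE : P' pat = x%:E.
  rewrite /pat EC //; last first.
    by move=> i; rewrite !inE => /or4P[] /eqP ->; rewrite /in_mem /= ?H2' ?(ltnW H2').
  rewrite /sl !big_cons big_nil mule1 /= /x fineK //.
  by rewrite !fin_numM // fin_num_measure.
rewrite -xE.
have mres : measurable ((fun t => restr (window N H) (env_grid N H X) t) @^-1` E).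
  have [mY _] := env_grid_independent laws iX.
  by rewrite -[_ @^-1` _]setTI; exact: (measurable_restr _ mY).
have mpat : measurable pat by exact: measurable_box.
apply: le_trans (holds_but_le mpat mres good _) _; last by rewrite leeD2l // lee_fin; lra.
move=> t pt [sc [st0 st1]] l ln; have [lN lm] := small_n l ln.
apply: (@eq_good_scale _ _ _ _ (gap (at_grid (env_grid N H X) t))) => [r m r2 /lm /andP[m1 mH]|].
  by rewrite restr_gap //; exact: leq_trans m1.
have [Kl ln'] := andP ln; have [sA sB sC] := sc l Kl ln'.
have [zE _ gE] := content_stateE X t (leqnn N).
set z := env_content N X t N in zE.
pose g0 := X (Side true 0) t; pose g1 := X (Side true 1) t; pose h0 := X (Side false 0) t.
have pz : SZ z by rewrite -zE; apply: (pt Store); rewrite /= !inE eqxx.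
have pg0 : S0 g0 by rewrite /g0 -gE; apply: (pt (Side true 0)); rewrite /= !inE eqxx !orbT.
have pg1 : S1 g1 by rewrite /g1 -gE; apply: (pt (Side true 1)); rewrite /= !inE eqxx !orbT.
have ph0 : SH h0 by rewrite /h0 -gE; apply: (pt (Side false 0)); rewrite /= !inE eqxx !orbT.
have incr_u r : (r < 2)%N ->
    env_height N X true t 0 r - env_height N X true t 0 r.+1 = - increment_u z g0 g1 h0 r.
  by move=> r2; rewrite -opprB heightV; case: r r2 => [|[|]].
have incr_v r : (r < 2)%N ->
    env_height N X false t 0 r - env_height N X false t 0 r.+1 = - increment_v z g0 g1 h0 r.
  by move=> r2; rewrite -opprB height2V; case: r r2 => [|[|]] //= _; rewrite subn0.
move=> r r2; have [p1 p2 p3] := pattern pz pg0 pg1 ph0 r2; split=> b.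
- by apply: le_trans (sA r r2); rewrite incr_v // oppr_ge0 p1.
- by apply: le_trans (sB r r2); rewrite incr_u // oppr_ge0 p2.
- apply: (le_trans (sC r r2)); rewrite incr_u // lerN2; move: (p3 b).
  by clear p1 p2 p3 b; case: r r2 => [|[|]].
Qed.

Let mslack (k : R) : measurable [set t | forall r, (r < 2)%N ->
    [/\ sb r -> direction v - k <= angle r t, tb r -> direction u - k <= angle r t &
        pb r -> angle r t <= direction u + k]%R].
Proof.
apply: measurable_forall => r _.
apply: measurable_and3; apply: measurable_imply; apply: measurable_le => //;
  exact: mangle.
Qed.

Let cv0 : 0 < c v. Proof. by have [h _ _ _] := curve; have [] := h v v01. Qed.
Let cu0 : 0 < c u. Proof. by have [h _ _ _] := curve; have [] := h u u01. Qed.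

Lemma direction_shift (y k : R) : 0 < y -> 0 < k ->
  (1 + y)^-1 - k <= (1 + (y + k))^-1 /\
  (1 + (y - Num.min k y / 2))^-1 <= (1 + y)^-1 + k.
Proof.
move=> y0 k0; split.
  rewrite -subr_ge0 [X in 0 <= X](_ : _ = k * ((1 + y) * (1 + (y + k)) - 1) / ((1 + y) * (1 + (y + k)))).
    by rewrite divr_ge0 // mulr_ge0 ?ltW //; nra.
  by field; rewrite !gt_eqF //; lra.
set m := Num.min k y / 2.
have [m0 mk my] : [/\ 0 < m, m <= k & m <= y / 2].
  by rewrite /m; have [[? ->]|[? ->]] := minP k y; split; lra.
apply: (@le_trans _ _ ((1 + y)^-1 + m)); last by rewrite lerD2l.
rewrite -subr_ge0 [X in 0 <= X](_ : _ = m * ((1 + y) * (1 + (y - m)) - 1) / ((1 + y) * (1 + (y - m)))).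
  by rewrite divr_ge0 // mulr_ge0 ?ltW //; nra.
by field; rewrite !gt_eqF //; lra.
Qed.

Let inv_frac (y : R) : 0 < y -> y^-1 / (1 + y^-1) = (1 + y)^-1.
Proof. by move=> y0; field; rewrite !gt_eqF //; lra. Qed.

Lemma coupling_slack (k e : R) : 0 < k -> 0 < e ->
  (x%:E <= P [set t | forall r, (r < 2)%N ->
    [/\ sb r -> direction v - k <= angle r t, tb r -> direction u - k <= angle r t &
        pb r -> angle r t <= direction u + k]%R] + e%:E)%E.
Proof.
move=> k0 e0; pose m : R := Num.min k (c u) / 2.
have [m0 my] : 0 < m /\ m <= c u / 2.
  by rewrite /m; have [[? ->]|[? ->]] := minP k (c u); have := cu0; split; lra.
have cu := cu0; have cv := cv0.
have k20 : 0 < k / 2 by rewrite divr_gt0.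
have yp0 : 0 < c u - m / 2 by lra.
have ypc : c u - m / 2 < c u by rewrite gtrBl divr_gt0.
have ysc : c v < c v + k / 2 by rewrite ltrDl.
have ytc : c u < c u + k / 2 by rewrite ltrDl.
have [K K0 [eta eta0 H]] := coupling_scales ysc ytc yp0 ypc e0.
pose A n := [set t | forall l, (K <= l <= n)%N ->
    good_scale (c v + k / 2) (c u + k / 2) (c u - m / 2) eta (gap (corner (omega^~ t))) l].
have mA n : measurable (A n).
  apply: (@measurable_good_scale _ T _ _ _ _ (fun r m n t => gap (corner (omega^~ t)) r m n)) => r i j.
  by apply: measurable_funB; apply: measurable_passage => a b; have [h _] := iomega; exact: h.
have decr n : A n.+1 `<=` A n.
  by move=> t h l /andP[Kl ln]; apply: h; rewrite Kl ltnW.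
have bound n : ((x - e)%:E <= P (A n))%E by rewrite EFinB leeBlDr //; exact: H.
have := decreasing_bound mA decr bound; rewrite EFinB leeBlDr // => /le_trans; apply.
rewrite leeD2r //; apply: le_measure; rewrite ?inE //.
  exact: bigcapT_measurable.
move=> t /= At r r2.
have {}At l : (K <= l)%N -> good_scale (c v + k / 2) (c u + k / 2) (c u - m / 2) eta (gap (corner (omega^~ t))) l.
  by move=> Kl; apply: (At l Logic.I); rewrite Kl /=.
split=> b.
- have [h _] := direction_shift cv k0; apply: (le_trans h); rewrite -inv_frac; last by lra.
  apply: flat_crit_angle; first by rewrite invr_gt0; lra.
  apply: (@flat_scales _ _ _ K (c v + k / 2)) => //; first by apply/andP; split; lra.
  by move=> l /At /(_ r r2)[/(_ b)].
- have [h _] := direction_shift cu k0; apply: (le_trans h); rewrite -inv_frac; last by lra.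
  apply: flat_crit_angle; first by rewrite invr_gt0; lra.
  apply: (@flat_scales _ _ _ K (c u + k / 2)) => //; first by apply/andP; split; lra.
  by move=> l /At /(_ r r2)[_ /(_ b)].
- have [_ h] := direction_shift cu k0; apply: le_trans h; rewrite -/m -inv_frac; last by lra.
  apply: crit_angle_le; first by rewrite invr_gt0; lra.
  apply: (@not_flat_scales _ _ _ K (c u - m / 2) _ eta) => //; first by apply/andP; split; lra.
  by move=> l /At /(_ r r2)[_ _ /(_ b)].
Qed.

Lemma coupling :
  (Z SZ * (Gu S0 * (Gu S1 * Gv SH)) <= P [set t | forall r, (r < 2)%N ->
    [/\ sb r -> direction v <= angle r t, tb r -> direction u <= angle r t &
        pb r -> angle r t <= direction u]%R])%E.
Proof.
have -> : (Z SZ * (Gu S0 * (Gu S1 * Gv SH)))%E = x%:E.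
  by rewrite /x fineK // !fin_numM // fin_num_measure.
pose A n := [set t | forall r, (r < 2)%N ->
    [/\ sb r -> direction v - (n.+1%:R)^-1 <= angle r t, tb r -> direction u - (n.+1%:R)^-1 <= angle r t &
        pb r -> angle r t <= direction u + (n.+1%:R)^-1]].
have mA n : measurable (A n) by exact: mslack.
have inv_le n : (n.+2%:R)^-1 <= (n.+1%:R)^-1 :> R by rewrite lef_pV2 ?posrE // ler_nat.
have decr n : A n.+1 `<=` A n.
  move=> t h r r2; have [h1 h2 h3] := h r r2; split=> b.
  - by apply: le_trans (h1 b); rewrite lerD2l lerN2.
  - by apply: le_trans (h2 b); rewrite lerD2l lerN2.
  - by apply: (le_trans (h3 b)); rewrite lerD2l.
have bound n : (x%:E <= P (A n))%E.
  by apply: bound_eps => e e0; apply: coupling_slack; rewrite ?invr_gt0.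
apply: (le_trans (decreasing_bound mA decr bound)).
apply: le_measure; rewrite ?inE //; first exact: bigcapT_measurable.
  rewrite (_ : [set _ | _] = [set t | forall r, (r < 2)%N ->
    [/\ sb r -> direction v - 0 <= angle r t, tb r -> direction u - 0 <= angle r t &
        pb r -> angle r t <= direction u + 0]]); first exact: mslack.
  by rewrite !subr0 addr0.
have small (y z : R) : (forall n, y <= z + (n.+1%:R)^-1) -> y <= z.
  move=> h; apply/ler_addgt0Pr => e e0; apply: (le_trans (h (Num.truncn e^-1))).
  by rewrite lerD2l -[leRHS]invrK lef_pV2 ?posrE ?invr_gt0 // ltW // truncnS_gt.
move=> t /= At r r2; split=> b; apply: small => n; have [h1 h2 h3] := At n Logic.I r r2.
- by rewrite -lerBlDr; exact: h1.
- by rewrite -lerBlDr; exact: h2.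
- exact: h3.
Qed.

End Coupling.

(** * Summation over the cells *)

Section Slices.
Context (R : realType) d (T : measurableType d) (P : probability T R).

Definition pr (A : set T) : R := fine (P A).

Lemma prE A : measurable A -> P A = (pr A)%:E.
Proof. by move=> mA; rewrite /pr fineK // fin_num_measure. Qed.

Lemma pr_ge0 A : 0 <= pr A.
Proof. by rewrite /pr fine_ge0. Qed.

Lemma pr_le A B : measurable A -> measurable B -> A `<=` B -> pr A <= pr B.
Proof. by move=> mA mB AB; rewrite -lee_fin -!prE //; apply: le_measure; rewrite ?inE. Qed.

Lemma pr_setU A B : measurable A -> measurable B -> A `&` B = set0 -> pr (A `|` B) = pr A + pr B.
Proof.
move=> mA mB AB; have := measureU P mA mB AB.
rewrite [LHS]prE; last exact: measurableU.
by rewrite [X in _ = X + _ -> _]prE // [X in _ = _ + X -> _]prE // -EFinD => -[].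
Qed.

Lemma pr_setU_le A B : measurable A -> measurable B -> pr (A `|` B) <= pr A + pr B.
Proof.
move=> mA mB; have := measureU2 P mA mB.
by rewrite [X in (X <= _)%E]prE ?[X in (_ <= X + _)%E]prE ?[X in (_ <= _ + X)%E]prE //; exact: measurableU.
Qed.

Lemma pr_setT : pr setT = 1.
Proof. by rewrite /pr probability_setT. Qed.

Lemma pr_slices (f : T -> R) (th a : nat -> R) (E : set T) m : measurable_fun setT f -> measurable E ->
  (forall k, (k < m)%N -> th k <= th k.+1) ->
  (forall k, (k < m)%N -> a k <= pr (E `&` [set t | th k <= f t < th k.+1])) ->
  \sum_(k < m) a k <= pr E.
Proof.
move=> mf mE th_le aE.
have mlt x : measurable [set t | f t < x] by apply: measurable_lt => //; exact: measurable_cst.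
have mge x : measurable [set t | x <= f t] by apply: measurable_le => //; exact: measurable_cst.
suff main n : (n <= m)%N -> \sum_(k < n) a k <= pr (E `&` [set t | f t < th n]).
  apply: (le_trans (main m (leqnn m))); apply: pr_le => //; first exact: measurableI.
elim: n => [_|n IH nm]; first by rewrite big_ord0 pr_ge0.
have mslice : measurable (E `&` [set t | th n <= f t < th n.+1]).
  apply: measurableI => //; rewrite (_ : [set _ | _] = [set t | th n <= f t] `&` [set t | f t < th n.+1]).
    exact: measurableI.
  by apply/seteqP; split => t /=; [move=> /andP|move=> [-> ->]].
rewrite big_ord_recr /=; apply: le_trans (lerD (IH (ltnW nm)) (aE n nm)) _.
rewrite -pr_setU //; first last.
- apply/seteqP; split => // t [/= [_ h] [_ /andP[h' _]]].
  by move: h; rewrite ltNge h'.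
- exact: measurableI.
apply: pr_le; [by apply: measurableU => //; exact: measurableI|exact: measurableI|].
move=> t [[Et /= h]|[Et /= /andP[_ h]]]; split => //=.
by apply: (lt_le_trans h); exact: th_le.
Qed.

End Slices.

Section Sums.
Variable R : realType.

Lemma sum_linear (b : R) m : \sum_(k < m) (b - k%:R) = m%:R * b - m%:R * (m%:R - 1) / 2.
Proof.
elim: m => [|m IH]; first by rewrite big_ord0; field.
by rewrite big_ord_recr /= IH -natr1; field.
Qed.

Lemma sum_square (b : R) m : \sum_(k < m) (b - k%:R) * (b + 1 - k%:R) =
  m%:R * b * (b + 1) - (2 * b + 1) * (m%:R * (m%:R - 1) / 2) + (m%:R - 1) * m%:R * (2 * m%:R - 1) / 6.
Proof.
elim: m => [|m IH]; first by rewrite big_ord0; field.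
by rewrite big_ord_recr /= IH -natr1; field.
Qed.

Lemma sum_product (b : R) m : \sum_(k < m) (k%:R + 2) * (b - k%:R) =
  2 * b * m%:R + (b - 2) * (m%:R * (m%:R - 1) / 2) - (m%:R - 1) * m%:R * (2 * m%:R - 1) / 6.
Proof.
elim: m => [|m IH]; first by rewrite big_ord0; field.
by rewrite big_ord_recr /= IH -natr1; field.
Qed.

Lemma le_harmonic (x y C : R) : (forall m, x - C / m.+2%:R <= y) -> x <= y.
Proof.
move=> h; apply/ler_addgt0Pr => e e0.
pose m := Num.truncn (`|C| / e).
have m0 : 0 < m.+2%:R :> R by rewrite ltr0n.
have Ce : C / m.+2%:R <= e.
  rewrite ler_pdivrMr // mulrC -ler_pdivrMr //.
  apply: (@le_trans _ _ (`|C| / e)); first by rewrite ler_pM2r ?invr_gt0 // ler_norm.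
  by apply: ltW; apply: (lt_trans (truncnS_gt _)); rewrite ltr_nat.
by apply: (@le_trans _ _ (y + C / m.+2%:R)); rewrite ?lerD2l // -lerBlDr.
Qed.

End Sums.

Section Final.
Context (R : realType) (W : probability R R) (mq ma c : R -> R).
Hypothesis model : move_model W mq ma.
Hypothesis curve : critical_curve mq ma c.
Context d (T : measurableType d) (P : probability T R) (omega : site -> T -> R).
Hypothesis iomega : independent_on P predT (fun _ => W) omega.

Let xi r t := angle omega r t.

Let mxi r : measurable_fun setT (xi r).
Proof. by apply: measurable_crit_angle; have [] := iomega. Qed.

Let tau := direction c.

Let tau_lt x y : unit_point x -> unit_point y -> x < y -> tau x < tau y.
Proof.
move=> x01 y01 xy; have [h1 h2 _ _] := curve; have [_ cyx] := h2 x y x01 y01 xy.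
have [_ cx] := h1 x x01; have [_ cy] := h1 y y01.
by rewrite /tau /direction ltf_pV2 ?posrE ?ltrD2l // addr_gt0.
Qed.

Let tau01 x : unit_point x -> 0 < tau x < 1.
Proof.
move=> x01; have [h1 _ _ _] := curve; have [_ cx] := h1 x x01.
by rewrite /tau /direction invr_gt0 invf_lt1 ?addr_gt0 // ltrDl cx.
Qed.

(* [Some true], [Some false] and [None] stand for the conditions [x > 0],
   [x <= 0] and no condition. *)
Definition sign_set (o : option bool) : set R :=
  match o with Some true => `]0, +oo[%classic | Some false => `]-oo, 0]%classic | None => setT end.

Definition sign_weight (o : option bool) (a : R) : R :=
  match o with Some true => a | Some false => 1 - a | None => 1 end.

Let measurable_sign o : measurable (sign_set o).
Proof. by case: o => [[]|]; [exact: measurable_itv|exact: measurable_itv|exact: measurableT]. Qed.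

Let sign_measure (m : probability R R) (a : R) o :
  m `]0, +oo[%classic = a%:E -> m (sign_set o) = (sign_weight o a)%:E.
Proof.
move=> ma'; case: o => [[]|] //=; last exact: probability_setT.
by rewrite -setCitvr probability_setC // ma' EFinB.
Qed.

Lemma cell_bound v u (oz o0 o1 oh : option bool) (sb tb pb : nat -> bool) (A : set T) :
  unit_point v -> unit_point u -> v < u ->
  (forall z g0 g1 h, sign_set oz z -> sign_set o0 g0 -> sign_set o1 g1 -> sign_set oh h ->
   forall r, (r < 2)%N ->
   [/\ sb r -> increment_v z g0 g1 h r <= 0, tb r -> increment_u z g0 g1 h r <= 0 &
      pb r -> 0 < increment_u z g0 g1 h r]) ->
  measurable A ->
  (forall t, (forall r, (r < 2)%N ->
    [/\ sb r -> tau v <= xi r t, tb r -> tau u <= xi r t & pb r -> xi r t <= tau u]) -> A t) ->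
  sign_weight oz (v / u) * (sign_weight o0 u * (sign_weight o1 u * sign_weight oh v)) <= pr P A.
Proof.
move=> v01 u01 vu pat mA AE.
have /andP[v0 v1] := v01; have /andP[u0 u1] := u01.
have vu1 : v < u < 1 by rewrite vu.
have [s [Qv [Qu [Gv [Gu [Z laws]]]]]] := layer_laws_exists model v0 vu1.
have := coupling model curve iomega laws v01 u01 vu (measurable_sign oz) (measurable_sign o0)
  (measurable_sign o1) (measurable_sign oh) pat.
rewrite (sign_measure _ (Z_pos laws)) (sign_measure o0 (Gu_pos laws)).
rewrite (sign_measure o1 (Gu_pos laws)) (sign_measure oh (Gv_pos laws)).
rewrite -!EFinM -lee_fin -(prE P mA) => /le_trans; apply; apply: le_measure; rewrite ?inE //.
apply: measurable_forall => r _.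
by apply: measurable_and3; apply: measurable_imply; apply: measurable_le.
Qed.

Let signP (o : option bool) (x : R) : sign_set o x ->
  match o with Some true => 0 < x /\ pos x = x | Some false => pos x = 0 | None => True end.
Proof.
case: o => [[]|] //=; rewrite in_itv /= ?andbT.
  by have [[_ [-> _]]|[? _]] := posP x; [|lra].
by have [[? [-> _]]|[_ [-> _]]] := posP x; [lra|].
Qed.

Let mle r x : measurable [set t | xi r t <= x].
Proof. by apply: measurable_le => //; exact: measurable_cst. Qed.

Let mge r x : measurable [set t | x <= xi r t].
Proof. by apply: measurable_le => //; exact: measurable_cst. Qed.

Let half (x : R) : unit_point x -> unit_point (x / 2) /\ x / 2 < x.
Proof. by move=> /andP[x0 x1]; split; [apply/andP; split|]; lra. Qed.

Lemma marginal_ge r u : (r < 2)%N -> unit_point u -> 1 - u <= pr P [set t | tau u <= xi r t].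
Proof.
move=> r2 u01; have [v01 vu] := half u01.
pose o i := if i == r then Some false else None.
have := @cell_bound (u / 2) u None (o 0%N) (o 1%N) None xpred0 (pred1 r) xpred0
  [set t | tau u <= xi r t] v01 u01 vu _ (mge _ _) _.
have -> : sign_weight None (u / 2 / u) * (sign_weight (o 0%N) u * (sign_weight (o 1%N) u *
    sign_weight None (u / 2))) = 1 - u.
  by rewrite /o; clear o; case: r r2 => [|[|]] //= _; ring.
apply=> [z g0 g1 h _ /signP h0 /signP h1 _ i i2|t /(_ r r2)[_ ht _] /=]; last by apply: ht; exact/eqP.
split=> // /eqP ir; subst i; move: h0 h1; rewrite /o /increment_u; clear o i2.
by case: r r2 => [|[|]] //= _ => [->|_ ->].
Qed.

Lemma marginal_le r u : (r < 2)%N -> unit_point u -> u <= pr P [set t | xi r t <= tau u].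
Proof.
move=> r2 u01; have [v01 vu] := half u01.
pose o i := if i == r then Some true else None.
have := @cell_bound (u / 2) u None (o 0%N) (o 1%N) None xpred0 xpred0 (pred1 r)
  [set t | xi r t <= tau u] v01 u01 vu _ (mle _ _) _.
have -> : sign_weight None (u / 2 / u) * (sign_weight (o 0%N) u * (sign_weight (o 1%N) u *
    sign_weight None (u / 2))) = u.
  by rewrite /o; clear o; case: r r2 => [|[|]] //= _; ring.
apply=> [z g0 g1 h _ /signP h0 /signP h1 _ i i2|t /(_ r r2)[_ _ ht] /=]; last by apply: ht; exact/eqP.
split=> // /eqP ir; subst i; move: h0 h1; rewrite /o /increment_u; clear o i2.
by case: r r2 => [|[|]] //= _ => [[? ->]|_ [? ->]].
Qed.

Lemma no_atom r u : (r < 2)%N -> unit_point u -> pr P [set t | xi r t = tau u] = 0.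
Proof.
move=> r2 u01; have /andP[u0 u1] := u01.
have upper x : unit_point x -> pr P [set t | xi r t <= tau x] <= x.
  move=> x01; have /andP[x0 x1] := x01; apply/ler_addgt0Pr => e e0.
  pose y := Num.min (x + e) ((1 + x) / 2).
  have [y1 y2 y3] : [/\ y <= x + e, x < y & y < 1].
    by rewrite /y; have [[? ->]|[? ->]] := minP (x + e) ((1 + x) / 2); split; lra.
  have y01 : unit_point y by apply/andP; split; lra.
  have := marginal_ge r2 y01; have txy := tau_lt x01 y01 y2.
  have : pr P [set t | xi r t <= tau x] + pr P [set t | tau y <= xi r t] <= 1.
    rewrite -pr_setU //; first by rewrite -(pr_setT P); apply: pr_le => //; exact: measurableU.
    by apply/seteqP; split => // t [/= h1 h2]; have := le_trans h2 h1; rewrite leNgt txy.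
  by lra.
have lower : pr P [set t | tau u <= xi r t] <= 1 - u.
  apply/ler_addgt0Pr => e e0.
  pose y := Num.max (u - e) (u / 2).
  have [y1 y2 y3] : [/\ u - e <= y, y < u & 0 < y].
    by rewrite /y; case: (leP (u - e) (u / 2)) => ?; split; lra.
  have y01 : unit_point y by apply/andP; split; lra.
  have := marginal_le r2 y01; have tyu := tau_lt y01 u01 y2.
  have : pr P [set t | xi r t <= tau y] + pr P [set t | tau u <= xi r t] <= 1.
    rewrite -pr_setU //; first by rewrite -(pr_setT P); apply: pr_le => //; exact: measurableU.
    by apply/seteqP; split => // t [/= h1 h2]; have := le_trans h2 h1; rewrite leNgt tyu.
  by lra.
have meq : measurable [set t | xi r t = tau u].
  by apply: measurable_eq => //; exact: measurable_cst.
have mlt : measurable [set t | xi r t < tau u].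
  by apply: measurable_lt => //; exact: measurable_cst.
have split_le : pr P [set t | xi r t <= tau u] = pr P [set t | xi r t < tau u] + pr P [set t | xi r t = tau u].
  rewrite -pr_setU //.
    congr (pr P _); apply/seteqP; split => t /=.
      by rewrite le_eqVlt => /orP[/eqP|]; [right|left].
    by move=> [/ltW|->].
  by apply/seteqP; split => // t [/= h ht]; move: h; rewrite ht ltxx.
have total : 1 = pr P [set t | xi r t < tau u] + pr P [set t | tau u <= xi r t].
  rewrite -pr_setU //.
    rewrite -(pr_setT P); congr (pr P _); apply/seteqP; split => // t _ /=.
    by case: (ltP (xi r t) (tau u)); [left|right].
  by apply/seteqP; split => // t [/= h ht]; move: h; rewrite ltNge ht.
have := upper u u01; have := marginal_le r2 u01; have := marginal_ge r2 u01.
have := pr_ge0 P [set t | xi r t = tau u]; lra.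
Qed.

Lemma slice_bound r v u (oz o0 o1 oh : option bool) (sb tb pb : nat -> bool) (E : set T) :
  (r < 2)%N -> unit_point v -> unit_point u -> v < u ->
  (forall z g0 g1 h, sign_set oz z -> sign_set o0 g0 -> sign_set o1 g1 -> sign_set oh h ->
   forall r, (r < 2)%N ->
   [/\ sb r -> increment_v z g0 g1 h r <= 0, tb r -> increment_u z g0 g1 h r <= 0 &
      pb r -> 0 < increment_u z g0 g1 h r]) ->
  measurable E -> sb r -> pb r ->
  (forall t, (forall r, (r < 2)%N ->
    [/\ sb r -> tau v <= xi r t, tb r -> tau u <= xi r t & pb r -> xi r t <= tau u]) ->
    xi r t < tau u -> E t) ->
  sign_weight oz (v / u) * (sign_weight o0 u * (sign_weight o1 u * sign_weight oh v)) <=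
  pr P (E `&` [set t | tau v <= xi r t < tau u]).
Proof.
move=> r2 v01 u01 vu pat mE sbr pbr HE.
have mslice : measurable [set t | tau v <= xi r t < tau u].
  rewrite (_ : [set _ | _] = [set t | tau v <= xi r t] `&` [set t | xi r t < tau u]).
    by apply: measurableI => //; apply: measurable_lt => //; exact: measurable_cst.
  by apply/seteqP; split => t /=; [move=> /andP|move=> [-> ->]].
have matom : measurable [set t | xi r t = tau u].
  by apply: measurable_eq => //; exact: measurable_cst.
have mB : measurable (E `&` [set t | tau v <= xi r t < tau u]) by exact: measurableI.
rewrite -[leRHS]addr0 -(no_atom r2 u01); apply: le_trans (pr_setU_le _ mB matom).
apply: (cell_bound v01 u01 vu pat); first exact: measurableU.
move=> t H; have [h1 _ h3] := H r r2; have := h3 pbr; rewrite le_eqVlt => /orP[/eqP|lt].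
  by right.
by left; split; [exact: HE|rewrite /= h1 ?lt].
Qed.

Section Partition.
Variable m : nat.

Let n : R := m.+2%:R.
Let point (k : nat) : R := k.+1%:R / n.

Let n0 : 0 < n. Proof. by rewrite ltr0n. Qed.

Let mE : m%:R = n - 2.
Proof. by rewrite /n -!natr1; ring. Qed.

Let point01 k : (k <= m)%N -> unit_point (point k).
Proof.
by move=> km; apply/andP; rewrite divr_gt0 ?ltr0n // ltr_pdivrMr // mul1r ltr_nat !ltnS.
Qed.

Let point_lt k : point k < point k.+1.
Proof. by rewrite ltr_pM2r ?invr_gt0 // ltr_nat. Qed.

Let th k := tau (point k).

Let th_le k : (k < m)%N -> th k <= th k.+1.
Proof. by move=> km; apply: ltW; apply: tau_lt => //; apply: point01 => //; exact: ltnW. Qed.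

Let mlt : measurable [set t | xi 0 t < xi 1 t]. Proof. exact: measurable_lt. Qed.
Let mgt : measurable [set t | xi 1 t < xi 0 t]. Proof. exact: measurable_lt. Qed.

Let weight_cell (k : nat) (x y : R) : (k < m)%N ->
  (1 - point k / point k.+1) * (point k.+1 * (x * y)) = x * y / n.
Proof.
move=> km; have k1 : point k.+1 != 0 by rewrite gt_eqF //; case/andP: (point01 km).
have -> : (1 - point k / point k.+1) * (point k.+1 * (x * y)) = (point k.+1 - point k) * (x * y).
  by field.
by rewrite /point -mulrBl -natrB // subSnn mul1r mulrC.
Qed.

Let compl k : 1 - point k.+1 = (m%:R - k%:R) / n.
Proof. by rewrite /point mE -!natr1; field; rewrite gt_eqF. Qed.

Let compl' k : 1 - point k = (m%:R + 1 - k%:R) / n.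
Proof. by rewrite /point mE -!natr1; field; rewrite gt_eqF. Qed.

Lemma pr_lt_partition : 1 / 2 - 3 / n <= pr P [set t | xi 0 t < xi 1 t].
Proof.
have bound k : (k < m)%N -> (m%:R - k%:R) / n ^+ 2 <=
    pr P ([set t | xi 0 t < xi 1 t] `&` [set t | th k <= xi 0 t < th k.+1]).
  move=> km; have p1 := point01 (ltnW km); have p2 := point01 km; have lt := point_lt k.
  have -> : (m%:R - k%:R) / n ^+ 2 = sign_weight (Some false) (point k / point k.+1) *
      (sign_weight (Some true) (point k.+1) * (sign_weight (Some false) (point k.+1) *
       sign_weight None (point k))).
    by rewrite /= weight_cell // compl mulr1; field; rewrite gt_eqF.
  apply: (@slice_bound 0 _ _ _ _ _ _ (pred1 0%N) (pred1 1%N) (pred1 0%N)) => //.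
    move=> z g0 g1 h /signP zE /signP[g00 g0E] /signP g1E _ r r2.
    split=> /eqP ->; rewrite /increment_v /increment_u ?zE ?g1E ?g0E //.
    by rewrite min_r // ltW.
  by move=> t H lt_xi; apply: (lt_le_trans lt_xi); have [_ h _] := H 1%N isT; exact: h.
apply: le_trans (pr_slices (th := th) (mxi 0) mlt th_le bound).
rewrite -mulr_suml sum_linear mE.
rewrite -subr_ge0 [X in 0 <= X](_ : _ = (3 * n + 2) / (2 * n ^+ 2)).
  by rewrite divr_ge0 ?mulr_ge0 ?sqr_ge0 // addr_ge0 // mulr_ge0 // ltW.
by field; rewrite gt_eqF.
Qed.

Lemma pr_gt_partition : 1 / 3 - 3 / n <= pr P [set t | xi 1 t < xi 0 t].
Proof.
have bound k : (k < m)%N -> (m%:R - k%:R) * (m%:R + 1 - k%:R) / n ^+ 3 <=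
    pr P ([set t | xi 1 t < xi 0 t] `&` [set t | th k <= xi 1 t < th k.+1]).
  move=> km; have p1 := point01 (ltnW km); have p2 := point01 km; have lt := point_lt k.
  have -> : (m%:R - k%:R) * (m%:R + 1 - k%:R) / n ^+ 3 =
      sign_weight (Some false) (point k / point k.+1) *
      (sign_weight (Some false) (point k.+1) * (sign_weight (Some true) (point k.+1) *
       sign_weight (Some false) (point k))).
    rewrite /= [X in _ = _ * X]mulrCA weight_cell // compl compl'.
    by field; rewrite gt_eqF.
  apply: (@slice_bound 1 _ _ _ _ _ _ (pred1 1%N) (pred1 0%N) (pred1 1%N)) => //.
    move=> z g0 g1 h /signP zE /signP g0E /signP[g10 g1E] /signP hE r r2.
    split=> /eqP ->; rewrite /increment_v /increment_u ?zE ?g1E ?g0E ?hE //.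
    by rewrite subr0 /pos maxxx addr0 min_r // ltW.
  by move=> t H lt_xi; apply: (lt_le_trans lt_xi); have [_ h _] := H 0%N isT; exact: h.
apply: le_trans (pr_slices (th := th) (mxi 1) mgt th_le bound).
rewrite -mulr_suml sum_square mE.
rewrite -subr_ge0 [X in 0 <= X](_ : _ = (6 * n + 2) / (3 * n ^+ 2)).
  by rewrite divr_ge0 ?mulr_ge0 ?sqr_ge0 // addr_ge0 // mulr_ge0 // ltW.
by field; rewrite gt_eqF.
Qed.

(* At most [1 / e] cells have more than width [e] in direction, and each has
   probability at most [1 / n]; the telescoping sum of widths accounts for them. *)
Lemma pr_near_partition (e : R) : 0 < e ->
  1 / 6 - (3 + e^-1) / n <= pr P [set t | `|xi 0 t - xi 1 t| <= e].
Proof.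
move=> e0; set E := [set t | _].
have mEE : measurable E.
  apply: measurable_le => //; apply: measurableT_comp => //; exact: measurable_funB.
have bound k : (k < m)%N -> (k%:R + 2) * (m%:R + 1 - k%:R) / n ^+ 3 - (th k.+1 - th k) / (n * e) <=
    pr P (E `&` [set t | th k <= xi 0 t < th k.+1]).
  move=> km; have p1 := point01 (ltnW km); have p2 := point01 km; have lt := point_lt k.
  have km' : k%:R + 1 <= m%:R :> R by rewrite natr1 ler_nat.
  have wE : (k%:R + 2) * (m%:R + 1 - k%:R) / n ^+ 3 = point k.+1 * (1 - point k) / n.
    by rewrite compl' /point -!natr1; field; rewrite gt_eqF.
  have th0 : 0 <= th k.+1 - th k by rewrite subr_ge0 th_le.
  have [wide|narrow] := ltP e (th k.+1 - th k).
    apply: le_trans (pr_ge0 _ _); rewrite subr_le0 wE.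
    have /andP[? ?] := p1; have /andP[? ?] := p2.
    apply: (@le_trans _ _ (1 / n)).
      rewrite ler_pM2r ?invr_gt0 //; nra.
    rewrite invfM [n^-1 * _]mulrC mulrA ler_pM2r ?invr_gt0 // ler_pdivlMr // mul1r.
    exact: ltW.
  apply: (@le_trans _ _ (point k.+1 * (1 - point k) / n)).
    by rewrite wE gerBl divr_ge0 // mulr_ge0 // ltW.
  have -> : point k.+1 * (1 - point k) / n =
      sign_weight (Some false) (point k / point k.+1) *
      (sign_weight (Some true) (point k.+1) * (sign_weight (Some true) (point k.+1) *
       sign_weight (Some false) (point k))).
    by rewrite /= weight_cell.
  pose b : nat -> bool := xpredT.
  apply: (@slice_bound 0 _ _ _ _ _ _ b xpred0 b) => //.
    move=> z g0 g1 h /signP zE /signP[g00 g0E] /signP[g10 g1E] /signP hE [|[|]] // _;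
      rewrite /increment_v /increment_u ?zE ?g1E ?g0E ?hE; split=> // _.
    + by rewrite min_r // ltW.
    + by rewrite /pos (max_r (_ : 0 - g0 <= 0)) ?addr0 ?min_r ?(ltW g10) // sub0r oppr_le0 ltW.
  move=> t H lt_xi; have [/(_ isT) h1 _ /(_ isT) h2] := H 0%N isT.
  have [/(_ isT) h3 _ /(_ isT) h4] := H 1%N isT.
  move: narrow; rewrite /E /= /th ler_norml => ?; apply/andP; split; lra.
apply: le_trans (pr_slices (th := th) (mxi 0) mEE th_le bound).
rewrite sumrB -!mulr_suml.
have -> : \sum_(k < m) (th k.+1 - th k) = th m - th 0.
  by rewrite -(big_mkord xpredT (fun k => th k.+1 - th k)) telescope_sumr.
have thle : th m - th 0 <= 1.
  have /andP[_ h1] := tau01 (point01 (leqnn m)); have /andP[h2 _] := tau01 (point01 (leq0n m)).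
  by rewrite /th; lra.
have h : (th m - th 0) / (n * e) <= e^-1 / n.
  by rewrite invfM [n^-1 * _]mulrC mulrA ler_pM2r ?invr_gt0 // ler_piMl // invr_ge0 ltW.
rewrite sum_product mE.
have : 1 / 6 - 3 / n <= (2 * (n - 2 + 1) * (n - 2) + (n - 2 + 1 - 2) * ((n - 2) * (n - 2 - 1) / 2) -
   (n - 2 - 1) * (n - 2) * (2 * (n - 2) - 1) / 6) / n ^+ 3.
  rewrite -subr_ge0 [X in 0 <= X](_ : _ = (21 * n - 10) / (6 * n ^+ 2)).
    rewrite divr_ge0 ?mulr_ge0 ?sqr_ge0 //; have : 2 <= n by rewrite ler_nat.
    by lra.
  by field; rewrite gt_eqF.
by move=> hh; rewrite mulrDl opprD addrA; apply: lerB.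
Qed.

End Partition.

Lemma pr_lt : 1 / 2 <= pr P [set t | xi 0 t < xi 1 t].
Proof. by apply: (@le_harmonic _ _ _ 3) => m; exact: pr_lt_partition. Qed.

Lemma pr_gt : 1 / 3 <= pr P [set t | xi 1 t < xi 0 t].
Proof. by apply: (@le_harmonic _ _ _ 3) => m; exact: pr_gt_partition. Qed.

Lemma pr_eq : 1 / 6 <= pr P [set t | xi 0 t = xi 1 t].
Proof.
pose A k := [set t | `|xi 0 t - xi 1 t| <= (k.+1%:R)^-1].
have mA k : measurable (A k).
  by apply: measurable_le => //; apply: measurableT_comp => //; exact: measurable_funB.
have bound k : ((1 / 6)%:E <= P (A k))%E.
  rewrite prE // lee_fin; apply: (@le_harmonic _ _ _ (3 + (k.+1%:R)^-1^-1)) => m.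
  by apply: pr_near_partition; rewrite invr_gt0.
have decr k : A k.+1 `<=` A k.
  by move=> t /= /le_trans; apply; rewrite lef_pV2 ?posrE // ler_nat.
have := decreasing_bound mA decr bound.
have -> : \bigcap_k A k = [set t | xi 0 t = xi 1 t].
  apply/seteqP; split => t /= h; last by move=> k _; rewrite /A /= h subrr normr0 invr_ge0.
  apply/eqP; rewrite -subr_eq0 -normr_le0; apply/ler_addgt0Pl => e e0; rewrite addr0.
  apply: (le_trans (h (Num.truncn e^-1) Logic.I)).
  by rewrite -[leRHS]invrK lef_pV2 ?posrE ?invr_gt0 // ltW // truncnS_gt.
by rewrite prE ?lee_fin //; exact: measurable_eq.
Qed.

Lemma angle_probabilities :
  [/\ measurable [set t | xi 0 t > xi 1 t] /\ P [set t | xi 0 t > xi 1 t] = (1 / 3 : R)%:E,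
      measurable [set t | xi 0 t = xi 1 t] /\ P [set t | xi 0 t = xi 1 t] = (1 / 6 : R)%:E &
      measurable [set t | xi 0 t < xi 1 t] /\ P [set t | xi 0 t < xi 1 t] = (1 / 2 : R)%:E].
Proof.
have mgt : measurable [set t | xi 1 t < xi 0 t] by exact: measurable_lt.
have mlt : measurable [set t | xi 0 t < xi 1 t] by exact: measurable_lt.
have meq : measurable [set t | xi 0 t = xi 1 t] by exact: measurable_eq.
have total : pr P [set t | xi 0 t < xi 1 t] + pr P [set t | xi 0 t = xi 1 t] +
    pr P [set t | xi 1 t < xi 0 t] = 1.
  rewrite -(pr_setU _ mlt meq); last first.
    by apply/seteqP; split => // t [/= h h']; move: h; rewrite h' ltxx.
  rewrite -(pr_setU _ (measurableU _ _ mlt meq) mgt); last first.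
    apply/seteqP; split => // t [/= [h|h] h']; first by have := lt_trans h h'; rewrite ltxx.
    by move: h'; rewrite h ltxx.
  rewrite -(pr_setT P); congr (pr P _); apply/seteqP; split => // t _ /=.
  by case: (ltgtP (xi 0 t) (xi 1 t)) => ?; [left; left|right|left; right].
have h1 := pr_lt; have h2 := pr_gt; have h3 := pr_eq.
by split; split=> //; rewrite prE //; congr EFin; lra.
Qed.

End Final.

Section Law.
Context (R : realType) d (T : measurableType d) (P : probability T R).
Variables (omega : site -> T -> R) (law : set R -> \bar R).
Hypothesis iid : iid_with_law P omega law.

Lemma iid_independent_on : exists W : probability R R,
  (forall A, measurable A -> W A = law A) /\ independent_on P predT (fun _ => W) omega.
Proof.
have [momega [hlaw ind]] := iid.
have [nu nuE] := pushforward_measure P (momega (0%Z, 0%Z)).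
have nuT : nu setT = 1%E by rewrite nuE preimage_setT; exact: probability_setT P.
have [W WE'] := measure_probability nuT.
have WE A : measurable A -> W A = law A by move=> mA; rewrite WE' nuE hlaw.
exists W; split=> //; split=> // s A us _ mA; rewrite /box ind //.
by apply: eq_bigr => x _; rewrite hlaw // WE.
Qed.

End Law.

Theorem theorem2p12 (R : realType) (d : measure_display) (T : measurableType d)
  (P : probability T R) (omega : site -> T -> R) (p a : R) :
  ((0 < p <= 1 /\ 0 < a /\ iid_with_law P omega (law_BerExp p a)) \/
   (0 < p < 1 /\ iid_with_law P omega (law_Ber p))) ->
  let xi0 := fun o => crit_angle (fun x => omega x o) (0%Z, 0%Z) in
  let xie2 := fun o => crit_angle (fun x => omega x o) e2 in
  [/\ measurable [set o | xi0 o > xie2 o] /\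
        P [set o | xi0 o > xie2 o] = (1 / 3 : R)%:E,
      measurable [set o | xi0 o = xie2 o] /\
        P [set o | xi0 o = xie2 o] = (1 / 6 : R)%:E &
      measurable [set o | xi0 o < xie2 o] /\
        P [set o | xi0 o < xie2 o] = (1 / 2 : R)%:E].
Proof.
move=> [[p01 [a0 iid]]|[p01 iid]]; have [W [WE indep]] := iid_independent_on iid.
- have [c curve] := exponential_curve p01 a0.
  exact: (angle_probabilities (exponential_model p01 a0 WE) curve indep).
- have [c curve] := bernoulli_curve p01.
  exact: (angle_probabilities (bernoulli_model p01 WE) curve indep).
Qed.
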